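(* Let $\mathcal{H}$ be the class of stars, the class of trees, or the class of forests. Then $\mathcal{H}$-Identification is NP-complete, and it is W[1]-hard when parameterized by $n-k$, where $n$ is the number of vertices of the input graph and $k$ the input integer.
   Context: All graphs are finite, simple and undirected. An identification of two distinct vertices $u,v$ replaces them with a new vertex adjacent to every vertex of $(N(u)\cup N(v))\setminus\{u,v\}$. For a graph class $\mathcal{H}$, $\mathcal{H}$-Identification takes as input a graph $G$ and an integer $k\ge 0$ and asks whether $G$ can be transformed into a graph in $\mathcal{H}$ by at most $k$ identifications. A star is a tree in which all vertices except at most one are of degree at most $1$. *)

(* Defs.v *)
From mathcomp Require Import all_boot.

Set Implicit Arguments.
Unset Strict Implicit.
Unset Printing Implicit Defensive.

(** * Multi-tape Turing machines over bit strings *)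

Variant direction := MoveL | MoveR | Stay.

(* Deterministic machine with [tm_tapes.+1] two-way infinite tapes.  The tape
   alphabet is [option (bool + tm_aux)]: [None] is the blank, [Some (inl b)] is
   the bit [b], [Some (inr a)] is an auxiliary symbol. *)
Record tm := TM {
  tm_tapes : nat;
  tm_state : finType;
  tm_aux : finType;
  tm_start : tm_state;
  tm_halt : pred tm_state;
  tm_trans : tm_state ->
    {ffun 'I_tm_tapes.+1 -> option (bool + tm_aux)} ->
    tm_state * {ffun 'I_tm_tapes.+1 -> option (bool + tm_aux) * direction}
}.

Definition tm_sym (M : tm) : Type := option (bool + tm_aux M).

(* [(l, r)]: the head scans the first symbol of [r]; [l] lists the symbols to
   its left, nearest first.  Everything beyond [l] and [r] is blank. *)
Definition tape (M : tm) : Type := (seq (tm_sym M) * seq (tm_sym M))%type.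

Section Run.
Variable M : tm.

Definition scanned (t : tape M) : tm_sym M := head None t.2.

Definition write_move (a : tm_sym M * direction) (t : tape M) : tape M :=
  let: (l, r) := t in
  match a.2 with
  | Stay => (l, a.1 :: behead r)
  | MoveR => (a.1 :: l, behead r)
  | MoveL => (behead l, head None l :: a.1 :: behead r)
  end.

Definition config : Type :=
  (tm_state M * ('I_(tm_tapes M).+1 -> tape M))%type.

Definition tm_step (c : config) : config :=
  if tm_halt c.1 then c else
  let: (q, act) := tm_trans c.1 [ffun i => scanned (c.2 i)] in
  (q, fun i => write_move (act i) (c.2 i)).

Definition tm_init (x : seq bool) : config :=
  (tm_start M,
   fun i => ([::], if i == ord0 then [seq Some (inl b) | b <- x] else [::])).

Fixpoint leading_bits (s : seq (tm_sym M)) : seq bool :=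
  if s is Some (inl b) :: s' then b :: leading_bits s' else [::].

(* The output is the maximal block of bits starting at the head of the input
   tape.  As halting configurations are fixed by [tm_step], this says that [M]
   halts on [x] after at most [t] steps, with output [y]. *)
Definition outputs_within (x y : seq bool) (t : nat) : Prop :=
  let c := iter t tm_step (tm_init x) in
  tm_halt c.1 /\ leading_bits (c.2 ord0).2 = y.

End Run.

Definition computable (f : nat -> nat) : Prop :=
  exists M : tm, forall n, exists t,
    outputs_within M (nseq n true) (nseq (f n) true) t.

Definition polytime (f : seq bool -> seq bool) : Prop :=
  exists (M : tm) (c : nat), forall x,
    outputs_within M x (f x) (c * (size x).+1 ^ c).

(** * NP-completeness *)

(* Self-delimiting pairing of bit strings: every bit of [x] is preceded by
   [true], and [false] marks the end of [x]. *)
Fixpoint pair_str (x y : seq bool) : seq bool :=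
  if x is b :: x' then [:: true, b & pair_str x' y] else false :: y.

Definition language := seq bool -> Prop.

Definition in_NP (L : language) : Prop :=
  exists (V : seq bool -> seq bool) (c : nat), polytime V /\
    forall x, L x <->
      exists y, size y <= c * (size x).+1 ^ c /\ V (pair_str x y) = [:: true].

Definition poly_reduces (L L' : language) : Prop :=
  exists f, polytime f /\ forall x, L x <-> L' (f x).

Definition NP_hard (L : language) : Prop :=
  forall L', in_NP L' -> poly_reduces L' L.

Definition NP_complete (L : language) : Prop := in_NP L /\ NP_hard L.

(** * Parameterized problems and W[1]-hardness *)

(* A set of pairs (instance, parameter). *)
Definition param_problem := seq bool -> nat -> Prop.

(* As an algorithm's input or output, the parameter is written in unary. *)
Definition param_str (x : seq bool) (k : nat) := pair_str (nseq k true) x.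

Definition fpt_reduces (P Q : param_problem) : Prop :=
  exists (M : tm) (R : seq bool -> nat -> seq bool * nat)
         (f g : nat -> nat) (c : nat),
    [/\ computable f, computable g &
     forall x k,
       [/\ outputs_within M (param_str x k) (param_str (R x k).1 (R x k).2)
             (f k * (size x).+1 ^ c),
           P x k <-> Q (R x k).1 (R x k).2 &
           (R x k).2 <= g k]].

Variant gate :=
  | Input
  | Not of nat
  | And of seq nat
  | Or of seq nat.

(* Nodes in topological order: the arguments of a gate are indices of earlier
   nodes.  The output is the last node. *)
Definition circuit := seq gate.

Definition is_input (g : gate) := if g is Input then true else false.

Definition gate_args (g : gate) : seq nat :=
  match g with Input => [::] | Not i => [:: i] | And s => s | Or s => s end.

Definition circuit_wf (C : circuit) : Prop :=
  forall j, j < size C -> all (fun i => i < j) (gate_args (nth Input C j)).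

(* Evaluates all nodes in order; [h vs g] is the value of a node of type [g]
   when [vs] lists the values of the nodes before it. *)
Definition node_values (T : Type) (h : seq T -> gate -> T) (C : circuit) :=
  foldl (fun vs g => rcons vs (h vs g)) [::] C.

(* [a] is indexed by node and only read at the input nodes. *)
Definition circuit_value (a : nat -> bool) (C : circuit) : bool :=
  last false (node_values (fun vs g => match g with
    | Input => a (size vs)
    | Not i => ~~ nth false vs i
    | And s => all (nth false vs) s
    | Or s => has (nth false vs) s
    end) C).

Definition circuit_weight (a : nat -> bool) (C : circuit) : nat :=
  count (fun j => is_input (nth Input C j) && a j) (iota 0 (size C)).

(* Maximal number of gates on a path from an input to the output. *)
Definition circuit_depth (C : circuit) : nat :=
  last 0 (node_values (fun ds g =>
    if is_input g then 0 else (\max_(i <- gate_args g) nth 0 ds i).+1) C).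

(* Maximal number of large gates (fan-in above 2) on such a path. *)
Definition circuit_weft (C : circuit) : nat :=
  last 0 (node_values (fun ws g =>
    \max_(i <- gate_args g) nth 0 ws i + (2 < size (gate_args g))) C).

Definition unary_str (n : nat) : seq bool := rcons (nseq n true) false.

Definition list_str (s : seq nat) : seq bool :=
  unary_str (size s) ++ flatten (map unary_str s).

Definition gate_str (g : gate) : seq bool :=
  match g with
  | Input => [:: false; false]
  | Not i => [:: false, true & unary_str i]
  | And s => [:: true, false & list_str s]
  | Or s => [:: true, true & list_str s]
  end.

Definition circuit_str (C : circuit) : seq bool :=
  unary_str (size C) ++ flatten (map gate_str C).

(* Weighted circuit satisfiability for circuits of weft at most [t] and depth
   at most [d], parameterized by the weight. *)
Definition WCS (t d : nat) : param_problem := fun x k =>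
  exists C : circuit,
    [/\ x = circuit_str C, circuit_wf C, circuit_weft C <= t,
        circuit_depth C <= d &
        exists a, circuit_weight a C = k /\ circuit_value a C].

Definition in_W (t : nat) (P : param_problem) : Prop :=
  exists d, fpt_reduces P (WCS t d).

Definition W1_hard (Q : param_problem) : Prop :=
  forall P, in_W 1 P -> fpt_reduces P Q.

(** * Graphs and identifications *)

Record sgraph := SGraph {
  vertex : finType;
  edge : rel vertex;
  edge_sym : symmetric edge;
  edge_irr : irreflexive edge
}.

Definition degree (G : sgraph) (x : vertex G) := #|[set y | edge x y]|.

Section Identify.
Variables (G : sgraph) (u v : vertex G).

(* [None] is the new vertex. *)
Definition ident_vertex : finType :=
  option {x : vertex G | (x != u) && (x != v)}.

Definition ident_edge : rel ident_vertex := fun a b =>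
  match a, b with
  | Some x, Some y => edge (val x) (val y)
  | None, Some x | Some x, None => edge u (val x) || edge v (val x)
  | None, None => false
  end.

Lemma ident_edge_sym : symmetric ident_edge.
Proof. by case=> [x|] [y|] //=; rewrite edge_sym. Qed.

Lemma ident_edge_irr : irreflexive ident_edge.
Proof. by case=> [x|] //=; rewrite edge_irr. Qed.

Definition identify : sgraph := SGraph ident_edge_sym ident_edge_irr.

End Identify.

(* [identifications m G G']: [G'] arises from [G] by exactly [m]
   identifications. *)
Inductive identifications : nat -> sgraph -> sgraph -> Prop :=
  | Ident0 G : identifications 0 G G
  | IdentS m G (u v : vertex G) G' :
      u != v -> identifications m (identify u v) G' ->
      identifications m.+1 G G'.

Definition is_forest (G : sgraph) : Prop :=
  forall s : seq (vertex G), 2 < size s -> ~ ucycle (@edge G) s.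

Definition is_connected (G : sgraph) : Prop :=
  0 < #|vertex G| /\ forall x y : vertex G, connect (@edge G) x y.

Definition is_tree (G : sgraph) : Prop := is_connected G /\ is_forest G.

Definition is_star (G : sgraph) : Prop :=
  is_tree G /\ #|[set x : vertex G | 1 < degree x]| <= 1.

Definition identifiable (H : sgraph -> Prop) (G : sgraph) (k : nat) : Prop :=
  exists m G', [/\ m <= k, identifications m G G' & H G'].

(* Value of a binary numeral, least significant bit first. *)
Definition binval (s : seq bool) : nat := foldr (fun (b : bool) n => b + n.*2) 0 s.

(* [x] encodes the graph with vertex set ['I_n] and adjacency relation [e],
   given by its adjacency matrix, together with [k] in binary. *)
Definition encodes (x : seq bool) (n : nat) (e : rel 'I_n) (k : nat) : Prop :=
  exists s, binval s = k /\
    x = pair_str (nseq n true)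
          (pair_str [seq e i j | i <- enum 'I_n, j <- enum 'I_n] s).

Definition Identification (H : sgraph -> Prop) : language := fun x =>
  exists n (e : rel 'I_n) (es : symmetric e) (ei : irreflexive e) k,
    encodes x e k /\ identifiable H (SGraph es ei) k.

(* The parameter is n - k; instances with k > n have no parameter. *)
Definition Identification_dual (H : sgraph -> Prop) : param_problem :=
  fun x p =>
  exists n (e : rel 'I_n) (es : symmetric e) (ei : irreflexive e) k,
    [/\ encodes x e k, p + k = n & identifiable H (SGraph es ei) k].

(* Main.v *)
(* Identifications turn a graph into its quotients, so [G] is a yes-instance iff
   some quotient of [G] with at least [n - k] vertices is in the class.  If [G]
   has a universal vertex [z], a quotient is a forest iff the parts other than
   that of [z] are pairwise non-adjacent (otherwise there is a triangle), and
   then it is even a star; choosing one vertex per part shows that all three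
   problems ask for an independent set of size [n - k - 1] in [G - z].

   Independent sets of size [q] in the complement of a graph encode binary
   constraint problems with [q] variables.
   - NP-hardness: one variable per time step of the verifier, whose value
     records the state, the scanned symbols, the head positions and, for each
     tape, the time of the previous visit to the scanned cell.  The last item
     makes the consistency of the tapes a condition on pairs of time steps.
   - W[1]-hardness: let [X_1 < ... < X_k] be the true inputs.  The variables are
     the [2^d]-tuples of indices, valued by the corresponding pairs
     [(X_i, X_{i+1})].  Such a pair decides all inputs between its components,
     so every fan-in-2 circuit of depth [d] is decided by some variable; the top
     part of the circuit is handled by a proof tree of constant size, guessed in
     every variable.

   All reductions are functions on bit strings and numbers that are bounded by
   polynomials, obtained from bounded iteration.  They run on programs over
   finitely many stacks, which translate into Turing machines and conversely. *)

Require Import Defs.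
From mathcomp Require Import all_boot zify.
From Stdlib Require Import FunctionalExtensionality.

Set Implicit Arguments.
Unset Strict Implicit.
Unset Printing Implicit Defensive.

(** * Stack programs and their Turing machines *)

Section StackPrograms.
Variable aux : finType.

Definition symbol : finType := (bool + aux)%type.
Definition store := nat -> seq symbol.
Definition upd (m : store) (i : nat) (s : seq symbol) : store :=
  fun j => if j == i then s else m j.

Inductive prog :=
  | Skip
  | Push of nat & symbol
  | Pop of nat
  | Seq of prog & prog
  | Case of nat & (option symbol -> prog)
  | While of nat & pred (option symbol) & prog.

(* [exec p m n m']: started in [m], the program [p] halts in [m'] after exactly
   [n] steps. *)
Inductive exec : prog -> store -> nat -> store -> Prop :=
  | ExecSkip m : exec Skip m 1 m
  | ExecPush i a m : exec (Push i a) m 1 (upd m i (a :: m i))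
  | ExecPop i m : exec (Pop i) m 1 (upd m i (behead (m i)))
  | ExecSeq p q m n m1 n' m2 :
      exec p m n m1 -> exec q m1 n' m2 -> exec (Seq p q) m (n + n') m2
  | ExecCase i f m n m1 :
      exec (f (ohead (m i))) m n m1 -> exec (Case i f) m n.+1 m1
  | ExecWhileStop i (P : pred (option symbol)) p m :
      ~~ P (ohead (m i)) -> exec (While i P p) m 1 m
  | ExecWhileStep i (P : pred (option symbol)) p m n m1 n' m2 :
      P (ohead (m i)) -> exec p m n m1 -> exec (While i P p) m1 n' m2 ->
      exec (While i P p) m (n + n').+1 m2.

Lemma exec_size p m n m' :
  exec p m n m' -> forall i, size (m' i) <= size (m i) + n.
Proof.
elim=> {p m n m'} => [m i|i a m j|i m j|p q m n m1 n' m2 _ IHp _ IHq i|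
   i f m n m1 _ IH j|i P p m _ j|i P p m n m1 n' m2 _ _ IHp _ IHw j].
- lia.
- by rewrite /upd; case: eqP => [->|] /=; lia.
- by rewrite /upd; case: eqP => [->|]; rewrite ?size_behead; lia.
- by have := IHp i; have := IHq i; lia.
- by have := IH j; lia.
- lia.
- by have := IHp j; have := IHw j; lia.
Qed.

Definition runs p m n m' := exists2 t, t <= n & exec p m t m'.

Lemma runs_le p m n n' m' : runs p m n m' -> n <= n' -> runs p m n' m'.
Proof. by case=> t tn hp nn; exists t => //; apply: leq_trans tn nn. Qed.

Lemma runs_skip m n : 0 < n -> runs Skip m n m.
Proof. by exists 1 => //; apply: ExecSkip. Qed.

Lemma runs_push m i a : runs (Push i a) m 1 (upd m i (a :: m i)).
Proof. by exists 1 => //; apply: ExecPush. Qed.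

Lemma runs_pop m i : runs (Pop i) m 1 (upd m i (behead (m i))).
Proof. by exists 1 => //; apply: ExecPop. Qed.

Lemma runs_seq p q m n m1 n' m2 :
  runs p m n m1 -> runs q m1 n' m2 -> runs (Seq p q) m (n + n') m2.
Proof.
case=> t tn hp [t' tn' hq]; exists (t + t'); first exact: leq_add.
exact: ExecSeq hp hq.
Qed.

Lemma runs_case i f m n m' :
  runs (f (ohead (m i))) m n m' -> runs (Case i f) m n.+1 m'.
Proof. by case=> t tn hf; exists t.+1 => //; apply: ExecCase. Qed.

Lemma runs_while_stop i (P : pred (option symbol)) p m n :
  ~~ P (ohead (m i)) -> 0 < n -> runs (While i P p) m n m.
Proof. by exists 1 => //; apply: ExecWhileStop. Qed.

Lemma runs_while_step i (P : pred (option symbol)) p m n m1 n' m2 :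
  P (ohead (m i)) -> runs p m n m1 -> runs (While i P p) m1 n' m2 ->
  runs (While i P p) m (n + n').+1 m2.
Proof.
move=> hP [t tn hp] [t' tn' hw]; exists (t + t').+1; last exact: ExecWhileStep hw.
by rewrite ltnS leq_add.
Qed.

Lemma runs_while i (P : pred (option symbol)) p (ms : nat -> store) N T :
  (forall k, k < N -> P (ohead (ms k i)) /\ runs p (ms k) T (ms k.+1)) ->
  ~~ P (ohead (ms N i)) -> runs (While i P p) (ms 0) (N * T.+1).+1 (ms N).
Proof.
elim: N ms => [|N IH] ms step stop; first exact: runs_while_stop.
have [P0 run0] := step 0 isT; rewrite mulSn addSn -addnS.
exact: runs_while_step run0 (IH _ (fun k kN => step k.+1 kN) stop).
Qed.

Inductive instr (X : Type) :=
  | IPush of nat & symbol & X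
  | IPop of nat & X
  | ICase of nat & (option symbol -> X).

Definition map_instr X Y (h : X -> Y) (i : instr X) : instr Y :=
  match i with
  | IPush i a x => IPush i a (h x)
  | IPop i x => IPop i (h x)
  | ICase i f => ICase i (fun a => h (f a))
  end.

Definition step_instr X (i : instr X) (m : store) : X * store :=
  match i with
  | IPush i a x => (x, upd m i (a :: m i))
  | IPop i x => (x, upd m i (behead (m i)))
  | ICase i f => (f (ohead (m i)), m)
  end.

Definition instr_reg X (i : instr X) : nat :=
  match i with IPush i _ _ => i | IPop i _ => i | ICase i _ => i end.

Lemma instr_reg_map X Y (h : X -> Y) i : instr_reg (map_instr h i) = instr_reg i.
Proof. by case: i. Qed.

Inductive reach (Q : Type) (code : Q -> instr (option Q)) :
    option Q * store -> nat -> option Q * store -> Prop :=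
  | ReachRefl c : reach code c 0 c
  | ReachStep q m n c :
      reach code (step_instr (code q) m) n c -> reach code (Some q, m) n.+1 c.

Lemma reach_trans Q (code : Q -> instr (option Q)) c1 n1 c2 n2 c3 :
  reach code c1 n1 c2 -> reach code c2 n2 c3 -> reach code c1 (n1 + n2) c3.
Proof. by elim=> // q m n c _ IH /IH; rewrite addSn; apply: ReachStep. Qed.

Lemma reach_map Q1 Q2 (code1 : Q1 -> instr (option Q1))
    (code2 : Q2 -> instr (option Q2)) (g : Q1 -> Q2) (h : option Q1 -> option Q2) :
  (forall q, h (Some q) = Some (g q)) ->
  (forall q, code2 (g q) = map_instr h (code1 q)) ->
  forall x n y, reach code1 x n y -> reach code2 (h x.1, x.2) n (h y.1, y.2).
Proof.
move=> hS hcode x n y; elim=> [c|q m k c _ IH]; first exact: ReachRefl.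
rewrite /= hS; apply: ReachStep; rewrite hcode.
by case: (code1 q) IH => [i a z|i z|i f].
Qed.

(* The labels of a program are its control points; leaving the program is
   encoded by [None]. *)
Fixpoint label (p : prog) : finType :=
  match p with
  | Seq p q => (label p + label q)%type
  | Case _ f => option {a : option symbol & label (f a)}
  | While _ _ p => option (label p)
  | _ => unit
  end.

Fixpoint entry (p : prog) : label p :=
  match p with
  | Seq p q => inl (entry p)
  | Case _ _ => None
  | While _ _ _ => None
  | _ => tt
  end.

Fixpoint compile (p : prog) : label p -> instr (option (label p)) :=
  match p return label p -> instr (option (label p)) with
  | Skip => fun _ => ICase 0 (fun _ => None)
  | Push i a => fun _ => IPush i a None
  | Pop i => fun _ => IPop i None
  | Seq p q => fun l =>
      match l with
      | inl l => map_instr (fun o => Some (if o is Some l then inl l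
                                           else inr (entry q))) (compile l)
      | inr l => map_instr (omap inr) (compile l)
      end
  | Case i f => fun l =>
      match l with
      | None => ICase i (fun a => Some (Some (existT _ a (entry (f a)))))
      | Some (existT a l) =>
          map_instr (omap (fun l => Some (existT (fun a => label (f a)) a l)))
            (compile l)
      end
  | While i P p => fun l =>
      match l with
      | None => ICase i (fun a => if P a then Some (Some (entry p)) else None)
      | Some l => map_instr Some (compile l)
      end
  end.

Lemma exec_reach p m n m' :
  exec p m n m' -> reach (@compile p) (Some (entry p), m) n (None, m').
Proof.
elim=> {p m n m'}.
- by move=> m; apply: ReachStep; apply: ReachRefl.
- by move=> i a m; apply: ReachStep; apply: ReachRefl.
- by move=> i m; apply: ReachStep; apply: ReachRefl.
- move=> p q m n m1 n' m2 _ IHp _ IHq; apply: reach_trans.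
    by refine (reach_map (g := inl) (code2 := @compile (Seq p q)) (h := fun o =>
      Some (if o is Some l then inl l else inr (entry q))) _ _ IHp).
  by refine (reach_map (g := inr) (code2 := @compile (Seq p q))
    (h := omap inr) _ _ IHq).
- move=> i f m n m1 _ IH; apply: ReachStep => /=; set a := ohead (m i).
  pose g l := Some (existT (fun a => label (f a)) a l).
  by refine (reach_map (g := g) (code2 := @compile (Case i f)) (h := omap g) _ _ IH).
- move=> i P p m /negbTE hP; apply: ReachStep; rewrite /= hP; exact: ReachRefl.
- move=> i P p m n m1 n' m2 hP _ IHp _ IHw; apply: ReachStep; rewrite /= hP.
  apply: reach_trans IHw.
  by refine (reach_map (g := Some) (code2 := @compile (While i P p))
    (h := Some) _ _ IHp).
Qed.

Fixpoint max_reg (p : prog) : nat :=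
  match p with
  | Skip => 0
  | Push i _ => i
  | Pop i => i
  | Seq p q => maxn (max_reg p) (max_reg q)
  | Case i f => maxn i (\max_a max_reg (f a))
  | While i _ p => maxn i (max_reg p)
  end.

Lemma instr_reg_compile p (l : label p) : instr_reg (compile l) <= max_reg p.
Proof.
elim: p l => [|i a|i|p IHp q IHq|i f IH|i P p IH] //=.
- by case=> l; rewrite instr_reg_map leq_max ?IHp ?IHq ?orbT.
- case=> [[a l]|] /=; last by rewrite leq_maxl.
  by rewrite instr_reg_map (leq_trans (IH a l)) // leq_max (leq_bigmax a) orbT.
- by case=> [l|] /=; rewrite ?leq_maxl // instr_reg_map leq_max IH orbT.
Qed.

End StackPrograms.

Arguments Skip {aux}.
Arguments Pop {aux}.

Section ProgramMachine.
Variables (aux Q : finType) (code : Q -> instr aux (option Q)) (start : Q) (K : nat).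
Hypothesis code_reg : forall q, instr_reg (code q) <= K.

(* A push takes two steps; the intermediate state records the symbol that is
   still to be written. *)
Definition machine_state : finType :=
  (option Q + 'I_K.+1 * symbol aux * option Q)%type.

Definition machine_trans (s : machine_state)
    (scan : {ffun 'I_K.+1 -> option (symbol aux)}) :
    machine_state * {ffun 'I_K.+1 -> option (symbol aux) * direction} :=
  match s with
  | inl None => (s, [ffun i => (scan i, Stay)])
  | inl (Some q) =>
      match code q with
      | IPush i a x =>
          (inr (inord i, a, x),
           [ffun j => (scan j, if j == inord i then MoveL else Stay)])
      | IPop i x =>
          (inl x,
           [ffun j => if j == inord i then (None, MoveR) else (scan j, Stay)])
      | ICase i f => (inl (f (scan (inord i))), [ffun j => (scan j, Stay)])
      end
  | inr (i, a, x) =>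
      (inl x, [ffun j => (if j == i then Some a else scan j, Stay)])
  end.

Definition machine : tm :=
  @TM K machine_state aux (inl (Some start) : machine_state)
    (fun s => if s is inl None then true else false) machine_trans.

Definition tape_holds (t : tape machine) (s : seq (symbol aux)) : Prop :=
  all (fun a => a == None) t.1 /\ exists k, t.2 = map Some s ++ nseq k None.

Lemma tape_holds_scanned t s : tape_holds t s -> scanned t = ohead s.
Proof. by case: t => l r [_ [k /= ->]]; case: s => [|a s] //; case: k. Qed.

Lemma tape_holds_stay t s :
  tape_holds t s -> tape_holds (write_move (scanned t, Stay) t) s.
Proof.
case: t => l r [/= hl [k ->]]; split=> //=.
case: s => [|a s] /=; last by exists k.
by case: k => [|k] /=; [exists 1|exists k.+1].
Qed.

Lemma tape_holds_pop t s :
  tape_holds t s -> tape_holds (write_move (None, MoveR) t) (behead s).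
Proof.
case: t => l r [/= hl [k ->]]; split=> //=.
by case: s => [|a s] /=; [exists k.-1; case: k | exists k].
Qed.

Lemma tape_holds_push t s a : tape_holds t s ->
  tape_holds (write_move (Some a, Stay) (write_move (scanned t, MoveL) t)) (a :: s).
Proof.
case: t => l r [/= hl [k ->]]; split=> /=; first by case: l hl => //= ? ? /andP[].
case: s => [|b s] /=; last by exists k.
by case: k => [|k] /=; [exists 1|exists k.+1].
Qed.

Definition config_holds (c : config machine) (x : option Q) (m : store aux) : Prop :=
  c.1 = inl x /\ forall i : 'I_K.+1, tape_holds (c.2 i) (m i).

Lemma machine_sim_instr q m c : config_holds c (Some q) m ->
  exists2 t, t <= 2 & config_holds (iter t (@tm_step machine) c)
                        (step_instr (code q) m).1 (step_instr (code q) m).2.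
Proof.
case: c => s c [/= -> hc].
have val_inord i : i <= K -> nat_of_ord (inord i : 'I_K.+1) = i.
  by move=> iK; rewrite inordK.
have eq_inord i (j : 'I_K.+1) : i <= K -> (j == i :> nat) = (j == inord i).
  by move=> iK; rewrite -val_eqE /= val_inord.
have := code_reg q; case E: (code q) => [i a x|i x|i f] /= iK.
- exists 2 => //; rewrite /= {2}/tm_step /= E /=; split=> //= j.
  rewrite !ffunE /upd eq_inord //; case: eqP => [->|_].
    by have /tape_holds_push := hc (inord i); rewrite val_inord //; apply.
  exact/tape_holds_stay/tape_holds_stay.
- exists 1 => //; rewrite /= /tm_step /= E /=; split=> //= j.
  rewrite !ffunE /upd eq_inord //; case: eqP => [->|_]; last exact: tape_holds_stay.
  by have /tape_holds_pop := hc (inord i); rewrite val_inord.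
- exists 1 => //; rewrite /= /tm_step /= E /=; split=> [|j] /=.
    by rewrite !ffunE (tape_holds_scanned (hc _)) val_inord.
  by rewrite !ffunE; apply: tape_holds_stay.
Qed.

Lemma machine_sim x n y : reach code x n y -> forall c, config_holds c x.1 x.2 ->
  exists2 t, t <= 2 * n & config_holds (iter t (@tm_step machine) c) y.1 y.2.
Proof.
elim=> [z c hc|q m k z _ IH c hc]; first by exists 0.
have [t t2 /IH[t' tk hz]] := machine_sim_instr hc.
by exists (t' + t); [lia | rewrite iterD].
Qed.

End ProgramMachine.

Lemma iter_tm_step_halted (M : tm) (c : config M) t :
  tm_halt c.1 -> iter t (@tm_step M) c = c.
Proof. by move=> halted; elim: t => //= t ->; rewrite /tm_step halted. Qed.

Definition init_store aux (x : seq bool) : store aux :=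
  fun i => if i == 0 then map inl x else [::].

Lemma prog_machine aux (p : prog aux) : exists M : tm, forall x y n m,
  runs p (init_store aux x) n m -> m 0 = map inl y ->
  forall t, 2 * n <= t -> outputs_within M x y t.
Proof.
exists (machine (@compile aux p) (entry p) (max_reg p)).
move=> x y n m [n' nn /exec_reach hr] my t nt; set M := machine _ _ _.
have init : config_holds (tm_init M x) (Some (entry p)) (init_store aux x).
  split=> //= i; rewrite /init_store; split=> //=; exists 0.
  by rewrite cats0 -val_eqE /=; case: eqP => //= _; rewrite -map_comp.
have [t' tn [state tapes]] := machine_sim (@instr_reg_compile aux p) hr init.
have tt : t' <= t by lia.
rewrite /outputs_within -(subnK tt) iterD iter_tm_step_halted state //; split=> //.
have [_ [k ->]] := tapes ord0; rewrite /= my -map_comp.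
by elim: (y) => [|b z /= ->] //=; case: k.
Qed.

(** * Functions computed by stack programs in polynomial time *)

(* Proves an equality of two stores built with [upd], register by register. *)
Ltac store_eq :=
  apply: functional_extensionality => ?; rewrite /upd;
  do ?[case: eqP => [?|?]]; subst; rewrite ?eqxx //; try lia; try by auto.

(* Computes the contents of a register of a store built with [upd]. *)
Ltac updE := rewrite /upd ?eqxx; do ?[case: eqP => ? //]; try lia.

Section Registers.
Variable aux : finType.
Implicit Types (m : store aux).

Lemma upd_id m i s : m i = s -> upd m i s = m.
Proof. by move=> mi; store_eq. Qed.

Lemma upd_upd m i s s' : upd (upd m i s) i s' = upd m i s'.
Proof. by store_eq. Qed.

Lemma updC m i j s s' : i != j -> upd (upd m i s) j s' = upd (upd m j s') i s.
Proof. by move=> ij; store_eq. Qed.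

Lemma upd_eq m i s : upd m i s i = s.
Proof. by rewrite /upd eqxx. Qed.

Lemma upd_neq m i j s : j != i -> upd m i s j = m j.
Proof. by rewrite /upd => /negbTE->. Qed.

Definition unary n : seq (symbol aux) := nseq n (inl true).

Definition clear i : prog aux := While i isSome (Pop i).
Definition shift i j : prog aux :=
  Case i (fun a => if a is Some a then Seq (Pop i) (Push j a) else Skip).
Definition move (P : pred (option (symbol aux))) i j := While i P (shift i j).
Definition copy i t u : prog aux :=
  Seq (move isSome i u)
      (While u isSome (Seq (Pop u) (Seq (Push i (inl true)) (Push t (inl true))))).

Lemma shift_runs m i j a s : i != j -> m i = a :: s ->
  runs (shift i j) m 3 (upd (upd m i s) j (a :: m j)).
Proof.
move=> ij mi; apply: runs_case; rewrite mi /=.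
apply: runs_seq (runs_pop m i) _; rewrite mi /=.
rewrite -[m j](upd_neq m (i := i) s) 1?eq_sym //; exact: runs_push.
Qed.

Lemma move_runs P m i j s r : i != j -> m i = s ++ r ->
  all (fun a => P (Some a)) s -> ~~ P (ohead r) ->
  runs (move P i j) m (4 * size s).+1 (upd (upd m i r) j (catrev s (m j))).
Proof.
move=> ij; elim: s m => [|a s IH] m /= mi.
  move=> _ stop; rewrite upd_id // ?upd_id // ?(upd_neq _ _ _) 1?eq_sym //.
  by apply: runs_while_stop; rewrite ?mi.
case/andP=> Pa Ps stop; set m1 := upd (upd m i (s ++ r)) j (a :: m j).
have m1i : m1 i = s ++ r by rewrite /m1 upd_neq // upd_eq.
have -> : upd (upd m i r) j (catrev s (a :: m j)) =
    upd (upd m1 i r) j (catrev s (m1 j)) by rewrite /m1 upd_eq; store_eq.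
have -> : (4 * (size s).+1).+1 = (3 + (4 * size s).+1).+1 by lia.
apply: runs_while_step (IH _ m1i Ps stop); first by rewrite mi.
exact: shift_runs.
Qed.

Lemma move_all_runs m i j : i != j ->
  runs (move isSome i j) m (4 * size (m i)).+1
    (upd (upd m i [::]) j (catrev (m i) (m j))).
Proof.
by move=> ij; apply: move_runs; rewrite ?cats0 //; apply/allP.
Qed.

Lemma clear_runs m i : runs (clear i) m (2 * size (m i)).+1 (upd m i [::]).
Proof.
move E: (m i) => s; elim: s m E => [|a s IH] m mi.
  by rewrite upd_id //; apply: runs_while_stop; rewrite ?mi.
have -> : (2 * (size s).+1).+1 = (1 + (2 * size s).+1).+1 by lia.
apply: runs_while_step; [by rewrite mi | exact: runs_pop|].
by rewrite mi /= -(upd_upd m i s [::]); apply: IH; rewrite upd_eq.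
Qed.

Lemma catrev_unary n k : catrev (unary n) (unary k) = unary (n + k).
Proof. by elim: n k => //= n IH k; rewrite (IH k.+1) addnS. Qed.

Lemma behead_unary n : behead (unary n) = unary n.-1.
Proof. by case: n. Qed.

Lemma move_unary m i j n : i != j -> m i = unary n -> m j = [::] ->
  runs (move isSome i j) m (4 * n).+1 (upd (upd m i [::]) j (unary n)).
Proof.
move=> ij mi mj; have := move_all_runs m ij.
by rewrite mi mj size_nseq (catrev_unary n 0) addn0.
Qed.

Definition replace i j : prog aux := Seq (clear i) (move isSome j i).

Lemma replace_runs m i j n k : i != j -> m i = unary n -> m j = unary k ->
  runs (replace i j) m ((2 * n).+1 + (4 * k).+1)
    (upd (upd m j [::]) i (unary k)).
Proof.
move=> ij mi mj; have := clear_runs m i; rewrite mi size_nseq => run_clear.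
apply: runs_seq run_clear _; have ji : j != i by rewrite eq_sym.
have -> : upd (upd m j [::]) i (unary k) =
    upd (upd (upd m i [::]) j [::]) i (unary k) by store_eq.
by apply: move_unary; rewrite ?upd_eq ?upd_neq.
Qed.

Lemma copy_runs m i t u n : uniq [:: i; t; u] -> m i = unary n -> m t = [::] ->
  m u = [::] -> runs (copy i t u) m (8 * n).+2 (upd m t (unary n)).
Proof.
rewrite /= !inE negb_or => /and3P[/andP[it iu] tu _] mi mt mu.
have -> : (8 * n).+2 = (4 * n).+1 + (n * 4).+1 by lia.
apply: runs_seq; first exact: move_unary.
pose ms k := upd (upd (upd m i (unary k)) t (unary k)) u (unary (n - k)).
have -> : upd (upd m i [::]) u (unary n) = ms 0.
  by rewrite /ms subn0; store_eq.
have -> : upd m t (unary n) = ms n by rewrite /ms subnn; store_eq.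
apply: runs_while => [k kn|]; last by rewrite /ms upd_eq subnn.
split; first by rewrite /ms upd_eq -(ltn_predK (_ : 0 < n - k)) ?subn_gt0.
apply: (runs_seq (n := 1) (n' := 2)); first exact: runs_pop.
apply: (runs_seq (n := 1) (n' := 1)); first exact: runs_push.
set m1 := upd _ i _; have m1t : m1 t = unary k by rewrite /m1 /ms; updE.
suff -> : ms k.+1 = upd m1 t (inl true :: m1 t) by exact: runs_push.
have msu : ms k u = unary (n - k) by rewrite /ms upd_eq.
rewrite m1t /m1 msu behead_unary -subnS.
have -> : upd (ms k) u (unary (n - k.+1)) i = unary k by rewrite /ms; updE.
rewrite /ms; clear -it iu tu; store_eq.
Qed.

End Registers.

Definition poly_bounded (f : nat -> nat) :=
  exists e, forall a, 1 < a -> f a <= a ^ e.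

Lemma poly_bounded_const k : poly_bounded (fun=> k).
Proof. by exists k => a a1; apply/ltnW/ltn_expl. Qed.

Lemma poly_bounded_id : poly_bounded (fun a => a).
Proof. by exists 1. Qed.

Lemma poly_bounded_mul f g :
  poly_bounded f -> poly_bounded g -> poly_bounded (fun a => f a * g a).
Proof.
by case=> e fe [e' ge']; exists (e + e') => a a1; rewrite expnD leq_mul ?fe ?ge'.
Qed.

Lemma poly_bounded_add f g :
  poly_bounded f -> poly_bounded g -> poly_bounded (fun a => f a + g a).
Proof.
case=> e fe [e' ge']; exists (e + e').+1 => a a1.
have le_f : f a <= a ^ (e + e').
  by apply: leq_trans (fe a a1) _; apply: leq_pexp2l; lia.
have le_g : g a <= a ^ (e + e').
  by apply: leq_trans (ge' a a1) _; apply: leq_pexp2l; lia.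
apply: (@leq_trans (2 * a ^ (e + e'))); first lia.
by rewrite expnS leq_mul2r a1 orbT.
Qed.

Lemma leq_expl m n e : m <= n -> m ^ e <= n ^ e.
Proof. by move=> mn; case: e => // e; rewrite leq_exp2r. Qed.

Lemma poly_bounded_exp f e : poly_bounded f -> poly_bounded (fun a => f a ^ e).
Proof.
case=> k fk; exists (k * e) => a a1; rewrite expnM.
by apply: leq_expl; apply: fk.
Qed.

Lemma poly_bounded_succ f : poly_bounded f -> poly_bounded (fun a => (f a).+1).
Proof.
move=> hf; have [e he] := poly_bounded_add hf (poly_bounded_const 1).
by exists e => a /he; rewrite addn1.
Qed.

Create HintDb poly_bounded.
#[local] Hint Constants Opaque : poly_bounded.
#[local] Hint Resolve poly_bounded_const poly_bounded_id poly_bounded_mul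
  poly_bounded_add poly_bounded_exp poly_bounded_succ : poly_bounded.
Ltac poly_bounded_tac := solve [auto 50 with poly_bounded nocore].

(* A context consists of an input string and the values of finitely many
   variables, the most recently bound one first. *)
Definition ctx := (seq bool * seq nat)%type.
Definition top (c : ctx) : nat := head 0 c.2.
Definition pop (c : ctx) : ctx := (c.1, behead c.2).
Definition push (n : nat) (c : ctx) : ctx := (c.1, n :: c.2).
Definition ctx_size (c : ctx) : nat := (size c.1 + sumn c.2).+2.

Lemma pop_push n c : pop (push n c) = c.
Proof. by case: c. Qed.

Lemma ctx_size_push n c : ctx_size (push n c) = ctx_size c + n.
Proof. by rewrite /ctx_size /=; lia. Qed.

Lemma ctx_size_iter_pop j c : ctx_size (iter j pop c) <= ctx_size c.
Proof.
elim: j => //= j; apply: leq_trans.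
by case: (iter j pop c) => x [|n e]; rewrite /ctx_size /=; lia.
Qed.

(* The string of [c] is in register [b] and its variables are in unary in the
   registers [r]; register [b.+1] and all registers from [s] on are empty. *)
Record represents aux (m : store aux) (b : nat) (r : seq nat) (s : nat)
    (c : ctx) : Prop := Represents {
  represents_str : m b = map inl c.1;
  represents_tmp : m b.+1 = [::];
  represents_base : b.+1 < s;
  represents_vars : map m r = map (unary aux) c.2;
  represents_regs : all (fun i => i < s) r;
  represents_free : forall i, s <= i -> m i = [::] }.

Section Represents.
Variable aux : finType.
Implicit Types (m : store aux) (c : ctx).

Lemma represents_reserve m b r s c l :
  represents m b r s c -> represents (upd m s l) b r s.+1 c.
Proof.
case=> str tmp base vars regs free; split; rewrite ?upd_neq //; try lia.
- by rewrite -vars; apply/eq_in_map => i /(allP regs) si; rewrite upd_neq //; lia.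
- by apply/allP => i /(allP regs) /ltnW.
- by move=> i si; rewrite upd_neq; [apply: free|]; lia.
Qed.

Lemma represents_skip m b r s c :
  represents m b r s c -> represents m b r s.+1 c.
Proof.
move=> rep; rewrite -(upd_id (represents_free rep (leqnn s))).
exact: represents_reserve.
Qed.

Lemma represents_push m b r s c n : represents m b r s c ->
  represents (upd m s (unary aux n)) b (s :: r) s.+1 (push n c).
Proof.
case/(represents_reserve (unary aux n)) => str tmp base vars regs free.
by split; rewrite //= ?upd_eq ?vars // ltnSn.
Qed.

Lemma represents_iter_pop m b r s c j : represents m b r s c ->
  represents m b (iter j behead r) s (iter j pop c).
Proof.
move=> rep; elim: j => //= j [str tmp base vars regs free]; split=> //=.
  by rewrite -!behead_map vars.
by case: (iter j behead r) regs {vars} => //= ? ? /andP[].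
Qed.

Lemma represents_value_le (p : prog aux) m b r s c n v :
  represents m b r s c -> runs p m n (upd m s (unary aux v)) -> v <= n.
Proof.
move=> rep [t tn /exec_size /(_ s)].
rewrite upd_eq size_nseq (represents_free rep (leqnn s)).
by move/leq_trans; apply.
Qed.

Lemma represents_exists c :
  exists m, represents m 0 (iota 2 (size c.2)) (size c.2).+2 c.
Proof.
exists (fun i => if i == 0 then map inl c.1 else
  if i == 1 then [::] else unary aux (nth 0 c.2 (i - 2))).
split=> //.
- rewrite -[2]addn0 iotaDl -map_comp.
  apply: (@eq_from_nth _ [::]); rewrite !size_map size_iota // => i ic.
  rewrite (nth_map 0) ?size_iota //= (nth_map 0) // nth_iota //.
  by rewrite !add2n /= subn2.
- by apply/allP => i; rewrite mem_iota; lia.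
- move=> i si; case: eqP => [?|_]; first lia; case: eqP => [?|_]; first lia.
  by rewrite nth_default //; lia.
Qed.

End Represents.

Definition polytime_nat (F : ctx -> nat) : Prop :=
  forall (aux : finType) b r s, exists (p : prog aux) (e : nat), forall m c,
    represents m b r s c -> runs p m (ctx_size c ^ e) (upd m s (unary aux (F c))).

Definition polytime_bool (P : ctx -> bool) : Prop :=
  polytime_nat (fun c => P c : nat).

Lemma polytime_intro F :
  (forall (aux : finType) b r s, exists (p : prog aux) f,
    poly_bounded f /\ forall m c, represents m b r s c ->
      runs p m (f (ctx_size c)) (upd m s (unary aux (F c)))) -> polytime_nat F.
Proof.
move=> hF aux b r s; have [p [f [[e fe] hp]]] := hF aux b r s.
by exists p, e => m c /hp run; apply: runs_le run _; apply: fe.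
Qed.

Lemma polytime_ext F G : F =1 G -> polytime_nat G -> polytime_nat F.
Proof. by move=> /functional_extensionality ->. Qed.

Lemma polytime_zero : polytime_nat (fun=> 0).
Proof.
apply: polytime_intro => aux b r s; exists Skip, (fun=> 1).
split; first by poly_bounded_tac.
by move=> m c rep; rewrite upd_id ?(represents_free rep) //; apply: runs_skip.
Qed.

Lemma polytime_succ F : polytime_nat F -> polytime_nat (fun c => (F c).+1).
Proof.
move=> hF; apply: polytime_intro => aux b r s; have [p [e hp]] := hF aux b r s.
exists (Seq p (Push s (inl true))), (fun a => a ^ e + 1).
split; first by poly_bounded_tac.
move=> m c /hp run; apply: runs_seq run _.
have := runs_push (upd m s (unary aux (F c))) s (inl true).
by rewrite upd_eq upd_upd.
Qed.

Lemma polytime_predn F : polytime_nat F -> polytime_nat (fun c => (F c).-1).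
Proof.
move=> hF; apply: polytime_intro => aux b r s; have [p [e hp]] := hF aux b r s.
exists (Seq p (Pop s)), (fun a => a ^ e + 1); split; first by poly_bounded_tac.
move=> m c /hp run; apply: runs_seq run _.
have := runs_pop (upd m s (unary aux (F c))) s.
by rewrite upd_eq upd_upd behead_unary.
Qed.

Lemma polytime_const k : polytime_nat (fun=> k).
Proof. by elim: k => [|k]; [apply: polytime_zero | apply: polytime_succ]. Qed.

Lemma polytime_top : polytime_nat top.
Proof.
apply: polytime_intro => aux b [|i r] s.
  exists Skip, (fun=> 1); split; first by poly_bounded_tac.
  move=> m [x [|v e]] rep; last by have := represents_vars rep.
  by rewrite upd_id ?(represents_free rep) //; apply: runs_skip.
exists (copy aux i s s.+1), (fun a => (8 * a).+2); split; first by poly_bounded_tac.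
move=> m [x [|v e]] rep; first by have := represents_vars rep.
have /= [mi _] := represents_vars rep.
have /= /andP[is_s _] := represents_regs rep.
apply: runs_le (copy_runs _ mi _ _) _; rewrite ?(represents_free rep) //.
  by rewrite /= !inE; lia.
by rewrite /ctx_size /=; lia.
Qed.

Lemma polytime_let j F G : polytime_nat F -> polytime_nat G ->
  polytime_nat (fun c => G (push (F c) (iter j pop c))).
Proof.
move=> hF hG; apply: polytime_intro => aux b r s.
have [p [e hp]] := hF aux b r s.
have [q [e' hq]] := hG aux b (s :: iter j behead r) s.+1.
exists (Seq p (Seq q (replace aux s s.+1))), (fun a =>
  a ^ e + ((a + a ^ e) ^ e' + ((2 * a ^ e).+1 + (4 * (a + a ^ e) ^ e').+1))).
split; first by poly_bounded_tac.
move=> m c rep; set a := ctx_size c.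
have run_p := hp _ _ rep; set n := F c in run_p *.
have n_le : n <= a ^ e := represents_value_le rep run_p.
apply: runs_seq run_p _; have rep_n := represents_push n (represents_iter_pop j rep).
have run_q := hq _ _ rep_n; set k := G _ in run_q *.
have {}run_q : runs q (upd m s (unary aux n)) ((a + a ^ e) ^ e')
    (upd (upd m s (unary aux n)) s.+1 (unary aux k)).
  apply: runs_le run_q _; apply: leq_expl; rewrite ctx_size_push.
  by apply: leq_add => //; apply: ctx_size_iter_pop.
have k_le := represents_value_le rep_n run_q.
apply: runs_seq (run_q) _; set m1 := upd (upd _ _ _) _ _.
have m1s : m1 s = unary aux n by rewrite /m1; updE.
have -> : upd m s (unary aux k) = upd (upd m1 s.+1 [::]) s (unary aux k).
  by rewrite /m1; store_eq; rewrite (represents_free rep).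
apply: runs_le (replace_runs _ m1s (upd_eq _ _ _)) _; lia.
Qed.

Lemma polytime_if P F G : polytime_bool P -> polytime_nat F -> polytime_nat G ->
  polytime_nat (fun c => if P c then F c else G c).
Proof.
move=> hP hF hG; apply: polytime_intro => aux b r s.
have [p [e hp]] := hP aux b r s; have [q [eF hq]] := hF aux b r s.
have [q' [eG hq']] := hG aux b r s.
exists (Seq p (Case s (fun a => if a then Seq (Pop s) q else q'))).
exists (fun a => a ^ e + (1 + a ^ eF + a ^ eG).+1); split; first by poly_bounded_tac.
move=> m c rep; have ms : m s = [::] := represents_free rep (leqnn s).
apply: runs_seq (hp _ _ rep) _; apply: runs_case; rewrite upd_eq.
case: (P c) => /=.
  apply: (runs_le (n := 1 + ctx_size c ^ eF)); last lia.
  by apply: runs_seq (runs_pop _ _) _; rewrite upd_eq /= upd_upd upd_id //; apply: hq.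
by rewrite (upd_id ms); apply: runs_le (hq' _ _ rep) _; lia.
Qed.

Section Scan.
Variable aux : finType.
Implicit Types (m : store aux) (x : seq (symbol aux)).

(* The first [k] symbols of [x] have been moved from register [b] to register
   [b.+1]. *)
Definition scan_store m b x k : store aux :=
  upd (upd m b (drop k x)) b.+1 (rev (take k x)).

Lemma scan_store0 m b x : m b = x -> m b.+1 = [::] -> scan_store m b x 0 = m.
Proof. by move=> mb mb1; rewrite /scan_store take0 drop0; store_eq. Qed.

Lemma upd_scan_store m b x k s l : b.+1 < s ->
  upd (scan_store m b x k) s l = scan_store (upd m s l) b x k.
Proof. by move=> bs; rewrite /scan_store; store_eq. Qed.

Lemma scan_store_str m b x k : scan_store m b x k b = drop k x.
Proof. by rewrite /scan_store; updE. Qed.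

Lemma scan_store_neq m b x k s : b.+1 < s -> scan_store m b x k s = m s.
Proof. by move=> bs; rewrite /scan_store; updE. Qed.

Lemma scan_step m b x k :
  runs (shift aux b b.+1) (scan_store m b x k) 3 (scan_store m b x k.+1).
Proof.
case: (ltnP k (size x)) => kx.
  have x_k := drop_nth (inl true) kx; set a := nth _ x k in x_k.
  have -> : scan_store m b x k.+1 = upd (upd (scan_store m b x k) b (drop k.+1 x))
      b.+1 (a :: scan_store m b x k b.+1).
    by rewrite /scan_store upd_eq (take_nth (inl true)) // rev_rcons -/a; store_eq.
  by apply: shift_runs; rewrite ?scan_store_str //; lia.
have -> : scan_store m b x k.+1 = scan_store m b x k.
  by rewrite /scan_store !drop_oversize ?take_oversize // leqW.
apply: runs_case; rewrite scan_store_str drop_oversize //.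
exact: runs_skip.
Qed.

Lemma scan_back m b x k :
  runs (move isSome b.+1 b) (scan_store m b x k) (4 * size x).+1 (scan_store m b x 0).
Proof.
have := @move_all_runs aux (scan_store m b x k) b.+1 b.
have -> : scan_store m b x k b.+1 = rev (take k x) by rewrite /scan_store upd_eq.
rewrite scan_store_str size_rev catrevE revK cat_take_drop.
have -> : upd (upd (scan_store m b x k) b.+1 [::]) b x = scan_store m b x 0.
  by rewrite /scan_store take0 drop0; store_eq.
move=> run; apply: runs_le (run _) _; first lia.
by rewrite size_take; case: ifP; lia.
Qed.

End Scan.

Lemma polytime_size_input : polytime_nat (fun c => size c.1).
Proof.
apply: polytime_intro => aux b r s.
exists (Seq (While b isSome (Seq (shift aux b b.+1) (Push s (inl true))))
            (move isSome b.+1 b)).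
exists (fun a => (a * 5).+1 + (4 * a).+1); split; first by poly_bounded_tac.
move=> m c rep; set x := map inl c.1 : seq (symbol aux).
have x_size : size x = size c.1 by rewrite size_map.
have x_le : size x <= ctx_size c by rewrite x_size /ctx_size; lia.
have bs := represents_base rep.
pose ms k := scan_store (upd m s (unary aux k)) b x k.
have -> : upd m s (unary aux (size c.1)) =
    scan_store (upd m s (unary aux (size x))) b x 0.
  rewrite x_size scan_store0 // upd_neq; try lia.
    exact: (represents_str rep).
  exact: (represents_tmp rep).
apply: (runs_seq (m1 := ms (size x))); last first.
  by apply: runs_le (scan_back _ _ _ _) _; lia.
have {1}-> : m = ms 0.
  rewrite /ms upd_id; last exact: (represents_free rep).
  by rewrite scan_store0 // ?(represents_str rep) ?(represents_tmp rep).
apply: runs_le (runs_while (T := 4) (N := size x) _ _) _; last by lia.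
  move=> k kx; split; first by rewrite /ms scan_store_str (drop_nth (inl true)).
  apply: (runs_seq (n := 3) (n' := 1)); first exact: scan_step.
  set m1 := scan_store _ _ _ _.
  have -> : ms k.+1 = upd m1 s (inl true :: m1 s); last exact: runs_push.
  by rewrite upd_scan_store // upd_upd /m1 scan_store_neq // upd_eq.
by rewrite /ms scan_store_str drop_size.
Qed.

Lemma polytime_nth_input F :
  polytime_nat F -> polytime_bool (fun c => nth false c.1 (F c)).
Proof.
move=> hF; apply: polytime_intro => aux b r s; have [p [e hp]] := hF aux b r s.
exists (Seq p (Seq (While s isSome (Seq (Pop s) (shift aux b b.+1)))
  (Seq (Case b (fun a => if a == Some (inl true) then Push s (inl true) else Skip))
       (move isSome b.+1 b)))).
exists (fun a => a ^ e + ((a ^ e * 5).+1 + (2 + (4 * a).+1))).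
split; first by poly_bounded_tac.
move=> m c rep; have run_p := hp _ _ rep; set n := F c in run_p *.
have n_le : n <= ctx_size c ^ e := represents_value_le rep run_p.
apply: runs_seq (run_p) _; set x := map inl c.1 : seq (symbol aux).
have x_le : size x <= ctx_size c by rewrite size_map /ctx_size; lia.
have bs := represents_base rep; have ms0 := represents_free rep (leqnn s).
have scan0 l : scan_store (upd m s l) b x 0 = upd m s l.
  rewrite scan_store0 // upd_neq; try lia.
    exact: (represents_str rep).
  exact: (represents_tmp rep).
pose ms k := scan_store (upd m s (unary aux (n - k))) b x k.
apply: (runs_seq (m1 := ms n)).
  have {1}-> : upd m s (unary aux n) = ms 0 by rewrite /ms subn0 scan0.
  apply: runs_le (runs_while (T := 4) (N := n) _ _) _; last by lia.
    move=> k kn; have msk : ms k s = unary aux (n - k).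
      by rewrite /ms scan_store_neq // upd_eq.
    split; first by rewrite msk -(ltn_predK (_ : 0 < n - k)) ?subn_gt0.
    apply: (runs_seq (n := 1) (n' := 3)); first exact: runs_pop.
    rewrite msk behead_unary -subnS upd_scan_store // upd_upd; exact: scan_step.
  by rewrite /ms scan_store_neq // upd_eq subnn.
rewrite /ms subnn; set v := nth false c.1 n; rewrite -(scan0 (unary aux v)).
apply: (runs_seq (m1 := scan_store (upd m s (unary aux v)) b x n)); last first.
  by apply: runs_le (scan_back _ _ _ _) _; lia.
apply: runs_case; rewrite scan_store_str.
have -> : (ohead (drop n x) == Some (inl true)) = v.
  rewrite /v -[n in nth _ _ n]addn0 -nth_drop /x -map_drop.
  by case: (drop n c.1) => [|[] l].
have := @runs_push aux (scan_store (upd m s (unary aux 0)) b x n) s (inl true).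
rewrite upd_scan_store // upd_upd scan_store_neq // upd_eq.
by case: v => // _; apply: runs_skip.
Qed.

Definition ctx_bounded (F : ctx -> nat) : Prop :=
  forall n, exists e, forall c, size c.2 = n -> F c <= ctx_size c ^ e.

Lemma polytime_ctx_bounded F : polytime_nat F -> ctx_bounded F.
Proof.
move=> hF n; have [p [e hp]] := hF unit 0 (iota 2 n) n.+2.
exists e => c cn; have [m] := represents_exists unit c; rewrite cn => rep.
exact: represents_value_le rep (hp _ _ rep).
Qed.

Lemma ctx_bounded_add F G :
  ctx_bounded F -> ctx_bounded G -> ctx_bounded (fun c => F c + G c).
Proof.
move=> hF hG n; have [e Fe] := hF n; have [e' Ge] := hG n.
have [k hk] : poly_bounded (fun a => a ^ e + a ^ e') by poly_bounded_tac.
by exists k => c cn; apply: leq_trans (hk _ _); rewrite ?leq_add ?Fe ?Ge.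
Qed.

Lemma ctx_bounded_mul F G :
  ctx_bounded F -> ctx_bounded G -> ctx_bounded (fun c => F c * G c).
Proof.
move=> hF hG n; have [e Fe] := hF n; have [e' Ge] := hG n.
by exists (e + e') => c cn; rewrite expnD leq_mul ?Fe ?Ge.
Qed.

Section IterationLoop.
Variables (aux : finType) (s : nat).

(* Remaining number of iterations, index of the next one, accumulator. *)
Definition iter_store (m : store aux) j k v : store aux :=
  upd (upd (upd m s (unary aux j)) s.+1 (unary aux k)) s.+2 (unary aux v).

Definition iter_body (p : prog aux) : prog aux :=
  Seq (Pop s) (Seq p (Seq (replace aux s.+2 s.+3) (Push s.+1 (inl true)))).

Lemma iter_body_runs m p j k v v' T : m s.+3 = [::] ->
  runs p (iter_store m j k v) T (upd (iter_store m j k v) s.+3 (unary aux v')) ->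
  runs (iter_body p) (iter_store m j.+1 k v)
    (1 + (T + ((2 * v).+1 + (4 * v').+1 + 1))) (iter_store m j k.+1 v').
Proof.
move=> m3 run_p; apply: runs_seq (runs_pop _ _) _.
have -> : upd (iter_store m j.+1 k v) s (behead (iter_store m j.+1 k v s)) =
    iter_store m j k v.
  have -> : iter_store m j.+1 k v s = unary aux j.+1 by rewrite /iter_store; updE.
  by rewrite behead_unary /iter_store; store_eq.
apply: runs_seq run_p _; set m1 := upd _ s.+3 _.
apply: runs_seq.
  apply: (replace_runs (n := v) (k := v')); first lia.
    by rewrite /m1 /iter_store; updE.
  by rewrite /m1 upd_eq.
set m2 := upd _ s.+2 _; have m2s : m2 s.+1 = unary aux k.
  by rewrite /m2 /m1 /iter_store; updE.
have -> : iter_store m j k.+1 v' = upd m2 s.+1 (inl true :: m2 s.+1).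
  by rewrite m2s /m2 /m1 /iter_store; clear -m3; store_eq.
exact: runs_push.
Qed.

Lemma represents_iter_store m b r c j k v : represents m b r s c ->
  represents (iter_store m j k v) b [:: s.+2, s.+1 & r] s.+3 (push v (push k c)).
Proof. by move=> rep; do 2!apply: represents_push; apply: represents_reserve. Qed.

Lemma iter_finish_runs m k v : m s = [::] -> m s.+1 = [::] -> m s.+2 = [::] ->
  runs (Seq (clear aux s.+1) (replace aux s s.+2)) (iter_store m 0 k v)
    ((2 * k).+1 + (1 + (4 * v).+1)) (upd m s (unary aux v)).
Proof.
move=> ms ms1 ms2; have ks : iter_store m 0 k v s.+1 = unary aux k.
  by rewrite /iter_store; updE.
have := clear_runs (iter_store m 0 k v) s.+1; rewrite ks size_nseq => run_clear.
apply: runs_seq run_clear _; set m1 := upd _ _ _.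
have -> : upd m s (unary aux v) = upd (upd m1 s.+2 [::]) s (unary aux v).
  by rewrite /m1 /iter_store; store_eq.
apply: (replace_runs (n := 0)); first lia.
  by rewrite /m1 /iter_store; updE.
by rewrite /m1 /iter_store; updE.
Qed.

End IterationLoop.

Lemma polytime_iteri (N a B : ctx -> nat) (f : ctx -> nat -> nat -> nat) :
  polytime_nat N -> polytime_nat a -> ctx_bounded B ->
  polytime_nat (fun c => f (pop (pop c)) (top (pop c)) (top c)) ->
  (forall c i, i <= N c -> iteri i (f c) (a c) <= B c) ->
  polytime_nat (fun c => iteri (N c) (f c) (a c)).
Proof.
move=> hN ha hB hf bound; apply: polytime_intro => aux b r s.
have [pN [eN hpN]] := hN aux b r s; have [pa [ea hpa]] := ha aux b r s.+2.
have [eB B_le] := hB (size r); have [p [e hp]] := hf aux b [:: s.+2, s.+1 & r] s.+3.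
pose T A := 1 + ((A + A ^ eN + A ^ eB) ^ e + ((2 * A ^ eB).+1 + (4 * A ^ eB).+1 + 1)).
exists (Seq pN (Seq pa (Seq (While s isSome (iter_body s p))
  (Seq (clear aux s.+1) (replace aux s s.+2))))).
exists (fun A => A ^ eN + (A ^ ea + ((A ^ eN * (T A).+1).+1 +
  ((2 * A ^ eN).+1 + (1 + (4 * A ^ eB).+1))))).
split; first by rewrite /T; poly_bounded_tac.
move=> m c rep; set A := ctx_size c; set n := N c.
have free i : s <= i -> m i = [::] by apply: (represents_free rep).
have run_N := hpN _ _ rep; have n_le : n <= A ^ eN := represents_value_le rep run_N.
pose acc k := iteri k (f c) (a c).
have acc_le k : k <= n -> acc k <= A ^ eB.
  move=> kn; apply: leq_trans (bound c k kn) _; apply: B_le.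
  by have /(congr1 size) := represents_vars rep; rewrite !size_map.
pose ms k := iter_store s m (n - k) k (acc k).
have m_init : upd (upd m s (unary aux n)) s.+2 (unary aux (a c)) = ms 0.
  by rewrite /ms /iter_store subn0 (@upd_id _ _ s.+1) // upd_neq ?free //; lia.
have rep_n := represents_skip (represents_reserve (unary aux n) rep).
apply: runs_seq run_N _; apply: runs_seq (hpa _ _ rep_n) _; rewrite m_init.
apply: (runs_seq (m1 := ms n)); last first.
  apply: runs_le (_ : runs _ _ ((2 * n).+1 + (1 + (4 * acc n).+1)) _) _.
    by rewrite /ms subnn; apply: iter_finish_runs; apply: free; lia.
  by have := acc_le n (leqnn n); lia.
apply: runs_le (runs_while (T := T A) (N := n) _ _) _; first last.
- by rewrite ltnS leq_mul2r n_le orbT.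
- by rewrite /ms /iter_store subnn; updE.
move=> k kn; have nk : n - k = (n - k.+1).+1 by lia.
split; first by rewrite /ms nk /iter_store; updE.
have acc_k := acc_le k (ltnW kn); have acc_k1 := acc_le _ kn.
have := hp _ _ (represents_iter_store (n - k.+1) k (acc k) rep).
rewrite !pop_push /top /= -/(acc k.+1) => run_p; rewrite /ms nk.
have run_body := iter_body_runs (free s.+3 _) run_p.
apply: runs_le (run_body _) _; first by lia.
rewrite /T leq_add2l leq_add ?leq_add ?ltnS ?leq_mul2l ?acc_k ?acc_k1 //.
by apply: leq_expl; rewrite !ctx_size_push leq_add // leq_add2l; lia.
Qed.

(* [weakening k]: [k] forgets some of the innermost variables. *)
Definition weakening (k : ctx -> ctx) : Prop := exists j, forall c, k c = iter j pop c.

Lemma weakening_id : weakening id.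
Proof. by exists 0. Qed.

Lemma weakening_pop k : weakening k -> weakening (fun c => pop (k c)).
Proof. by case=> j kj; exists j.+1 => c; rewrite kj. Qed.

Lemma polytime_subst k V (f : ctx -> nat -> nat) : weakening k -> polytime_nat V ->
  polytime_nat (fun c => f (pop c) (top c)) ->
  polytime_nat (fun c => f (k c) (V c)).
Proof.
case=> j kj hV /(polytime_let j hV); apply: polytime_ext => c.
by rewrite pop_push kj.
Qed.

Lemma polytime_pop F : polytime_nat F -> polytime_nat (fun c => F (pop c)).
Proof.
move=> hF aux b r s; have [p [e hp]] := hF aux b (behead r) s.
exists p, e => m c /(represents_iter_pop 1) /hp run; apply: runs_le run _.
exact/leq_expl/(ctx_size_iter_pop 1).
Qed.

Lemma polytime_weaken k F :
  weakening k -> polytime_nat F -> polytime_nat (fun c => F (k c)).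
Proof.
case=> j kj hF; apply: (polytime_ext (G := fun c => F (iter j pop c))) => [c|].
  by rewrite kj.
elim: j F hF {kj} => [|j IH] F hF //.
exact: (IH (fun c => F (pop c)) (polytime_pop hF)).
Qed.

Lemma polytime_iter (N a B : ctx -> nat) (f : ctx -> nat -> nat) :
  polytime_nat N -> polytime_nat a -> ctx_bounded B ->
  polytime_nat (fun c => f (pop c) (top c)) ->
  (forall c i, i <= N c -> iter i (f c) (a c) <= B c) ->
  polytime_nat (fun c => iter (N c) (f c) (a c)).
Proof.
move=> hN ha hB hf bound.
apply: (polytime_iteri (f := fun c _ => f c) hN ha hB _ bound).
by apply: polytime_subst polytime_top hf; exists 2.
Qed.

Lemma polytime_add F G :
  polytime_nat F -> polytime_nat G -> polytime_nat (fun c => F c + G c).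
Proof.
move=> hF hG; apply: (polytime_ext (G := fun c => iter (G c) S (F c))) => [c|].
  by rewrite iter_succn.
apply: (polytime_iter (f := fun _ => S) (B := fun c => F c + G c)) => //.
- exact: ctx_bounded_add (polytime_ctx_bounded hF) (polytime_ctx_bounded hG).
- exact/polytime_succ/polytime_top.
- by move=> c i iG; rewrite iter_succn leq_add2l.
Qed.

Lemma polytime_sub F G :
  polytime_nat F -> polytime_nat G -> polytime_nat (fun c => F c - G c).
Proof.
move=> hF hG; apply: (polytime_ext (G := fun c => iter (G c) predn (F c))) => [c|].
  by rewrite iter_predn.
apply: (polytime_iter (f := fun _ => predn)) (polytime_ctx_bounded hF) _ _ => //.
  exact/polytime_predn/polytime_top.
by move=> c i _; rewrite iter_predn leq_subr.
Qed.

Lemma polytime_mul F G :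
  polytime_nat F -> polytime_nat G -> polytime_nat (fun c => F c * G c).
Proof.
move=> hF hG.
apply: (polytime_ext (G := fun c => iter (G c) (addn (F c)) 0)) => [c|].
  by rewrite iter_addn_0.
apply: (polytime_iter (f := fun c => addn (F c)) (B := fun c => F c * G c)) => //.
- exact: polytime_zero.
- exact: ctx_bounded_mul (polytime_ctx_bounded hF) (polytime_ctx_bounded hG).
- exact: polytime_add (polytime_pop hF) polytime_top.
- by move=> c i iG; rewrite iter_addn_0 leq_mul2l iG orbT.
Qed.

Lemma polytime_exp F k : polytime_nat F -> polytime_nat (fun c => F c ^ k).
Proof.
move=> hF; elim: k => [|k IH]; first exact: polytime_const.
by apply: polytime_ext (polytime_mul hF IH) => c; rewrite expnS.
Qed.

Lemma polytime_nat_of_bool P : polytime_bool P -> polytime_nat (fun c => P c).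
Proof. by []. Qed.

Lemma polytime_bool_const b : polytime_bool (fun=> b).
Proof. exact: polytime_const. Qed.

Lemma polytime_bool_if P Q R :
  polytime_bool P -> polytime_bool Q -> polytime_bool R ->
  polytime_bool (fun c => if P c then Q c else R c).
Proof.
by move=> hP hQ hR; apply: polytime_ext (polytime_if hP hQ hR) => c; case: (P c).
Qed.

Lemma polytime_bool_weaken k P :
  weakening k -> polytime_bool P -> polytime_bool (fun c => P (k c)).
Proof. exact: polytime_weaken. Qed.

Lemma polytime_negb P : polytime_bool P -> polytime_bool (fun c => ~~ P c).
Proof.
by move=> hP; apply: (polytime_bool_if hP); apply: polytime_bool_const.
Qed.

Lemma polytime_andb P Q :
  polytime_bool P -> polytime_bool Q -> polytime_bool (fun c => P c && Q c).
Proof. by move=> hP hQ; apply: (polytime_bool_if hP hQ (polytime_bool_const false)). Qed.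

Lemma polytime_orb P Q :
  polytime_bool P -> polytime_bool Q -> polytime_bool (fun c => P c || Q c).
Proof. by move=> hP hQ; apply: (polytime_bool_if hP (polytime_bool_const true) hQ). Qed.

Lemma polytime_implb P Q :
  polytime_bool P -> polytime_bool Q -> polytime_bool (fun c => P c ==> Q c).
Proof. by move=> hP hQ; apply: (polytime_bool_if hP hQ (polytime_bool_const true)). Qed.

Lemma polytime_leq F G :
  polytime_nat F -> polytime_nat G -> polytime_bool (fun c => F c <= G c).
Proof.
move=> hF hG; apply: polytime_ext (polytime_sub (polytime_const 1) (polytime_sub hF hG)).
by move=> c; rewrite /leq; case: (_ - _).
Qed.

Lemma polytime_eqn F G :
  polytime_nat F -> polytime_nat G -> polytime_bool (fun c => F c == G c).
Proof.
move=> hF hG.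
apply: polytime_ext (polytime_andb (polytime_leq hF hG) (polytime_leq hG hF)) => c.
by rewrite eqn_leq.
Qed.

Lemma polytime_eqb P Q :
  polytime_bool P -> polytime_bool Q -> polytime_bool (fun c => P c == Q c).
Proof.
move=> hP hQ; apply: polytime_ext (polytime_bool_if hP hQ (polytime_negb hQ)) => c.
by case: (P c); case: (Q c).
Qed.

Ltac polytime_weaken_tac :=
  match goal with
  | |- polytime_nat (fun c => ?F (pop (@?k c))) =>
      apply (@polytime_weaken (fun c => pop (k c)) F)
  | |- polytime_bool (fun c => ?P (pop (@?k c))) =>
      apply (@polytime_bool_weaken (fun c => pop (k c)) P)
  end.

Create HintDb polytime.
#[local] Hint Constants Opaque : polytime.
#[local] Hint Resolve weakening_id weakening_pop : polytime.
#[local] Hint Resolve polytime_const polytime_bool_const polytime_top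
  polytime_nat_of_bool | 0 : polytime.
#[local] Hint Resolve polytime_succ polytime_predn polytime_add polytime_sub
  polytime_mul polytime_exp polytime_leq polytime_eqn polytime_eqb
  polytime_negb polytime_andb polytime_orb polytime_implb : polytime.
#[local] Hint Resolve polytime_if polytime_bool_if | 3 : polytime.
#[local] Hint Extern 2 => polytime_weaken_tac : polytime.
Ltac polytime_tac := solve [auto 100 with polytime nocore].

Lemma polytime_minn F G :
  polytime_nat F -> polytime_nat G -> polytime_nat (fun c => minn (F c) (G c)).
Proof. by move=> hF hG; rewrite /minn; polytime_tac. Qed.

Lemma polytime_all N (P : ctx -> nat -> bool) :
  polytime_nat N -> polytime_bool (fun c => P (pop c) (top c)) ->
  polytime_bool (fun c => all (P c) (iota 0 (N c))).
Proof.
move=> hN hP; pose f c i acc := nat_of_bool ((acc != 0) && P c i).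
have all_iteri n c : nat_of_bool (all (P c) (iota 0 n)) = iteri n (f c) 1.
  elim: n => [|n IH] //; rewrite -addn1 iotaD all_cat addn1 iteriS -IH /f /=.
  by rewrite andbT add0n; case: all.
apply: (polytime_ext (G := fun c => iteri (N c) (f c) 1)) => //.
apply: (polytime_iteri (f := f) (B := fun=> 1)) => // [|||c i _].
- by polytime_tac.
- by apply: polytime_ctx_bounded; polytime_tac.
- by have hP' := polytime_pop hP; rewrite /f; polytime_tac.
- by rewrite -all_iteri; case: all.
Qed.

Lemma polytime_has N (P : ctx -> nat -> bool) :
  polytime_nat N -> polytime_bool (fun c => P (pop c) (top c)) ->
  polytime_bool (fun c => has (P c) (iota 0 (N c))).
Proof.
move=> hN hP.
have := polytime_negb (polytime_all (P := fun c i => ~~ P c i) hN (polytime_negb hP)).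
apply: polytime_ext => c; rewrite -has_predC; congr nat_of_bool.
by apply: eq_has => i /=; rewrite negbK.
Qed.

Lemma polytime_find N (P : ctx -> nat -> bool) :
  polytime_nat N -> polytime_bool (fun c => P (pop c) (top c)) ->
  polytime_nat (fun c => find (P c) (iota 0 (N c))).
Proof.
move=> hN hP; pose f c i acc := if (acc == i) && ~~ P c i then i.+1 else acc.
have find_iteri n c : find (P c) (iota 0 n) = iteri n (f c) 0.
  elim: n => [|n IH] //; rewrite -addn1 iotaD find_cat addn1 iteriS -IH /f /= add0n.
  rewrite size_iota has_find size_iota; have := find_size (P c) (iota 0 n).
  rewrite size_iota; move: (find _ _) => q; rewrite leq_eqVlt => /predU1P[->|qn].
    by rewrite ltnn eqxx; case: (P c n); rewrite ?addn0 ?addn1.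
  by rewrite qn (ltn_eqF qn).
apply: (polytime_ext (G := fun c => iteri (N c) (f c) 0)) => //.
apply: (polytime_iteri (f := f) hN (polytime_const 0) (polytime_ctx_bounded hN)) =>
  [|c i iN].
- by have hP' := polytime_pop hP; rewrite /f; polytime_tac.
- by rewrite -find_iteri (leq_trans (find_size _ _)) ?size_iota.
Qed.

Lemma polytime_count N (P : ctx -> nat -> bool) :
  polytime_nat N -> polytime_bool (fun c => P (pop c) (top c)) ->
  polytime_nat (fun c => count (P c) (iota 0 (N c))).
Proof.
move=> hN hP; pose f c i acc := acc + P c i.
have count_iteri n c : count (P c) (iota 0 n) = iteri n (f c) 0.
  elim: n => [|n IH] //.
  by rewrite -addn1 iotaD count_cat addn1 iteriS -IH /f /= addn0 add0n.
apply: (polytime_ext (G := fun c => iteri (N c) (f c) 0)) => //.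
apply: (polytime_iteri (f := f) hN (polytime_const 0) (polytime_ctx_bounded hN)) =>
  [|c i iN].
- exact: polytime_add polytime_top (polytime_pop hP).
- by rewrite -count_iteri (leq_trans (count_size _ _)) ?size_iota.
Qed.

Lemma polytime_all_const (I : Type) (l : seq I) (P : ctx -> I -> bool) :
  (forall i, polytime_bool (fun c => P c i)) -> polytime_bool (fun c => all (P c) l).
Proof. by move=> hP; elim: l => [|i l IH] /=; polytime_tac. Qed.

Lemma polytime_has_const (I : Type) (l : seq I) (P : ctx -> I -> bool) :
  (forall i, polytime_bool (fun c => P c i)) -> polytime_bool (fun c => has (P c) l).
Proof. by move=> hP; elim: l => [|i l IH] /=; polytime_tac. Qed.

#[local] Hint Resolve polytime_minn polytime_all polytime_has polytime_find
  polytime_count : polytime.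
#[local] Hint Resolve polytime_all_const polytime_has_const | 3 : polytime.

Lemma find_iota (P : pred nat) q n :
  q < n -> P q -> (forall i, i < q -> ~~ P i) -> find P (iota 0 n) = q.
Proof.
move=> qn Pq before_q; rewrite -(subnKC qn) iotaD find_cat -addn1 iotaD has_cat /=.
rewrite Pq orbT find_cat /= Pq addn0 size_iota ifN //.
by apply/hasPn => i; rewrite mem_iota; apply: before_q.
Qed.

Lemma polytime_divn F G :
  polytime_nat F -> polytime_nat G -> polytime_nat (fun c => F c %/ G c).
Proof.
move=> hF hG; apply: (polytime_ext (G := fun c => if G c == 0 then 0 else
    find (fun i => F c < G c * i.+1) (iota 0 (F c).+1))) => [c|]; last by polytime_tac.
case: (posnP (G c)) => [->|G0]; first by rewrite divn0.
symmetry; apply: find_iota; first exact: leq_div.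
  by rewrite mulnC; apply: ltn_ceil.
by move=> i iq; rewrite -leqNgt mulnC -leq_divRL.
Qed.

Lemma polytime_modn F G :
  polytime_nat F -> polytime_nat G -> polytime_nat (fun c => F c %% G c).
Proof.
move=> hF hG.
apply: polytime_ext (polytime_sub hF (polytime_mul (polytime_divn hF hG) hG)).
by move=> c; rewrite {2}(divn_eq (F c) (G c)) addKn.
Qed.

Lemma polytime_half F : polytime_nat F -> polytime_nat (fun c => (F c)./2).
Proof.
move=> hF; apply: polytime_ext (polytime_divn hF (polytime_const 2)) => c.
by rewrite divn2.
Qed.

Lemma polytime_double F : polytime_nat F -> polytime_nat (fun c => (F c).*2).
Proof. by move=> hF; apply: polytime_ext (polytime_add hF hF) => c; rewrite addnn. Qed.

Lemma polytime_odd F : polytime_nat F -> polytime_bool (fun c => odd (F c)).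
Proof.
move=> hF; apply: polytime_ext (polytime_modn hF (polytime_const 2)) => c.
by rewrite modn2.
Qed.

Lemma polytime_table (t : seq nat) F :
  polytime_nat F -> polytime_nat (fun c => nth 0 t (F c)).
Proof.
elim: t F => [|a t IH] F hF.
  by apply: polytime_ext polytime_zero => c; rewrite nth_nil.
have hif : polytime_nat (fun c => if F c == 0 then a else nth 0 t (F c).-1).
  by have := IH _ (polytime_predn hF) => ht; polytime_tac.
by apply: polytime_ext hif => c; case: (F c).
Qed.

#[local] Hint Resolve polytime_divn polytime_modn polytime_half polytime_double
  polytime_odd polytime_table : polytime.

(* Intermediate strings are never stored: whoever needs a bit recomputes it. *)
Definition polytime_str (S : ctx -> seq bool) : Prop :=
  polytime_nat (fun c => size (S c)) /\
  polytime_bool (fun c => nth false (S (pop c)) (top c)).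

Lemma polytime_size S : polytime_str S -> polytime_nat (fun c => size (S c)).
Proof. by case. Qed.

Lemma polytime_nth S F : polytime_str S -> polytime_nat F ->
  polytime_bool (fun c => nth false (S c) (F c)).
Proof.
case=> _ hS hF.
exact: (polytime_subst (f := fun c n => nat_of_bool (nth false (S c) n)) weakening_id).
Qed.

Lemma polytime_str_ext S S' : S =1 S' -> polytime_str S' -> polytime_str S.
Proof. by move=> /functional_extensionality ->. Qed.

Lemma polytime_str_input : polytime_str (fun c => c.1).
Proof.
by split; [apply: polytime_size_input | apply: (polytime_nth_input polytime_top)].
Qed.

Lemma polytime_str_weaken k S :
  weakening k -> polytime_str S -> polytime_str (fun c => S (k c)).
Proof.
move=> hk [size_S nth_S]; split; first exact: (polytime_weaken hk size_S).
apply: (polytime_subst (f := fun c n => nat_of_bool (nth false (S c) n))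
  (k := fun c => k (pop c))) polytime_top nth_S.
by case: hk => j kj; exists j.+1 => c; rewrite kj iterSr.
Qed.

Lemma polytime_mkseq N (P : ctx -> nat -> bool) :
  polytime_nat N -> polytime_bool (fun c => P (pop c) (top c)) ->
  polytime_str (fun c => mkseq (P c) (N c)).
Proof.
move=> hN hP; split; first by apply: polytime_ext hN => c; rewrite size_mkseq.
have hnth : polytime_bool (fun c => (top c < N (pop c)) && P (pop c) (top c)).
  by polytime_tac.
apply: polytime_ext hnth => c; case: ltnP => lt_N; first by rewrite nth_mkseq.
by rewrite nth_default ?size_mkseq.
Qed.

Ltac polytime_str_weaken_tac :=
  match goal with
  | |- polytime_str (fun c => ?S (pop (@?k c))) =>
      apply (@polytime_str_weaken (fun c => pop (k c)) S)
  end.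

#[local] Hint Resolve polytime_size polytime_nth polytime_str_input
  polytime_mkseq : polytime.
#[local] Hint Extern 2 (polytime_str _) => polytime_str_weaken_tac : polytime.

Lemma polytime_str_const s : polytime_str (fun=> s).
Proof.
split; first by polytime_tac.
have hs : polytime_nat (fun c => nth 0 (map nat_of_bool s) (top c)) by polytime_tac.
apply: polytime_ext hs => c; case: (ltnP (top c) (size s)) => lt_s.
  by rewrite (nth_map false).
by rewrite !nth_default ?size_map.
Qed.

Lemma polytime_drop S F :
  polytime_str S -> polytime_nat F -> polytime_str (fun c => drop (F c) (S c)).
Proof.
move=> hS hF; have hsize : polytime_nat (fun c => size (S c) - F c) by polytime_tac.
have hnth : polytime_bool (fun c => nth false (S (pop c)) (F (pop c) + top c)).
  by polytime_tac.
by split; [apply: polytime_ext hsize | apply: polytime_ext hnth] => c;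
  rewrite ?size_drop ?nth_drop.
Qed.

Lemma size_pair_str x y : size (pair_str x y) = (size x).*2.+1 + size y.
Proof. by elim: x => //= b x ->. Qed.

Lemma nth_pair_str x y i : nth false (pair_str x y) i =
  if i < (size x).*2 then ~~ odd i || nth false x i./2
  else if i == (size x).*2 then false else nth false y (i - (size x).*2.+1).
Proof.
elim: x i => [|b x IH] i; first by case: i => [|i] //=; rewrite subn1.
by case: i => [|[|i]] //=; rewrite IH ltnS ltnS negbK.
Qed.

Lemma polytime_pair_str S S' : polytime_str S -> polytime_str S' ->
  polytime_str (fun c => pair_str (S c) (S' c)).
Proof.
move=> hS hS'; split.
  have hsize : polytime_nat (fun c => (size (S c)).*2.+1 + size (S' c)).
    by polytime_tac.
  by apply: polytime_ext hsize => c; rewrite size_pair_str.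
have hnth : polytime_bool (fun c =>
    if top c < (size (S (pop c))).*2
    then ~~ odd (top c) || nth false (S (pop c)) (top c)./2
    else if top c == (size (S (pop c))).*2 then false
    else nth false (S' (pop c)) (top c - (size (S (pop c))).*2.+1)).
  by polytime_tac.
by apply: polytime_ext hnth => c; rewrite nth_pair_str.
Qed.

Lemma polytime_nseq b F : polytime_nat F -> polytime_str (fun c => nseq (F c) b).
Proof.
move=> hF; have hmk : polytime_str (fun c => mkseq (fun=> b) (F c)) by polytime_tac.
apply: polytime_str_ext hmk => c.
by rewrite /mkseq; elim: (F c) 0 => //= n IH i; rewrite -IH.
Qed.

Lemma polytime_seq1 P : polytime_bool P -> polytime_str (fun c => [:: P c]).
Proof.
move=> hP; exact: (polytime_mkseq (P := fun c _ => P c) (polytime_const 1)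
  (polytime_pop hP)).
Qed.

#[local] Hint Resolve polytime_str_const | 0 : polytime.
#[local] Hint Resolve polytime_drop polytime_pair_str polytime_nseq
  polytime_seq1 : polytime.

Section Emit.
Variables (aux : finType) (s : nat).
Hypothesis s0 : 0 < s.

(* Register 0 holds the output bits from position [i] on. *)
Definition emit_store (m : store aux) i (l : seq bool) : store aux :=
  upd (upd m s (unary aux i)) 0 (map inl l).

Definition emit_body (p : prog aux) : prog aux :=
  Seq (Pop s) (Seq p (Case s.+1 (fun a =>
    if a then Seq (Pop s.+1) (Push 0 (inl true)) else Push 0 (inl false)))).

Lemma emit_body_runs m p i (b : bool) l T : m s.+1 = [::] ->
  runs p (emit_store m i l) T (upd (emit_store m i l) s.+1 (unary aux b)) ->
  runs (emit_body p) (emit_store m i.+1 l) (1 + (T + 3)) (emit_store m i (b :: l)).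
Proof.
move=> ms1 run_p; apply: runs_seq (runs_pop _ _) _.
have -> : upd (emit_store m i.+1 l) s (behead (emit_store m i.+1 l s)) =
    emit_store m i l.
  have -> : emit_store m i.+1 l s = unary aux i.+1 by rewrite /emit_store; updE.
  by rewrite behead_unary /emit_store; store_eq.
apply: runs_seq run_p _; apply: (runs_case (n := 2)); rewrite upd_eq.
set m1 := emit_store m i l; have m1s : m1 s.+1 = [::] by rewrite /m1 /emit_store; updE.
have -> : emit_store m i (b :: l) = upd m1 0 (inl b :: m1 0).
  by rewrite /m1 /emit_store upd_eq upd_upd.
case: b => /=; last by rewrite (upd_id m1s); apply: runs_le (runs_push _ _ _) _.
apply: (runs_seq (n := 1) (n' := 1)); first exact: runs_pop.
by rewrite upd_eq /= upd_upd (upd_id m1s); apply: runs_push.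
Qed.

Lemma represents_emit_store m b r c i l : 0 < b -> all (leq 1) r ->
  represents m b r s c ->
  represents (emit_store m i l) b (s :: r) s.+1 (push i c).
Proof.
move=> b0 r0 /(represents_push i)[str tmp base vars regs free]; rewrite /emit_store.
split=> //.
- by rewrite upd_neq //; lia.
- rewrite -[RHS]vars; apply/eq_in_map => q.
  by rewrite inE => /predU1P[->|/(allP r0) q0]; rewrite upd_neq //; lia.
- by move=> q sq; rewrite upd_neq ?free //; lia.
Qed.

End Emit.

(* Output bits are pushed from the last one to the first. *)
Lemma polytime_str_emit S aux b r s : polytime_str S -> 0 < b -> all (leq 1) r ->
  exists (p : prog aux) e, forall m c, represents m b r s c -> m 0 = [::] ->
    runs p m (ctx_size c ^ e) (upd m 0 (map inl (S c))).
Proof.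
move=> [size_S nth_S] b0 r0; have [pN [eN hpN]] := size_S aux b r s.
have [p [e hp]] := nth_S aux b (s :: r) s.+1.
pose T A := 1 + ((A + A ^ eN) ^ e + 3).
have [k hk] : poly_bounded (fun A => A ^ eN + (A ^ eN * (T A).+1).+1).
  by rewrite /T; poly_bounded_tac.
exists (Seq pN (While s isSome (emit_body s p))), k => m c rep m0.
apply: runs_le (hk _ _) => //; set A := ctx_size c.
have run_N := hpN _ _ rep; set n := size (S c) in run_N.
have n_le : n <= A ^ eN := represents_value_le rep run_N.
have s0 : 0 < s by have := represents_base rep; lia.
pose ms j := emit_store s m (n - j) (drop (n - j) (S c)).
have m_init : upd m s (unary aux n) = ms 0.
  by rewrite /ms /emit_store subn0 drop_size; store_eq; rewrite m0.
have -> : upd m 0 (map inl (S c)) = ms n.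
  by rewrite /ms /emit_store subnn drop0 (@upd_id _ _ s) // (represents_free rep).
apply: runs_seq run_N _; rewrite m_init.
apply: runs_le (runs_while (T := T A) (N := n) _ _) _; first last.
- by rewrite ltnS leq_mul2r n_le orbT.
- by rewrite /ms /emit_store subnn; updE.
move=> j jn; have nj : n - j = (n - j.+1).+1 by lia.
split; first by rewrite /ms nj /emit_store; updE.
set i := n - j.+1; have i_le : i <= A ^ eN by lia.
have rep_i := represents_emit_store s0 i (drop i.+1 (S c)) b0 r0 rep.
have := hp _ _ rep_i; rewrite ctx_size_push pop_push /= => run_p.
rewrite /ms nj -/i [drop i _](drop_nth false); last lia.
have ms1 : m s.+1 = [::] by apply: (represents_free rep).
apply: runs_le (emit_body_runs s0 ms1 run_p) _.
by rewrite /T leq_add2l leq_add2r; apply: leq_expl; rewrite leq_add2l.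
Qed.

Lemma load_input_runs aux (m : store aux) n :
  m n.+1 = [::] -> m n.+2 = [::] ->
  runs (Seq (move isSome 0 n.+2) (move isSome n.+2 n.+1)) m
    ((4 * size (m 0)).+1 + (4 * size (m 0)).+1) (upd (upd m 0 [::]) n.+1 (m 0)).
Proof.
move=> m1 m2; apply: runs_seq; first exact: move_all_runs.
set m' := upd _ _ _; have m'2 : m' n.+2 = rev (m 0).
  by rewrite /m' upd_eq m2 catrevE cats0.
have := @move_all_runs _ m' n.+2 n.+1; rewrite m'2 size_rev catrevE revK.
have -> : m' n.+1 = [::] by rewrite /m'; updE.
rewrite cats0; set x := m 0.
have -> : upd (upd m 0 [::]) n.+1 x = upd (upd m' n.+2 [::]) n.+1 x.
  by rewrite /m' -/x; store_eq.
by apply; lia.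
Qed.

Lemma polytime_str_polytime S : polytime_str S -> polytime (fun x => S (x, [::])).
Proof.
move=> hS; have [p [e hp]] := @polytime_str_emit S unit 1 [::] 3 hS isT isT.
pose load : prog unit := Seq (move isSome 0 2) (move isSome 2 1).
have [M hM] := prog_machine (Seq load p).
have [k hk] : poly_bounded (fun a => 2 * ((4 * a).+1 + (4 * a).+1 + a ^ e)).
  by poly_bounded_tac.
exists M, (k + 2 ^ k) => x; pose m := init_store unit x.
have rep : represents (upd (upd m 0 [::]) 1 (m 0)) 1 [::] 3 (x, [::]).
  by split=> // i i3; rewrite /m /init_store; updE.
have run_load := @load_input_runs _ m 0 erefl erefl.
have run := runs_seq run_load (hp _ _ rep erefl).
apply: hM run _ _ _; first by rewrite upd_eq.
have -> : ctx_size (x, [::]) = (size x).+2 by rewrite /ctx_size /= addn0.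
rewrite /m /init_store size_map; set n := size x.
apply: leq_trans (_ : 2 * ((4 * n.+2).+1 + (4 * n.+2).+1 + n.+2 ^ e) <= _); first lia.
apply: leq_trans (hk _ _) _ => //.
have n2_le : n.+2 ^ k <= (2 * n.+1) ^ k by apply: leq_expl; lia.
apply: leq_trans n2_le _; rewrite expnMn; apply: leq_mul; first lia.
by apply: leq_pexp2l; lia.
Qed.

(** * Simulation of Turing machines by stack programs *)

Section Simulation.
Variable M : tm.
Notation K := (tm_tapes M).
Notation tapes := ('I_K.+1 -> tape M).

Definition sim_aux : finType := (option (tm_aux M) + tm_state M)%type.

Definition encode_sym (a : tm_sym M) : symbol sim_aux :=
  match a with
  | None => inr (inl None)
  | Some (inl b) => inl b
  | Some (inr a) => inr (inl (Some a))
  end.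

Definition decode_sym (o : option (symbol sim_aux)) : tm_sym M :=
  match o with
  | Some (inl b) => Some (inl b)
  | Some (inr (inl (Some a))) => Some (inr a)
  | _ => None
  end.

Lemma decode_head s : decode_sym (ohead (map encode_sym s)) = head None s.
Proof. by case: s => [|[[b|a]|] s]. Qed.

(* Tape [i] occupies the registers [2 i] (head and right part) and [2 i + 1]
   (left part); the state is kept in the next register. *)
Definition state_reg := K.+1.*2.

Definition config_store (m : store sim_aux) (q : tm_state M) (tp : tapes) :
    store sim_aux := fun j =>
  if j < state_reg then
    (if odd j then map encode_sym (tp (inord j./2)).1
     else map encode_sym (tp (inord j./2)).2)
  else if j == state_reg then [:: inr (inr q)] else m j.

Definition upd_tape (tp : tapes) i t : tapes := fun j => if j == i then t else tp j.

Lemma left_reg_lt (i : 'I_K.+1) : i.*2.+1 < state_reg.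
Proof. by rewrite /state_reg; have := ltn_ord i; lia. Qed.

Lemma config_store_right m q tp (i : 'I_K.+1) :
  config_store m q tp i.*2 = map encode_sym (tp i).2.
Proof.
by rewrite /config_store (ltnW (left_reg_lt i)) odd_double doubleK inord_val.
Qed.

Lemma config_store_left m q tp (i : 'I_K.+1) :
  config_store m q tp i.*2.+1 = map encode_sym (tp i).1.
Proof.
by rewrite /config_store left_reg_lt /= odd_double /= uphalf_double inord_val.
Qed.

Lemma config_store_state m q tp : config_store m q tp state_reg = [:: inr (inr q)].
Proof. by rewrite /config_store ltnn eqxx. Qed.

Lemma config_store_other m q tp i : state_reg < i -> config_store m q tp i = m i.
Proof. by move=> lt_i; rewrite /config_store ltnNge (ltnW lt_i) gtn_eqF. Qed.

Lemma upd_config_store_right m q tp (i : 'I_K.+1) r :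
  upd (config_store m q tp) i.*2 (map encode_sym r) =
  config_store m q (upd_tape tp i ((tp i).1, r)).
Proof.
apply: functional_extensionality => j; rewrite /upd /config_store /upd_tape.
case: eqP => [->|ij].
  by rewrite (ltnW (left_reg_lt i)) odd_double doubleK inord_val eqxx.
case: ltnP => // lt_j; rewrite -val_eqE /= inordK; last first.
  by rewrite /state_reg in lt_j; lia.
case: eqP => // e; case: ifP => //= o; last by lia.
by congr (map encode_sym (tp _).1); apply: val_inj; rewrite /= inordK e.
Qed.

Lemma upd_config_store_left m q tp (i : 'I_K.+1) l :
  upd (config_store m q tp) i.*2.+1 (map encode_sym l) =
  config_store m q (upd_tape tp i (l, (tp i).2)).
Proof.
apply: functional_extensionality => j; rewrite /upd /config_store /upd_tape.
case: eqP => [->|ij].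
  by rewrite left_reg_lt /= odd_double /= uphalf_double inord_val eqxx.
case: ltnP => // lt_j; rewrite -val_eqE /= inordK; last first.
  by rewrite /state_reg in lt_j; lia.
case: eqP => // e; case: ifP => //= o; first by lia.
by congr (map encode_sym (tp _).2); apply: val_inj; rewrite /= inordK e.
Qed.

Lemma upd_config_store_state m q q' tp :
  upd (config_store m q tp) state_reg [:: inr (inr q')] = config_store m q' tp.
Proof.
apply: functional_extensionality => j; rewrite /upd /config_store.
by case: eqP => [->|]; rewrite ?ltnn.
Qed.

Lemma upd_tape_upd tp i t t' : upd_tape (upd_tape tp i t) i t' = upd_tape tp i t'.
Proof. by apply: functional_extensionality => j; rewrite /upd_tape; case: eqP. Qed.

Lemma upd_tape_eq tp i t : upd_tape tp i t i = t.
Proof. by rewrite /upd_tape eqxx. Qed.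

Definition act_prog (i : 'I_K.+1) (a : tm_sym M * direction) : prog sim_aux :=
  Seq (Pop i.*2)
    match a.2 with
    | Stay => Push i.*2 (encode_sym a.1)
    | MoveR => Push i.*2.+1 (encode_sym a.1)
    | MoveL => Seq (Push i.*2 (encode_sym a.1)) (Case i.*2.+1 (fun o =>
        Seq (Pop i.*2.+1) (Push i.*2 (encode_sym (decode_sym o)))))
    end.

Lemma push_right_runs m q tp (i : 'I_K.+1) a :
  runs (Push i.*2 (encode_sym a)) (config_store m q tp) 1
    (config_store m q (upd_tape tp i ((tp i).1, a :: (tp i).2))).
Proof.
rewrite -upd_config_store_right map_cons -(config_store_right m q).
exact: runs_push.
Qed.

Lemma push_left_runs m q tp (i : 'I_K.+1) a :
  runs (Push i.*2.+1 (encode_sym a)) (config_store m q tp) 1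
    (config_store m q (upd_tape tp i (a :: (tp i).1, (tp i).2))).
Proof.
rewrite -upd_config_store_left map_cons -(config_store_left m q).
exact: runs_push.
Qed.

Lemma pop_right_runs m q tp (i : 'I_K.+1) :
  runs (Pop i.*2) (config_store m q tp) 1
    (config_store m q (upd_tape tp i ((tp i).1, behead (tp i).2))).
Proof.
by rewrite -upd_config_store_right -behead_map -(config_store_right m q); apply: runs_pop.
Qed.

Lemma pop_left_runs m q tp (i : 'I_K.+1) :
  runs (Pop i.*2.+1) (config_store m q tp) 1
    (config_store m q (upd_tape tp i (behead (tp i).1, (tp i).2))).
Proof.
by rewrite -upd_config_store_left -behead_map -(config_store_left m q); apply: runs_pop.
Qed.

Lemma act_prog_runs m q tp i a :
  runs (act_prog i a) (config_store m q tp) 5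
    (config_store m q (upd_tape tp i (write_move a (tp i)))).
Proof.
case: a => a d; apply: (runs_seq (n := 1) (n' := 4)); first exact: pop_right_runs.
set tp1 := upd_tape _ _ _.
have tp1i : tp1 i = ((tp i).1, behead (tp i).2) by rewrite /tp1 upd_tape_eq.
case: d => /=; rewrite [write_move _ _]surjective_pairing; case: (tp i) tp1i => l r tp1i.
- apply: (runs_seq (n := 1) (n' := 3)); first exact: push_right_runs.
  set tp2 := upd_tape tp1 _ _.
  have tp2i : tp2 i = (l, a :: behead r) by rewrite /tp2 upd_tape_eq tp1i.
  apply: (runs_case (n := 2)); rewrite config_store_left tp2i decode_head.
  apply: (runs_seq (n := 1) (n' := 1)); first exact: pop_left_runs.
  pose tp3 := upd_tape tp2 i (behead (tp2 i).1, (tp2 i).2).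
  have := push_right_runs m q tp3 i (head None l); rewrite {}/tp3.
  by rewrite upd_tape_eq tp2i /tp2 /tp1 !upd_tape_upd.
- have := push_left_runs m q tp1 i a.
  by rewrite tp1i /tp1 upd_tape_upd => /runs_le; apply.
- have := push_right_runs m q tp1 i a.
  by rewrite tp1i /tp1 upd_tape_upd => /runs_le; apply.
Qed.

Definition act_all (l : seq 'I_K.+1) (act : 'I_K.+1 -> tm_sym M * direction) :
    prog sim_aux :=
  foldr (fun i p => Seq (act_prog i (act i)) p) Skip l.

Lemma act_all_runs m q tp l act : uniq l ->
  runs (act_all l act) (config_store m q tp) (5 * size l).+1
    (config_store m q (fun j => if j \in l then write_move (act j) (tp j) else tp j)).
Proof.
elim: l tp => [|i l IH] tp /=; first by move=> _; apply: runs_skip.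
case/andP=> i_l uniq_l; rewrite mulnS -addnS.
apply: runs_seq (act_prog_runs _ _ _ _ _) _.
set tp2 := (fun j => if j \in i :: l then _ else _).
pose tp1 := upd_tape tp i (write_move (act i) (tp i)).
have -> : tp2 = (fun j => if j \in l then write_move (act j) (tp1 j) else tp1 j).
  apply: functional_extensionality => j; rewrite /tp2 /tp1 /upd_tape inE.
  by case: eqP => [->|_] /=; [rewrite (negbTE i_l)|].
exact: IH.
Qed.

Fixpoint scan_all (l : seq 'I_K.+1) (f : 'I_K.+1 -> tm_sym M)
    (k : ('I_K.+1 -> tm_sym M) -> prog sim_aux) : prog sim_aux :=
  if l is i :: l' then
    Case i.*2 (fun o => scan_all l' (fun j => if j == i then decode_sym o else f j) k)
  else k f.

Lemma scan_all_runs m q tp l f k n m' :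
  runs (k (fun j => if j \in l then scanned (tp j) else f j))
    (config_store m q tp) n m' ->
  runs (scan_all l f k) (config_store m q tp) (size l + n) m'.
Proof.
elim: l f => [|i l IH] f //= run_k; apply: runs_case; apply: IH.
rewrite config_store_right decode_head; set f' := (X in k X).
have -> // : f' = (fun j => if j \in i :: l then scanned (tp j) else f j).
apply: functional_extensionality => j; rewrite /f' inE.
by case: eqP => [->|_] //=; case: ifP.
Qed.

Definition step_prog : prog sim_aux :=
  Case state_reg (fun o => if o is Some (inr (inr q)) then
    scan_all (enum 'I_K.+1) (fun=> None) (fun f =>
      let: (q', act) := tm_trans q [ffun i => f i] in
      Seq (act_all (enum 'I_K.+1) act)
        (Seq (Pop state_reg) (Push state_reg (inr (inr q')))))
    else Skip).

Definition run_prog : prog sim_aux :=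
  While state_reg
    (fun o => if o is Some (inr (inr q)) then ~~ tm_halt q else false) step_prog.

Definition step_cost := (K.+1 + ((5 * K.+1).+1 + 2)).+1.

Lemma step_prog_runs m (c : config M) : ~~ tm_halt c.1 ->
  runs step_prog (config_store m c.1 c.2) step_cost
    (config_store m (tm_step c).1 (tm_step c).2).
Proof.
move=> running; apply: runs_case; rewrite config_store_state /=.
pose n := size (enum 'I_K.+1); apply: (runs_le (n := n + ((5 * n).+1 + 2))); last first.
  by rewrite /n size_enum_ord.
apply: scan_all_runs.
have -> : [ffun i => if i \in enum 'I_K.+1 then scanned (c.2 i) else None] =
    [ffun i => scanned (c.2 i)].
  by apply/ffunP => i; rewrite !ffunE mem_enum.
rewrite /tm_step (negbTE running); case: tm_trans => q' act /=.
apply: runs_seq (act_all_runs _ _ _ _ (enum_uniq _)) _.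
set tp := (fun j => _).
have -> : tp = (fun i => write_move (act i) (c.2 i)).
  by apply: functional_extensionality => i; rewrite /tp mem_enum.
apply: (runs_seq (n := 1) (n' := 1)); first exact: runs_pop.
rewrite config_store_state /= -(upd_config_store_state m c.1 q').
rewrite -(upd_upd _ _ [::] [:: inr (inr q')]); set m1 := upd _ _ [::].
by have := runs_push m1 state_reg (inr (inr q')); rewrite {3}/m1 upd_eq.
Qed.

Lemma run_prog_runs m t (c : config M) : tm_halt (iter t (@tm_step M) c).1 ->
  runs run_prog (config_store m c.1 c.2) (t * step_cost.+1).+1
    (config_store m (iter t (@tm_step M) c).1 (iter t (@tm_step M) c).2).
Proof.
elim: t c => [|t IH] c halted.
  by apply: runs_while_stop; rewrite ?config_store_state ?negbK.
case: (boolP (tm_halt c.1)) => halted_c.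
  by rewrite iter_tm_step_halted //; apply: runs_while_stop;
    rewrite ?config_store_state ?negbK.
rewrite iterSr in halted *; rewrite mulSn addSn -addnS.
by apply: runs_while_step (step_prog_runs _ halted_c) (IH _ halted);
  rewrite config_store_state.
Qed.

Lemma config_store_init m x : m 0 = map inl x ->
  (forall i, 0 < i <= state_reg -> m i = [::]) ->
  config_store m (tm_start M) (tm_init M x).2 =
  upd m state_reg (inr (inr (tm_start M)) :: m state_reg).
Proof.
move=> m0 empty; apply: functional_extensionality => j; rewrite /config_store /upd.
case: (j =P state_reg) => [->|j_state]; first by rewrite ltnn empty // leqnn.
case: ltnP => // lt_j; rewrite /tm_init /= -val_eqE /= inordK; last first.
  by rewrite /state_reg in lt_j; lia.
case: (posnP j) => [->|j0]; first by rewrite /= m0 -map_comp.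
rewrite empty; last by lia.
by case: ifP => // o; case: eqP => //; lia.
Qed.

Definition is_bit (o : option (symbol sim_aux)) :=
  if o is Some (inl _) then true else false.

Lemma encode_leading_bits s : exists r : seq (symbol sim_aux),
  map encode_sym s = map inl (leading_bits s) ++ r /\ ~~ is_bit (ohead r).
Proof.
elim: s => [|[[b|a]|] s [r [IH r_bit]]] /=; first by exists [::].
- by exists r; rewrite IH.
- by exists (inr (inl (Some a)) :: map encode_sym s).
- by exists (inr (inl None) :: map encode_sym s).
Qed.

Definition extract_bits b : prog sim_aux :=
  Seq (move is_bit 0 b.+1) (Seq (move isSome b.+1 b) (clear sim_aux 0)).

Lemma extract_bits_runs m b y r : 0 < b -> m 0 = map inl y ++ r ->
  ~~ is_bit (ohead r) -> m b = [::] -> m b.+1 = [::] ->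
  runs (extract_bits b) m ((4 * size y).+1 + ((4 * size y).+1 + (2 * size r).+1))
    (upd (upd m 0 [::]) b (map inl y)).
Proof.
move=> b0 m0 r_bit mb mb1.
have y_bits : all (fun a => is_bit (Some a)) (map inl y).
  by rewrite all_map; apply/allP.
have := move_runs (isT : 0 != b.+1) m0 y_bits r_bit.
rewrite size_map => run_bits; apply: runs_seq run_bits _.
rewrite mb1 catrevE cats0; set m1 := upd _ b.+1 _.
have m1b1 : m1 b.+1 = rev (map inl y) by rewrite /m1 upd_eq.
have m1b : m1 b = [::] by rewrite /m1; updE.
have := @move_all_runs _ m1 b.+1 b.
rewrite m1b1 m1b size_rev size_map catrevE revK cats0 => run_move.
apply: runs_seq (run_move _) _; first by lia.
clear m1b m1b1 run_move; set m2 := upd _ b _.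
have -> : upd (upd m 0 [::]) b (map inl y) = upd m2 0 [::].
  by rewrite /m2 /m1; store_eq.
rewrite -(_ : m2 0 = r); first exact: clear_runs.
by rewrite /m2 /m1; updE.
Qed.

Definition sim_base := state_reg.+1.
Definition sim_prog : prog sim_aux :=
  Seq (Seq (Push state_reg (inr (inr (tm_start M)))) run_prog) (extract_bits sim_base).
Definition sim_cost := 20 * step_cost.+2.

Lemma sim_cost_bound nx ny nu t : ny + nu <= nx + (1 + (t * step_cost.+1).+1) ->
  1 + (t * step_cost.+1).+1 + ((4 * ny).+1 + ((4 * ny).+1 + (2 * nu).+1)) <=
  sim_cost * (t + nx).+1.
Proof. by rewrite /sim_cost; move: step_cost => C; nia. Qed.

Lemma sim_prog_runs m x y t r s vs : outputs_within M x y t ->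
  (forall i, i < sim_base -> m i = [::]) -> all (ltn sim_base.+1) r ->
  represents m sim_base r s ([::], vs) ->
  exists m', [/\ runs sim_prog (upd m 0 (map inl x)) (sim_cost * (t + size x).+1) m',
                 m' 0 = [::] & represents m' sim_base r s (y, vs)].
Proof.
move=> [halted out] empty r_gt [mb mb1 base vars regs free].
set c := iter t _ _ in halted out; set m0 := upd m 0 _.
have m0_neq i : 0 < i -> m0 i = m i by case: i => // i _; rewrite /m0 upd_neq.
have run_c : runs (Seq (Push state_reg (inr (inr (tm_start M)))) run_prog) m0
    (1 + (t * step_cost.+1).+1) (config_store m0 c.1 c.2).
  apply: runs_seq (runs_push _ _ _) _; rewrite -(@config_store_init _ x) //.
    exact: run_prog_runs halted.
  by move=> i /andP[i0 lt_i]; rewrite m0_neq ?empty.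
set m1 := config_store m0 c.1 c.2 in run_c.
have m1_other i : sim_base <= i -> m1 i = m i.
  by move=> le_i; rewrite /m1 config_store_other ?m0_neq //; apply: leq_trans le_i.
have m10 : m1 0 = map encode_sym (c.2 ord0).2 := config_store_right m0 c.1 c.2 ord0.
have [u [m1_bits u_bit]] := encode_leading_bits (c.2 ord0).2.
rewrite out -m10 in m1_bits.
have size_le : size y + size u <= size x + (1 + (t * step_cost.+1).+1).
  case: run_c => t' t'_le /exec_size /(_ 0).
  rewrite m1_bits size_cat /m0 upd_eq !size_map => /leq_trans; apply.
  by rewrite leq_add2l.
have run_bits := extract_bits_runs (isT : 0 < sim_base) m1_bits u_bit.
rewrite !m1_other // in run_bits; have {}run_bits := run_bits mb mb1.
exists (upd (upd m1 0 [::]) sim_base (map inl y)); split; first 2 last.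
- have m1_free i : sim_base < i -> upd (upd m1 0 [::]) sim_base (map inl y) i = m i.
    move=> lt_i; have i0 : 0 < i := leq_ltn_trans (leq0n _) lt_i.
    by rewrite upd_neq ?gtn_eqF // upd_neq -?lt0n // m1_other // ltnW.
  split=> //; first by rewrite upd_eq.
  + by rewrite m1_free.
  + by rewrite -[RHS]vars; apply/eq_in_map => i /(allP r_gt) ri; apply: m1_free (ltnW ri).
  + by move=> i si; rewrite m1_free ?free // (leq_trans (ltnW base) si).
- exact: runs_le (runs_seq run_c run_bits) (sim_cost_bound size_le).
- by rewrite upd_neq ?upd_eq.
Qed.

End Simulation.

Lemma computable_polytime_comp f (h : nat -> nat -> nat) : computable f ->
  polytime_nat (fun c => h (top c) (size c.1)) -> computable (fun n => h n (f n)).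
Proof.
case=> M hM hh; set b := sim_base M.
have hS : polytime_str (fun c => nseq (h (top c) (size c.1)) true) by polytime_tac.
have [q [e hq]] := @polytime_str_emit _ (sim_aux M) b [:: b.+2] b.+3 hS isT isT.
have [M' hM'] := prog_machine (Seq (copy _ 0 b.+2 b.+3) (Seq (sim_prog M) q)).
exists M' => n; have [t out] := hM n.
pose m : store (sim_aux M) := upd (fun=> [::]) b.+2 (unary _ n).
have m_empty i : i != b.+2 -> m i = [::] by move=> ib; rewrite /m upd_neq.
have run_copy : runs (copy _ 0 b.+2 b.+3) (init_store _ (nseq n true)) (8 * n).+2
    (upd m 0 (map inl (nseq n true))).
  rewrite /m updC //; apply: (@copy_runs _ (init_store _ (nseq n true))) => //.
    by rewrite /= !inE; lia.
  by rewrite /init_store map_nseq.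
have rep : represents m b [:: b.+2] b.+3 ([::], [:: n]).
  split=> [||//||/=|i bi]; rewrite ?m_empty ?ltnSn //; try lia.
  by rewrite /m /= upd_eq.
have [||m' [run_sim m'0 rep']] := sim_prog_runs out _ _ rep.
- by move=> i ib; rewrite m_empty //; lia.
- by rewrite /= ltnSn.
have := hq _ _ rep' m'0; rewrite /= size_nseq => run_q.
eexists; apply: (hM' _ _ _ _ (runs_seq run_copy (runs_seq run_sim run_q))) (leqnn _).
by rewrite upd_eq.
Qed.

Lemma param_cost_bound fk k c x :
  (fk * (size x).+1 ^ c + size (param_str x k)).+1 <=
  (fk + 2 * k + 2) * (size x).+1 ^ c.+1.
Proof.
rewrite size_pair_str size_nseq; set n := size x.
have exp_le : n.+1 ^ c <= n.+1 ^ c.+1 by apply: leq_pexp2l.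
have n_lt : n < n.+1 ^ c.+1 by rewrite expnS; apply: leq_pmulr; rewrite expn_gt0.
rewrite -addnA mulnDl; have := leq_mul (leqnn fk) exp_le; move: n_lt.
by move: (_ ^ c) (_ ^ c.+1) => u v; nia.
Qed.

Section ReductionComposition.
Variables (P P' Q : param_problem) (inst : seq bool -> seq bool).
Variables (param : seq bool -> nat) (h : nat -> nat).
Hypothesis P_reduces : fpt_reduces P P'.
Hypothesis inst_polytime :
  polytime_str (fun c => pair_str (nseq (param c.1) true) (inst c.1)).
Hypothesis inst_correct :
  forall x k, P' x k <-> Q (inst (param_str x k)) (param (param_str x k)).
Hypothesis param_str_param : forall x k, param (param_str x k) = h k.
Hypothesis h_mono : {homo h : m n / m <= n}.
Hypothesis h_polytime : polytime_nat (fun c => h (size c.1)).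

Lemma fpt_reduces_polytime : fpt_reduces P Q.
Proof.
case: P_reduces => M [R [f [g [c [cf cg hR]]]]]; set b := sim_base M.
have [q [e hq]] := @polytime_str_emit _ (sim_aux M) b [::] b.+2 inst_polytime isT isT.
have [M' hM'] := prog_machine (Seq (sim_prog M) q); set C := sim_cost M.
have [E hE] : poly_bounded (fun a => 2 * (C * a + ((C * a).+2) ^ e)).
  by poly_bounded_tac.
pose image x k := param_str (R x k).1 (R x k).2.
exists M', (fun x k => (inst (image x k), param (image x k))).
exists (fun k => (f k + 2 * k + 2) ^ E), (fun k => h (g k)), (c.+1 * E); split.
- apply: (computable_polytime_comp (h := fun n m => (m + 2 * n + 2) ^ E) cf).
  by polytime_tac.
- exact: (computable_polytime_comp (h := fun n m => h m) cg).
move=> x k; have [out PP' le_g] := hR x k; split; first last.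
- by rewrite /= param_str_param; apply: h_mono.
- by rewrite PP' inst_correct.
have rep : represents ((fun=> [::]) : store (sim_aux M)) b [::] b.+2 ([::], [::]) by [].
have [||m' [run_sim m'0 rep']] := sim_prog_runs out _ _ rep; rewrite // -/(image x k).
have run_q := hq _ _ rep' m'0.
apply: (hM' _ _ _ _ (runs_seq run_sim run_q)); first by rewrite upd_eq.
set a := (f k + 2 * k + 2) * (size x).+1 ^ c.+1.
set t := (_ + size (param_str x k)).+1 in run_sim *.
have t_le : t <= a := param_cost_bound _ _ _ _.
have image_size : size (image x k) <= C * t.
  case: run_sim => t' t'_le /exec_size /(_ b).
  by rewrite (represents_str rep') /= size_map => /leq_trans; apply.
have a_gt1 : 1 < a.
  by apply: leq_trans (leq_pmulr _ _); rewrite ?expn_gt0 //; lia.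
rewrite expnM -expnMn -/a; apply: leq_trans (hE _ a_gt1).
rewrite leq_mul2l /=; apply: leq_add; first by rewrite leq_mul2l t_le orbT.
apply: leq_expl; rewrite /ctx_size /= addn0 !ltnS.
by apply: leq_trans image_size _; rewrite leq_mul2l t_le orbT.
Qed.

End ReductionComposition.

(** * Identifications as quotients *)

Record quotient_map (G Q : sgraph) (f : vertex G -> vertex Q) : Prop := QuotientMap {
  quotient_surj : forall a, exists u, f u = a;
  quotient_edge : forall a b, edge a b <->
    a != b /\ exists u v, [/\ f u = a, f v = b & edge u v] }.

Lemma edge_neq (G : sgraph) (u v : vertex G) : edge u v -> u != v.
Proof. by apply: contraTneq => ->; rewrite edge_irr. Qed.

Lemma quotient_map_id (G : sgraph) : quotient_map (fun u : vertex G => u).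
Proof.
split=> [a|a b]; first by exists a.
split=> [ab|[_ [u [v [-> -> //]]]]]; split; first exact: edge_neq.
by exists a, b.
Qed.

Lemma quotient_map_comp (G1 G2 G3 : sgraph) (f : vertex G1 -> vertex G2)
    (g : vertex G2 -> vertex G3) :
  quotient_map f -> quotient_map g -> quotient_map (g \o f).
Proof.
move=> [f_surj f_edge] [g_surj g_edge]; split=> [a|a b].
  by have [b <-] := g_surj a; have [u <-] := f_surj b; exists u.
split.
  case/g_edge=> ab [u [v [ua vb /f_edge[_ [u' [v' [eu ev uv]]]]]]].
  by split=> //; exists u', v'; rewrite /= eu ev.
case=> ab [u [v [ua vb uv]]]; apply/g_edge; split=> //; exists (f u), (f v).
split=> //; apply/f_edge; split; last by exists u, v.
by apply: contraNneq ab => e; rewrite -ua -vb /= e.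
Qed.

Lemma leq_card_quotient (G Q : sgraph) (f : vertex G -> vertex Q) :
  quotient_map f -> #|vertex Q| <= #|vertex G|.
Proof.
case=> f_surj _; rewrite -[#|vertex Q|]/(#|predT|).
apply: leq_trans (leq_image_card f predT); apply/subset_leq_card/subsetP => a _.
by have [u <-] := f_surj a; apply: image_f.
Qed.

Section IdentifyQuotient.
Variables (G : sgraph) (u v : vertex G).
Hypothesis uv : u != v.

Definition ident_map (x : vertex G) : vertex (identify u v) := insub x.

Lemma ident_map_val (x : {x : vertex G | (x != u) && (x != v)}) :
  ident_map (val x) = Some x.
Proof. by rewrite /ident_map valK. Qed.

Lemma ident_map_Some x y : ident_map x = Some y -> x = val y.
Proof. by rewrite /ident_map; case: insubP => // z _ <- [->]. Qed.

Lemma ident_map_None x : ident_map x = None -> x = u \/ x = v.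
Proof.
rewrite /ident_map; case: insubP => // /nandP[]; rewrite negbK => /eqP; by auto.
Qed.

Lemma ident_map_quotient : quotient_map ident_map.
Proof.
have map_u : ident_map u = None by rewrite /ident_map insubF // eqxx.
have map_v : ident_map v = None by rewrite /ident_map insubF // eqxx andbF.
split=> [[x|]|a b]; [by exists (val x); apply: ident_map_val | by exists u |].
split=> [ab|[ab [x [y [xa yb xy]]]]].
  split; first exact: edge_neq.
  case: a b ab => [x|] [y|] //= xy.
  - by exists (val x), (val y); rewrite !ident_map_val.
  - by case/orP: xy => xy; [exists (val x), u | exists (val x), v];
      rewrite ident_map_val edge_sym.
  - by case/orP: xy => xy; [exists u, (val y) | exists v, (val y)];
      rewrite ident_map_val.
case: a b xa yb ab => [a|] [b|] //=.
- by move=> /ident_map_Some <- /ident_map_Some <-.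
- move=> /ident_map_Some <- /ident_map_None y_uv _; rewrite edge_sym.
  by case: y_uv xy => <-; rewrite edge_sym => ->; rewrite ?orbT.
- move=> /ident_map_None x_uv /ident_map_Some <- _.
  by case: x_uv xy => <- ->; rewrite ?orbT.
Qed.

Lemma card_identify : #|vertex G| = #|vertex (identify u v)|.+1.
Proof.
rewrite /= card_option card_sig.
have uv_compl : [predC [pred x | (x != u) && (x != v)]] =i pred2 u v.
  by move=> x; rewrite !inE negb_and !negbK.
by rewrite -(cardC [pred x | (x != u) && (x != v)]) (eq_card uv_compl) card2 uv addn2.
Qed.

Lemma quotient_map_factor (Q : sgraph) (f : vertex G -> vertex Q) :
  quotient_map f -> f u = f v ->
  exists g : vertex (identify u v) -> vertex Q, quotient_map g.
Proof.
move=> [f_surj f_edge] fuv.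
pose g (a : vertex (identify u v)) := if a is Some x then f (val x) else f u.
have g_map x : g (ident_map x) = f x.
  rewrite /g /ident_map; case: insubP => [y _ -> //|].
  by rewrite negb_and !negbK => /orP[] /eqP->.
have [_ map_edge] := ident_map_quotient; exists g; split=> [a|a b].
  by have [x <-] := f_surj a; exists (ident_map x).
split.
  case/f_edge=> ab [x [y [xa yb xy]]]; split=> //.
  exists (ident_map x), (ident_map y); rewrite !g_map; split=> //.
  apply/map_edge; split; last by exists x, y.
  by apply: contraNneq ab => e; rewrite -xa -yb -!g_map e.
case=> ab [x [y [xa yb /map_edge[_ [x' [y' [ex ey xy]]]]]]].
by apply/f_edge; split=> //; exists x', y'; rewrite -!g_map ex ey.
Qed.

End IdentifyQuotient.

Lemma identifications_quotient m (G G' : sgraph) : identifications m G G' ->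
  exists f : vertex G -> vertex G',
    quotient_map f /\ #|vertex G| = #|vertex G'| + m.
Proof.
elim=> [{}G|{}m {}G u v {}G' uv _ [f [hf card_f]]].
  by exists id; rewrite addn0; split=> //; apply: quotient_map_id.
exists (f \o @ident_map G u v); rewrite (card_identify uv) card_f addnS.
by split=> //; apply: quotient_map_comp (ident_map_quotient u v) hf.
Qed.

Lemma quotient_identifications (G Q : sgraph) (f : vertex G -> vertex Q) :
  quotient_map f -> exists m G' (g : vertex G' -> vertex Q),
    [/\ identifications m G G', quotient_map g, injective g
      & #|vertex G| = #|vertex Q| + m].
Proof.
move E : #|vertex G| => n; elim: n G E f => [|n IH] G E f hf.
  exists 0, G, f; split; [exact: Ident0 | by [] | | ].
    by move=> x; have := card0_eq E x.
  by have := leq_card_quotient hf; rewrite E leqn0 => /eqP->.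
case: (boolP (injectiveb f)) => [/injectiveP f_inj|/injectivePn[u [v uv fuv]]].
  exists 0, G, f; split=> //; first exact: Ident0.
  rewrite addn0 -E -(card_codom f_inj); apply: eq_card => a.
  by rewrite inE; have [u <-] := quotient_surj hf a; rewrite codom_f.
have [g hg] := quotient_map_factor hf fuv.
have [|m [G' [g' [idents hg' g'_inj card_n]]]] := IH (identify u v) _ g hg.
  by apply: succn_inj; rewrite -card_identify.
by exists m.+1, G', g'; split=> //; [apply: IdentS idents | rewrite card_n addnS].
Qed.

Definition star_center (G : sgraph) (z : vertex G) : Prop :=
  (forall x, x != z -> edge z x) /\ (forall x y, edge x y -> x = z \/ y = z).

(* For instance the distances from [r]. *)
Definition levels (G : sgraph) (r : vertex G) (l : vertex G -> nat) : Prop :=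
  forall x, x != r -> exists2 y, edge y x & l y < l x.

Definition forest_order_on (G : sgraph) (S : {set vertex G}) (rk : vertex G -> nat) :=
  {in S &, injective rk} /\
  {in S & &, forall u v w,
    edge u w -> edge v w -> rk u < rk w -> rk v < rk w -> u = v}.

Definition forest_order (G : sgraph) := @forest_order_on G [set: vertex G].

Lemma forest_orderP (G : sgraph) (rk : vertex G -> nat) :
  forest_order rk <-> injective rk /\
    forall u v w, edge u w -> edge v w -> rk u < rk w -> rk v < rk w -> u = v.
Proof.
split=> -[inj low]; split=> [u v|u v w]; last 2 first.
- by move=> _ _; apply: inj.
- by move=> _ _ _; apply: low.
- by apply: inj; rewrite inE.
- by apply: low; rewrite inE.
Qed.

Lemma levels_connected (G : sgraph) (r : vertex G) l : levels r l -> is_connected G.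
Proof.
move=> r_l; have root x : connect (@edge G) r x.
  move E : (l x) => n; elim/ltn_ind: n x E => n IH x E.
  case: (eqVneq x r) => [->|/r_l[y yx ly]]; first exact: connect0.
  by apply: connect_trans (connect1 yx); apply: IH erefl; rewrite -E.
split=> [|x y]; first by apply/card_gt0P; exists r.
by apply: connect_trans (root y); rewrite (sym_connect_sym (@edge_sym G)).
Qed.

Lemma connected_levels (G : sgraph) (r : vertex G) : is_connected G ->
  exists2 l, levels r l & forall x, l x < #|vertex G|.
Proof.
case=> _ conn; pose walk x n := [exists t : n.-tuple (vertex G),
  path (@edge G) r t && (last r t == x)].
have walkP x p : path (@edge G) r p -> last r p = x -> walk x (size p).
  by move=> rp px; apply/existsP; exists (in_tuple p); rewrite rp px eqxx.
have walk_ex x : exists n, walk x n.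
  by have /connectP[p rp px] := conn r x; exists (size p); apply: walkP.
exists (fun x => ex_minn (walk_ex x)).
  move=> x xr; case: (ex_minnP (walk_ex x)) => n /existsP[[p0 /= /eqP size_p]].
  case/lastP: p0 size_p => [|p y] size_p; first by rewrite /= eq_sym (negbTE xr).
  rewrite rcons_path last_rcons => /andP[/andP[rp py] /eqP yx] _.
  exists (last r p); first by rewrite -yx.
  case: ex_minnP => k _ k_min; have := k_min _ (walkP _ _ rp erefl).
  by move: size_p; rewrite size_rcons => <-.
move=> x; case: ex_minnP => n _ n_min; have /connectP[p rp px] := conn r x.
case: (shortenP rp) px => p' rp' uniq_p' _ p'x.
apply: leq_ltn_trans (n_min _ (walkP _ _ rp' (esym p'x))) _.
by have := max_card [in r :: p']; rewrite (card_uniqP uniq_p').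
Qed.

(* The vertex of highest rank on a cycle would have two lower neighbors. *)
Lemma forest_order_is_forest (G : sgraph) (rk : vertex G -> nat) :
  forest_order rk -> is_forest G.
Proof.
case/forest_orderP=> rk_inj low s size_s /andP[cycle_s uniq_s].
have [x0 x0s] : exists x, x \in s.
  by case: s size_s {cycle_s uniq_s} => // x s _; exists x; rewrite mem_head.
case: (@arg_maxnP _ x0 [in s] rk x0s) => w ws w_max.
have [i p e] := rot_to ws.
have : cycle (@edge G) (w :: p) && uniq (w :: p).
  by rewrite -e rot_cycle rot_uniq cycle_s uniq_s.
have size_p : size p > 1.
  by rewrite -ltnS -[(size p).+1]/(size (w :: p)) -e size_rot.
have in_s x : x \in p -> x \in s.
  by move=> xp; rewrite -(mem_rot i) e inE xp orbT.
case/lastP: p size_p in_s {e} => [//|p y]; case: p => [//|x p] _ in_s.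
rewrite /= !rcons_path last_rcons inE negb_or !mem_rcons !inE !negb_or.
case/andP=> /and3P[wx _ yw] /andP[_ /andP[/andP[xy _] _]].
have lower z : edge z w -> z \in s -> rk z < rk w.
  move=> zw zs; rewrite ltn_neqAle (w_max z zs : rk z <= rk w) andbT.
  by apply: contraTneq zw => /rk_inj ->; rewrite edge_irr.
have xw : edge x w by rewrite edge_sym.
have xs : x \in s by apply: in_s; rewrite /= mem_head.
have ys : y \in s by apply: in_s; rewrite mem_rcons mem_head.
by rewrite (low x y w xw yw (lower x xw xs) (lower y yw ys)) eqxx in xy.
Qed.

(* Otherwise walking backwards within [S] without turning never stops, and
   cannot revisit a vertex. *)
Lemma forest_leaf (G : sgraph) (S : {set vertex G}) : is_forest G -> S != set0 ->
  exists2 x, x \in S & {in S &, forall u v, edge u x -> edge v x -> u = v}.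
Proof.
move=> forest_G /set0Pn[x0 x0S].
case: (boolP [exists x in S, [forall u in S, forall v in S,
    edge u x ==> edge v x ==> (u == v)]]) => [/exists_inP[x xS /forall_inP leaf]|].
  exists x => // u v uS vS ux vx; apply/eqP.
  by have /forall_inP/(_ v vS) := leaf u uS; rewrite ux vx.
move=> /exists_inPn no_leaf.
have extend x y : x \in S -> exists z, [/\ z \in S, edge z x & z != y].
  move=> xS; have := no_leaf x xS; rewrite negb_forall_in => /exists_inP[u uS].
  rewrite negb_forall_in => /exists_inP[v vS]; rewrite !negb_imply => /and3P[ux vx uv].
  case: (eqVneq u y) => [uy|]; last by exists u.
  by exists v; split=> //; rewrite eq_sym -uy.
have long n : exists x p,
    [/\ x \in S, path (@edge G) x p, uniq (x :: p) & size p = n].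
  elim: n => [|n [x [p [xS xp uniq_p size_p]]]]; first by exists x0, [::].
  have [y [yS yx y_head]] := extend x (head x p) xS.
  case: (boolP (y \in x :: p)) => [yp|yp]; last first.
    by exists y, (x :: p); rewrite /= yx xp size_p; split=> //; apply/andP.
  have {}yp : y \in p by move: yp; rewrite inE (negbTE (edge_neq yx)).
  case/splitPr: yp xp uniq_p y_head => p1 p2 xp uniq_p y_head.
  have : ucycle (@edge G) (x :: rcons p1 y).
    rewrite /ucycle /= rcons_path last_rcons yx andbT.
    move: xp; rewrite -cat_rcons cat_path => /andP[-> _] /=.
    by move: uniq_p; rewrite -cat_rcons -cat_cons cat_uniq => /andP[].
  move/forest_G; case=> //; rewrite /= size_rcons !ltnS.
  by case: p1 y_head {xp uniq_p} => //=; rewrite eqxx.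
have [x [p [_ _ uniq_p size_p]]] := long #|vertex G|.
by have := max_card [in x :: p]; rewrite (card_uniqP uniq_p) /= size_p ltnn.
Qed.

Lemma forest_order_add_leaf (G : sgraph) (S : {set vertex G}) x rk n : x \in S ->
  {in S &, forall u v, edge u x -> edge v x -> u = v} ->
  forest_order_on (S :\ x) rk -> {in S :\ x, forall y, rk y < n} ->
  forest_order_on S (fun y => if y == x then n else rk y).
Proof.
move=> xS leaf [rk_inj low] rk_lt.
have in_D y : y \in S -> y != x -> y \in S :\ x.
  by move=> *; rewrite !inE; apply/andP.
split.
  move=> u v uS vS; case: eqVneq => [->|ux]; case: eqVneq => [->|vx] //.
  - by move=> e; have := rk_lt v (in_D _ vS vx); rewrite -e ltnn.
  - by move=> e; have := rk_lt u (in_D _ uS ux); rewrite e ltnn.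
  - by apply: rk_inj; apply: in_D.
move=> u v w uS vS wS uw vw; case: (eqVneq w x) => [wx _ _|wx].
  by apply: leaf; rewrite -?wx.
have w_lt := rk_lt w (in_D _ wS wx).
case: eqVneq => [_|ux]; first by rewrite ltnNge (ltnW w_lt).
case: eqVneq => [_ _|vx]; first by rewrite ltnNge (ltnW w_lt).
by apply: (low u v w); rewrite ?in_D.
Qed.

Lemma forest_order_exists (G : sgraph) : is_forest G ->
  exists2 rk : vertex G -> nat, forest_order rk & forall x, rk x < #|vertex G|.
Proof.
move=> forest_G.
have order_on (S : {set vertex G}) :
    exists2 rk, forest_order_on S rk & {in S, forall y, rk y < #|S|}.
  move E : #|S| => n; elim: n S E => [|n IH] S E.
    by exists (fun=> 0); [split=> [u v|u v w]|move=> u]; rewrite (cards0_eq E) inE.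
  have [|x xS leaf] := forest_leaf (S := S) forest_G; first by rewrite -card_gt0 E.
  have card_D : #|S :\ x| = n by move: E; rewrite (cardsD1 x) xS => -[].
  have [rk order rk_lt] := IH _ card_D.
  exists (fun y => if y == x then n else rk y).
    exact: forest_order_add_leaf xS leaf order rk_lt.
  move=> y yS; case: eqVneq => [//|yx]; rewrite ltnS ltnW // rk_lt //.
  by rewrite !inE yx.
have [rk order rk_lt] := order_on [set: vertex G]; exists rk => // x.
by rewrite -cardsT; apply: rk_lt; rewrite inE.
Qed.

Lemma star_center_is_star (G : sgraph) (z : vertex G) : star_center z -> is_star G.
Proof.
case=> z_adj z_edge; split.
  split.
    apply: (@levels_connected G z (fun x => x != z)) => x xz.
    by exists z; rewrite ?z_adj // eqxx xz.
  apply: (@forest_order_is_forest G (fun x => if x == z then 0 else (enum_rank x).+1)).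
  apply/forest_orderP; split=> [u v|u v w uw vw].
    by case: eqVneq => [->|_]; case: eqVneq => [->|_] // [] /ord_inj/enum_rank_inj.
  case: (z_edge _ _ uw) => [->|->]; last by rewrite eqxx.
  by case: (z_edge _ _ vw) => [->|->] //; rewrite eqxx.
rewrite -(cards1 z); apply/subset_leq_card/subsetP => x; rewrite !inE.
rewrite /degree; apply: contraLR => xz; rewrite -leqNgt.
apply/subset_leq_card/subsetP => y; rewrite !inE => /z_edge[] e; last by rewrite e.
by rewrite e eqxx in xz.
Qed.

Lemma is_star_center (G : sgraph) : is_star G -> exists z : vertex G, star_center z.
Proof.
case=> [[[G_gt0 conn] _] high].
have [z z_high] : exists z, forall x : vertex G, x != z -> degree x <= 1.
  case: (set_0Vmem [set x : vertex G | 1 < degree x]) => [high0|[z zin]].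
    have [z _] := card_gt0P G_gt0; exists z => x _; rewrite leqNgt.
    by apply/negP => x_high; have := in_set0 x; rewrite -high0 inE x_high.
  exists z => x xz; rewrite leqNgt; apply: contra xz => x_high; apply/eqP.
  by move/card_le1_eqP: high; apply; rewrite // inE.
have only_neighbor x y w : x != z -> edge x y -> edge x w -> y = w.
  by move=> xz xy xw; have /card_le1_eqP := z_high x xz; apply; rewrite inE.
have z_adj x : x != z -> edge z x.
  move=> xz; have /connectP[p] := conn z x.
  elim/last_ind: p x xz => [|p y IH] x xz; first by move=> _ e; rewrite e eqxx in xz.
  rewrite rcons_path last_rcons => /andP[zp py] xy; rewrite -xy in py *.
  case: (eqVneq (last z p) z) => [e|lz]; first by rewrite e in py.
  have zl := IH _ lz zp erefl.
  by have := only_neighbor _ x z lz py; rewrite edge_sym => /(_ zl) e;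
    rewrite e eqxx in xz.
exists z; split=> // x y xy; case: (eqVneq x z) => [|xz]; [by left | right].
by apply: (only_neighbor x) => //; rewrite edge_sym; apply: z_adj.
Qed.

Section InjectiveQuotient.
Variables (G Q : sgraph) (f : vertex G -> vertex Q).
Hypotheses (hf : quotient_map f) (f_inj : injective f).

Lemma quotient_inj_edge u v : edge (f u) (f v) = edge u v.
Proof.
apply/idP/idP => [/(quotient_edge hf)[_ [u' [v' [/f_inj -> /f_inj -> //]]]]|uv].
by apply/(quotient_edge hf); rewrite (inj_eq f_inj) edge_neq //; split=> //; exists u, v.
Qed.

Lemma quotient_inj_forest : is_forest Q -> is_forest G.
Proof.
move=> forest_Q s size_s /andP[cycle_s uniq_s].
apply: (forest_Q (map f s)); rewrite ?size_map //.
by rewrite /ucycle map_inj_uniq // uniq_s (mono_cycle quotient_inj_edge) cycle_s.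
Qed.

Lemma quotient_inj_connected : is_connected Q -> is_connected G.
Proof.
move=> conn; have [/card_gt0P[a _] _] := conn; have [l a_l _] := connected_levels a conn.
have [r ra] := quotient_surj hf a.
apply: (@levels_connected G r (fun x => l (f x))) => x xr.
have [|b bx lb] := a_l (f x); first by rewrite -ra (inj_eq f_inj).
have [y yb] := quotient_surj hf b; exists y; rewrite ?yb //.
by rewrite -quotient_inj_edge yb.
Qed.

Lemma quotient_inj_star : is_star Q -> is_star G.
Proof.
case/is_star_center=> a [a_adj a_edge]; have [z za] := quotient_surj hf a.
apply: (@star_center_is_star G z); split=> [x xz|x y].
  by rewrite -quotient_inj_edge za a_adj // -za (inj_eq f_inj).
by rewrite -quotient_inj_edge => /a_edge; rewrite -za => -[/f_inj->|/f_inj->];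
  [left | right].
Qed.

End InjectiveQuotient.

Definition sparse_class (H : sgraph -> Prop) :=
  H = is_star \/ H = is_tree \/ H = is_forest.

Lemma sparse_class_star H (G : sgraph) : sparse_class H -> is_star G -> H G.
Proof. by move=> [->|[->|->]] // [[]]. Qed.

Lemma sparse_class_forest H (G : sgraph) : sparse_class H -> H G -> is_forest G.
Proof. by move=> [->|[->|->]] // => [[[]]|[]]. Qed.

Lemma sparse_class_iso H (G Q : sgraph) (f : vertex G -> vertex Q) :
  sparse_class H -> quotient_map f -> injective f -> H Q -> H G.
Proof.
move=> [->|[->|->]] hf f_inj; first exact: (quotient_inj_star hf f_inj).
  case=> conn forest; split; first exact: (quotient_inj_connected hf f_inj conn).
  exact: (quotient_inj_forest hf f_inj forest).
exact: (quotient_inj_forest hf f_inj).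
Qed.

Lemma identifiableP H (G : sgraph) k : sparse_class H ->
  identifiable H G k <-> exists (Q : sgraph) (f : vertex G -> vertex Q),
    [/\ quotient_map f, H Q & #|vertex G| <= #|vertex Q| + k].
Proof.
move=> sparse_H; split=> [[m [G' [mk idents HG']]]|[Q [f [hf HQ card_le]]]].
  have [f [hf card_G]] := identifications_quotient idents; exists G', f.
  by split=> //; rewrite card_G leq_add2l.
have [m [G' [g [idents hg g_inj card_G]]]] := quotient_identifications hf.
exists m, G'; split=> //; first by rewrite card_G leq_add2l in card_le.
exact: (sparse_class_iso sparse_H hg g_inj HQ).
Qed.

(** * Membership in NP *)

Lemma all_iotaP (P : pred nat) n :
  reflect (forall i, i < n -> P i) (all P (iota 0 n)).
Proof.
by apply: (iffP allP) => all_P i; [move=> i_n; apply: all_P | move=> i_n; apply: all_P];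
   move: i_n; rewrite mem_iota.
Qed.

Lemma has_iotaP (P : pred nat) n :
  reflect (exists2 i, i < n & P i) (has P (iota 0 n)).
Proof.
by apply: (iffP hasP) => -[i i_n Pi]; exists i => //; move: i_n; rewrite mem_iota.
Qed.

Lemma all_enum_ordP m (P : pred 'I_m) : reflect (forall i, P i) (all P (enum 'I_m)).
Proof.
apply: (iffP allP) => all_P i; last by move=> _; apply: all_P.
by apply: all_P; rewrite mem_enum.
Qed.

Lemma has_enum_ordP m (P : pred 'I_m) : reflect (exists i, P i) (has P (enum 'I_m)).
Proof. by apply: (iffP hasP) => [[i _ Pi]|[i Pi]]; exists i; rewrite ?mem_enum. Qed.

Lemma card_count_iota n (P : pred nat) : #|[pred a : 'I_n | P a]| = count P (iota 0 n).
Proof.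
rewrite -val_enum_ord count_map cardE -size_filter /enum_mem.
by congr (size _); rewrite -filter_predI; apply: eq_filter => a; rewrite /= !inE andbT.
Qed.

Variant sparse_kind := Star | Tree | Forest.

Definition kind_class (k : sparse_kind) : sgraph -> Prop :=
  match k with Star => is_star | Tree => is_tree | Forest => is_forest end.

Lemma kind_class_sparse k : sparse_class (kind_class k).
Proof. by rewrite /sparse_class; case: k; auto. Qed.

Lemma sparse_class_kind H : sparse_class H -> exists k, H = kind_class k.
Proof. by case=> [->|[->|->]]; [exists Star | exists Tree | exists Forest]. Qed.

(* The color of a vertex is the number of its part. *)
Section ColoringCheck.
Variables (n : nat) (adj : rel nat).

Definition forest_check (c : nat -> nat) : bool :=
  all (fun u => all (fun v => all (fun w => all (fun w' =>
    [&& adj u w, adj v w', c w == c w', c u < c w & c v < c w] ==> (c u == c v))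
  (iota 0 n)) (iota 0 n)) (iota 0 n)) (iota 0 n).

Definition connected_check (c l : nat -> nat) : bool :=
  has (fun r => all (fun w => (c w == c r) ||
    has (fun u => has (fun v => [&& c v == c w, adj u v & l (c u) < l (c w)])
      (iota 0 n)) (iota 0 n)) (iota 0 n)) (iota 0 n).

Definition star_check (c : nat -> nat) : bool :=
  has (fun z => all (fun u =>
    ((c u == c z) ||
      has (fun v => has (fun v' => [&& c v == c z, c v' == c u & adj v v'])
        (iota 0 n)) (iota 0 n)) &&
    all (fun v => adj u v ==> [|| c u == c v, c u == c z | c v == c z]) (iota 0 n))
  (iota 0 n)) (iota 0 n).

Definition class_check (k : sparse_kind) (c l : nat -> nat) : bool :=
  match k with
  | Star => star_check c
  | Tree => connected_check c l && forest_check c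
  | Forest => forest_check c
  end.

Definition num_colors (c : nat -> nat) : nat :=
  count (fun a => has (fun u => c u == a) (iota 0 n)) (iota 0 n).

Variables (es : symmetric (fun i j : 'I_n => adj i j))
          (ei : irreflexive (fun i j : 'I_n => adj i j)).
Let G := SGraph es ei.

Section ColoredQuotient.
Variables (Q : sgraph) (f : vertex G -> vertex Q) (rk : vertex Q -> nat).
Variable c : nat -> nat.
Hypotheses (hf : quotient_map f) (rk_inj : injective rk).
Hypothesis c_rk : forall u : 'I_n, c u = rk (f u).

Lemma color_lift u : u < n -> exists a, c u = rk a.
Proof. by move=> un; exists (f (Ordinal un)); rewrite -c_rk. Qed.

Lemma color_surj a : exists2 u, u < n & c u = rk a.
Proof. by have [u <-] := quotient_surj hf a; exists u; rewrite ?c_rk ?ltn_ord. Qed.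

Lemma color_edgeP a b : edge a b <-> a != b /\
  exists u v, [/\ u < n, v < n, c u = rk a, c v = rk b & adj u v].
Proof.
split=> [/(quotient_edge hf)[ab [u [v [ua vb uv]]]]|[ab [u [v [un vn]]]]].
  by split=> //; exists u, v; rewrite !c_rk ua vb !ltn_ord.
rewrite (c_rk (Ordinal un)) (c_rk (Ordinal vn)) => /rk_inj ua /rk_inj vb uv.
by apply/(quotient_edge hf); split=> //; exists (Ordinal un), (Ordinal vn).
Qed.

Lemma color_edge u v a b : u < n -> v < n -> c u = rk a -> c v = rk b ->
  a != b -> adj u v -> edge a b.
Proof. by move=> un vn ua vb ab uv; apply/color_edgeP; split=> //; exists u, v. Qed.

Lemma forest_checkP : forest_check c <-> forest_order rk.
Proof.
split=> [/all_iotaP check|/forest_orderP[_ low]].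
  apply/forest_orderP; split=> // a b d /color_edgeP[_ [u [w [un wn ua wd uw]]]].
  move=> /color_edgeP[_ [v [w' [vn wn' vb wd' vw]]]] ad bd; apply/rk_inj/eqP.
  have /all_iotaP/(_ v vn)/all_iotaP/(_ w wn)/all_iotaP/(_ w' wn') := check u un.
  by rewrite uw vw wd wd' ua vb ad bd eqxx.
apply/all_iotaP => u un; apply/all_iotaP => v vn; apply/all_iotaP => w wn.
apply/all_iotaP => w' wn'; apply/implyP => /and5P[uw vw /eqP ww' uw_lt vw_lt].
have [[a ua] [b vb]] := (color_lift un, color_lift vn); have [d wd] := color_lift wn.
have w'd : c w' = rk d by rewrite -ww'.
rewrite ua vb wd in uw_lt vw_lt *; apply/eqP; congr rk; apply: (low a b d) => //.
  by apply: (color_edge un wn) uw => //; apply: contraTneq uw_lt => ->; rewrite ltnn.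
by apply: (color_edge vn wn') vw => //; apply: contraTneq vw_lt => ->; rewrite ltnn.
Qed.

Lemma connected_checkP l :
  connected_check c l <-> exists r, levels r (fun a => l (rk a)).
Proof.
split=> [/has_iotaP[r rn /all_iotaP check]|[r r_l]].
  have [a ra] := color_lift rn; exists a => b ba; have [w wn wb] := color_surj b.
  have := check w wn; rewrite wb ra (inj_eq rk_inj) (negbTE ba) /=.
  case/has_iotaP=> u un /has_iotaP[v vn /and3P[/eqP vb uv lu]].
  have [d ud] := color_lift un; rewrite ud in lu; exists d => //.
  by apply: (color_edge un vn) uv => //; apply: contraTneq lu => ->; rewrite ltnn.
have [r0 rn r0r] := color_surj r; apply/has_iotaP; exists r0 => //.
apply/all_iotaP => w wn; have [b wb] := color_lift wn.
rewrite wb r0r (inj_eq rk_inj); case: eqVneq => //= /r_l[a /color_edgeP].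
move=> [_ [u [v [un vn ua vb uv]]]] la.
apply/has_iotaP; exists u => //; apply/has_iotaP; exists v => //.
by rewrite vb ua la uv eqxx.
Qed.

Lemma star_checkP : star_check c <-> exists z : vertex Q, star_center z.
Proof.
split=> [/has_iotaP[z zn /all_iotaP check]|[z [z_adj z_edge]]].
  have [z' zz'] := color_lift zn; exists z'; split=> [a az|a b].
    have [u un ua] := color_surj a; have /andP[+ _] := check u un.
    rewrite ua zz' (inj_eq rk_inj) (negbTE az) /=.
    case/has_iotaP=> v vn /has_iotaP[v' vn' /and3P[/eqP vz /eqP v'a vv']].
    by apply: (color_edge vn vn') vv' => //; rewrite eq_sym.
  case/color_edgeP=> ab [u [v [un vn ua vb uv]]].
  have /andP[_ /all_iotaP/(_ v vn)] := check u un.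
  rewrite uv ua vb zz' !(inj_eq rk_inj) (negbTE ab) /=.
  by case/orP=> /eqP; auto.
have [z0 zn z0z] := color_surj z; apply/has_iotaP; exists z0 => //.
apply/all_iotaP => u un; have [a ua] := color_lift un; rewrite ua z0z.
rewrite (inj_eq rk_inj); apply/andP; split.
  case: eqVneq => //= /z_adj/color_edgeP[_ [v [v' [vn vn' vz v'a vv']]]].
  apply/has_iotaP; exists v => //; apply/has_iotaP; exists v' => //.
  by rewrite vz v'a vv' !eqxx.
apply/all_iotaP => v vn; apply/implyP => uv; have [b vb] := color_lift vn.
rewrite vb !(inj_eq rk_inj); case: eqVneq => //= ab.
by have [->|->] := z_edge _ _ (color_edge un vn ua vb ab uv); rewrite eqxx ?orbT.
Qed.

Lemma class_check_sound k l : class_check k c l -> kind_class k Q.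
Proof.
case: k => /= [/star_checkP[z]|/andP[/connected_checkP[r r_l] /forest_checkP order]|].
- exact: star_center_is_star.
- by split; [apply: levels_connected r_l | apply: forest_order_is_forest order].
- by move/forest_checkP; apply: forest_order_is_forest.
Qed.

Lemma num_colors_card : (forall a, rk a < n) -> num_colors c = #|vertex Q|.
Proof.
move=> rk_lt; rewrite /num_colors -size_filter cardE -(size_map rk).
apply/perm_size/uniq_perm.
- exact/filter_uniq/iota_uniq.
- by rewrite map_inj_uniq // enum_uniq.
move=> i; rewrite mem_filter mem_iota /= add0n; apply/andP/mapP.
  case=> /has_iotaP[u un /eqP <-] _; have [a ua] := color_lift un.
  by exists a; rewrite ?mem_enum.
case=> a _ ->; split=> //; have [u un ua] := color_surj a.
by apply/has_iotaP; exists u; rewrite ?ua.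
Qed.

End ColoredQuotient.

Lemma class_check_complete k (Q : sgraph) (f : vertex G -> vertex Q) :
  quotient_map f -> kind_class k Q -> exists rk lv : vertex Q -> nat,
  [/\ injective rk, forall a, rk a < #|vertex Q|, forall a, lv a < #|vertex Q|
    & forall c l : nat -> nat,
        (forall u : 'I_n, c u = rk (f u)) -> (forall a, l (rk a) = lv a) ->
      class_check k c l].
Proof.
move=> hf kQ.
have forest_Q := sparse_class_forest (kind_class_sparse k) kQ.
have [rk order rk_lt] := forest_order_exists forest_Q.
have /forest_orderP[rk_inj _] := order.
case: k kQ => /= [star|[conn forest]|forest].
- exists rk, rk; split=> // c l c_rk _.
  exact/(star_checkP hf rk_inj c_rk)/is_star_center.
- have [/card_gt0P[r _] _] := conn; have [lv r_lv lv_lt] := connected_levels r conn.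
  exists rk, lv; split=> // c l c_rk l_lv; apply/andP; split.
    apply/(connected_checkP hf rk_inj c_rk); exists r => a /r_lv[b ba lt_ba].
    by exists b; rewrite ?l_lv.
  exact/(forest_checkP hf rk_inj c_rk).
- by exists rk, rk; split=> // c l c_rk _; apply/(forest_checkP hf rk_inj c_rk).
Qed.

Section ColorGraph.
Variable c : nat -> nat.
Hypothesis c_lt : forall u, u < n -> c u < n.

Definition color_vertex : finType :=
  {a : 'I_n | has (fun u => c u == a) (iota 0 n)}.

Definition color_rel : rel color_vertex := fun a b =>
  (a != b) && [exists u : 'I_n, exists v : 'I_n,
    [&& c u == val (val a), c v == val (val b) & adj u v]].

Lemma color_rel_sym : symmetric color_rel.
Proof.
move=> a b; rewrite /color_rel eq_sym; congr andb.
by apply/existsP/existsP => -[u /existsP[v /and3P[ua vb uv]]];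
  exists v; apply/existsP; exists u; rewrite ua vb es uv.
Qed.

Lemma color_rel_irr : irreflexive color_rel.
Proof. by move=> a; rewrite /color_rel eqxx. Qed.

Definition color_graph := SGraph color_rel_sym color_rel_irr.

Definition color_rank (a : vertex color_graph) : nat := val (val a).

Lemma color_rank_inj : injective color_rank.
Proof. by move=> a b /val_inj/val_inj. Qed.

Lemma color_map_subproof (u : 'I_n) :
  has (fun v => c v == Ordinal (c_lt (ltn_ord u))) (iota 0 n).
Proof. by apply/has_iotaP; exists u. Qed.

Definition color_map (u : vertex G) : vertex color_graph :=
  exist _ (Ordinal (c_lt (ltn_ord u))) (color_map_subproof u).

Lemma color_map_eq (u : vertex G) a : (color_map u == a) = (c u == color_rank a).
Proof. by rewrite -!val_eqE. Qed.

Lemma color_map_quotient : quotient_map color_map.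
Proof.
split=> [a|a b].
  have /has_iotaP[u un ua] := valP a.
  by exists (Ordinal un); apply/eqP; rewrite color_map_eq.
split=> [/andP[ab /existsP[u /existsP[v /and3P[ua vb uv]]]]|[ab [u [v [ua vb uv]]]]].
  by split=> //; exists u, v; split=> //; apply/eqP; rewrite color_map_eq.
apply/andP; split=> //; apply/existsP; exists u; apply/existsP; exists v.
by rewrite -![val (val _)]/(color_rank _) -!color_map_eq ua vb !eqxx.
Qed.

End ColorGraph.

Lemma class_check_identifiable k c l b : (forall u, u < n -> c u < n) ->
  class_check k c l -> n <= num_colors c + b -> identifiable (kind_class k) G b.
Proof.
move=> c_lt check n_le; have rk_inj := @color_rank_inj c.
have quo := color_map_quotient c_lt.
apply/(identifiableP _ _ (kind_class_sparse k)); exists (color_graph c), (color_map c_lt).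
split=> //; first exact: (class_check_sound quo rk_inj (fun=> erefl) check).
by rewrite -(num_colors_card quo rk_inj (fun=> erefl)) ?card_ord // => a; apply: ltn_ord.
Qed.

End ColoringCheck.

Lemma pair_str_inj x y x' y' : pair_str x y = pair_str x' y' -> x = x' /\ y = y'.
Proof.
elim: x x' => [|b x IH] [|b' x'] //= [] => [-> //|-> /IH[-> ->] //].
Qed.

Lemma nth_flatten_rows n (rows : seq (seq bool)) i j :
  all (fun r => size r == n) rows -> j < n ->
  nth false (flatten rows) (i * n + j) = nth false (nth [::] rows i) j.
Proof.
elim: rows i => [|r rows IH] i /=; first by rewrite !nth_nil.
case/andP=> /eqP size_r rows_n jn; rewrite nth_cat size_r.
case: i => [|i]; first by rewrite mul0n add0n jn.
by rewrite mulSn -addnA ltnNge leq_addr /= addKn IH.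
Qed.

Definition seq_adj (A : seq bool) n : rel 'I_n := fun i j => nth false A (i * n + j).
Arguments seq_adj A n i j : clear implicits.

Lemma size_adj n (e : rel 'I_n) :
  size [seq e i j | i <- enum 'I_n, j <- enum 'I_n] = n * n.
Proof. by rewrite size_allpairs -cardE card_ord. Qed.

Lemma seq_adj_matrix n (e : rel 'I_n) (i j : 'I_n) :
  seq_adj [seq e i j | i <- enum 'I_n, j <- enum 'I_n] n i j = e i j.
Proof.
rewrite /seq_adj nth_flatten_rows ?ltn_ord //; last first.
  by apply/allP => r /mapP[k _ ->]; rewrite size_map -cardE card_ord.
have size_n := size_enum_ord n.
rewrite (nth_map i) ?size_n ?ltn_ord // (nth_map i) ?size_n ?ltn_ord //.
by rewrite !nth_ord_enum.
Qed.

Lemma matrix_seq_adj n (A : seq bool) : size A = n * n ->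
  [seq seq_adj A n i j | i <- enum 'I_n, j <- enum 'I_n] = A.
Proof.
move=> size_A; apply: (@eq_from_nth _ false).
  by rewrite (size_adj (seq_adj A n)) size_A.
move=> t; rewrite (size_adj (seq_adj A n)) => t_lt; have n0 : 0 < n by case: (n) t_lt.
have i_lt : t %/ n < n by rewrite ltn_divLR.
have j_lt : t %% n < n by rewrite ltn_mod.
rewrite {1}(divn_eq t n).
have := seq_adj_matrix (seq_adj A n) (Ordinal i_lt) (Ordinal j_lt).
by rewrite {1}/seq_adj /= => ->; rewrite /seq_adj /= -divn_eq.
Qed.

Lemma encodesP x n (e : rel 'I_n) k : encodes x e k <-> exists A s,
  [/\ binval s = k, x = pair_str (nseq n true) (pair_str A s), size A = n * n
    & e = seq_adj A n].
Proof.
split=> [[s [<- ->]]|[A [s [<- -> size_A ->]]]]; last by exists s; rewrite matrix_seq_adj.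
exists [seq e i j | i <- enum 'I_n, j <- enum 'I_n], s; split=> //; first exact: size_adj.
apply: functional_extensionality => i; apply: functional_extensionality => j.
by rewrite seq_adj_matrix.
Qed.

Definition pair_cut (z : seq bool) : nat :=
  find (fun i => ~~ nth false z i.*2) (iota 0 (size z)).
Definition is_pair (z : seq bool) : bool := (pair_cut z).*2 < size z.
Definition pair_fst (z : seq bool) : seq bool :=
  mkseq (fun i => nth false z i.*2.+1) (pair_cut z).
Definition pair_snd (z : seq bool) : seq bool := drop (pair_cut z).*2.+1 z.

Lemma pair_strK x y :
  [/\ is_pair (pair_str x y), pair_fst (pair_str x y) = x
    & pair_snd (pair_str x y) = y].
Proof.
have cut : pair_cut (pair_str x y) = size x.
  apply: find_iota; rewrite ?size_pair_str ?nth_pair_str ?ltnn ?eqxx //; first lia.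
  by move=> i ix; rewrite nth_pair_str ltn_double ix odd_double.
split; rewrite /is_pair /pair_fst /pair_snd cut.
- by rewrite size_pair_str; lia.
- apply: (@eq_from_nth _ false); rewrite size_mkseq // => i ix.
  rewrite nth_mkseq // nth_pair_str (_ : i.*2.+1 < _); last lia.
  by rewrite /= odd_double /= uphalf_double.
- by elim: x {cut} => [|b x IH] /=; rewrite ?drop0 ?doubleS.
Qed.

Lemma is_pairK z : is_pair z -> pair_str (pair_fst z) (pair_snd z) = z.
Proof.
rewrite /is_pair => cut_lt.
have size_fst : size (pair_fst z) = pair_cut z by rewrite size_mkseq.
have before_cut i : i < pair_cut z -> nth false z i.*2.
  move=> i_lt; have := before_find 0 i_lt.
  rewrite nth_iota; first by move/negbT; rewrite negbK.
  by apply: leq_trans i_lt _; rewrite /pair_cut (leq_trans (find_size _ _)) ?size_iota.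
have at_cut : nth false z (pair_cut z).*2 = false.
  have has_cut : has (fun i => ~~ nth false z i.*2) (iota 0 (size z)).
    by rewrite has_find size_iota -/(pair_cut z); lia.
  have := nth_find 0 has_cut; rewrite -/(pair_cut z) nth_iota; last by lia.
  by move/negbTE.
symmetry; apply: (@eq_from_nth _ false).
  by rewrite size_pair_str size_fst size_drop; lia.
move=> i iz; rewrite nth_pair_str size_fst; case: ltnP => i_cut.
  have half_lt : i./2 < pair_cut z by lia.
  rewrite nth_mkseq //; case: (boolP (odd i)) => odd_i /=.
    by congr nth; lia.
  by rewrite -(before_cut _ half_lt); congr nth; lia.
by case: eqP => [-> //|ne]; rewrite nth_drop; congr nth; lia.
Qed.

Definition inst_order x := size (pair_fst x).
Definition inst_matrix x := pair_fst (pair_snd x).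
Definition inst_budget_bits x := pair_snd (pair_snd x).
Definition inst_adj x : rel nat :=
  fun u v => nth false (inst_matrix x) (u * inst_order x + v).

(* The budget may be exponentially large; it is cut off at the order. *)
Definition inst_budget x := iteri (size (inst_budget_bits x)) (fun i acc =>
  minn (inst_order x) (nth false (inst_budget_bits x)
    (size (inst_budget_bits x) - i.+1) + acc.*2)) 0.

Definition inst_valid x := [&& is_pair x,
  all (nth false (pair_fst x)) (iota 0 (inst_order x)), is_pair (pair_snd x),
  size (inst_matrix x) == inst_order x * inst_order x &
  all (fun i => ~~ inst_adj x i i &&
    all (fun j => inst_adj x i j == inst_adj x j i) (iota 0 (inst_order x)))
  (iota 0 (inst_order x))].

Lemma inst_budgetE x : inst_budget x = minn (inst_order x) (binval (inst_budget_bits x)).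
Proof.
rewrite /inst_budget; set n := inst_order x; move: (inst_budget_bits x) => s.
have suffix i : i <= size s -> iteri i (fun i acc =>
    minn n (nth false s (size s - i.+1) + acc.*2)) 0 =
    minn n (binval (drop (size s - i) s)).
  elim: i => [|i IH] i_s; first by rewrite subn0 drop_size minn0.
  rewrite iteriS IH ?(ltnW i_s) // (@drop_nth _ false (size s - i.+1)); last lia.
  rewrite /= -subSn // subSS.
  by case: (nth _ _ _) => /=; move: (binval _) => v; lia.
by rewrite suffix // subnn drop0.
Qed.

Lemma inst_valid_pair n A s (x := pair_str (nseq n true) (pair_str A s)) :
  size A = n * n -> symmetric (seq_adj A n) -> irreflexive (seq_adj A n) ->
  [/\ inst_valid x, inst_order x = n, inst_matrix x = A & inst_budget_bits x = s].
Proof.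
move=> size_A es ei; have [pair_x fst_x snd_x] := pair_strK (nseq n true) (pair_str A s).
have [pair_A fst_A snd_A] := pair_strK A s.
have order_x : inst_order x = n by rewrite /inst_order fst_x size_nseq.
have matrix_x : inst_matrix x = A by rewrite /inst_matrix snd_x fst_A.
split; rewrite // ?/inst_budget_bits ?snd_x //.
apply/and5P; split; rewrite ?snd_x ?matrix_x ?order_x ?size_A //.
  by rewrite fst_x; apply/all_iotaP => i i_n; rewrite nth_nseq i_n.
rewrite /inst_adj matrix_x order_x; apply/all_iotaP => i i_n.
have := ei (Ordinal i_n); rewrite /seq_adj /= => -> /=.
apply/all_iotaP => j j_n.
by have := es (Ordinal i_n) (Ordinal j_n); rewrite /seq_adj /= => ->.
Qed.

Lemma inst_valid_encodes x (e := seq_adj (inst_matrix x) (inst_order x)) :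
  inst_valid x ->
  [/\ symmetric e, irreflexive e & encodes x e (binval (inst_budget_bits x))].
Proof.
case/and5P=> pair_x /all_iotaP true_x pair_A /eqP size_A /all_iotaP adj_ok; split.
- move=> i j; have /andP[_ /all_iotaP] := adj_ok i (ltn_ord i).
  by move/(_ j (ltn_ord j))/eqP.
- by move=> i; have /andP[/negbTE] := adj_ok i (ltn_ord i).
apply/encodesP; exists (inst_matrix x), (inst_budget_bits x); split=> //.
rewrite -{1}(is_pairK pair_x) -{1}(is_pairK pair_A); congr pair_str.
apply: (@eq_from_nth _ false); rewrite ?size_nseq // => i i_n.
by rewrite nth_nseq i_n true_x.
Qed.

(* A certificate is a bit matrix with [2 n] rows of length [n]: the first true
   bit of a row gives the color of a vertex, resp. (in the last [n] rows) the
   level of a color. *)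
Definition cert_row n y u := find (fun a => nth false y (u * n + a)) (iota 0 n).

Definition cert n (c : nat -> nat) : seq bool :=
  mkseq (fun t => c (t %/ n) == t %% n) (2 * n * n).

Lemma cert_rowK n c u : u < 2 * n -> c u < n -> cert_row n (cert n c) u = c u.
Proof.
move=> un cn; have bit a : a < n -> nth false (cert n c) (u * n + a) = (c u == a).
  move=> an; rewrite nth_mkseq; last by nia.
  by rewrite divnMDl ?(divn_small an) ?addn0 ?modnMDl ?modn_small //; lia.
apply: find_iota; rewrite ?bit ?eqxx // => i ic; rewrite bit; last by lia.
by rewrite neq_ltn ic orbT.
Qed.

Definition verify k x y := let n := inst_order x in [&& inst_valid x,
  all (fun u => cert_row n y u < n) (iota 0 n),
  class_check n (inst_adj x) k (cert_row n y) (fun a => cert_row n y (n + a)) &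
  n <= num_colors n (cert_row n y) + inst_budget x].

Lemma verify_sound k x y : verify k x y -> Identification (kind_class k) x.
Proof.
case/and4P=> /inst_valid_encodes[es ei enc] /all_iotaP c_lt check n_le.
exists (inst_order x), _, es, ei, (binval (inst_budget_bits x)); split=> //.
apply: (@class_check_identifiable _ (inst_adj x) es ei k _ _ _ c_lt check).
by apply: leq_trans n_le _; rewrite leq_add2l inst_budgetE geq_minr.
Qed.

Lemma verify_complete k x : Identification (kind_class k) x ->
  exists2 y, size y <= 4 * (size x).+1 ^ 4 & verify k x y.
Proof.
case=> n [e [es [ei [b [/encodesP[A [s [<- x_pair size_A eA]]]]]]]].
subst e => /(identifiableP _ _ (kind_class_sparse k))[Q [f [hf kQ]]].
rewrite card_ord => n_le.
have [inst_ok order_x matrix_x bits_x] := inst_valid_pair s size_A es ei.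
rewrite -x_pair in inst_ok order_x matrix_x bits_x.
have Q_le := leq_card_quotient hf; rewrite card_ord in Q_le.
pose adj u v := nth false A (u * n + v).
have [rk [lv [rk_inj rk_lt lv_lt check]]] := class_check_complete (adj := adj) hf kQ.
pose c u := if insub u is Some u' then rk (f u')
  else if [pick a | rk a == u - n] is Some a then lv a else 0.
have c_rk (u : 'I_n) : cert_row n (cert n c) u = rk (f u).
  have cu : c u = rk (f u) by rewrite /c valK.
  have := rk_lt (f u); have := ltn_ord u.
  by move=> un rk_u; rewrite cert_rowK ?cu //; [lia | apply: leq_trans rk_u Q_le].
have l_lv a : cert_row n (cert n c) (n + rk a) = lv a.
  have rk_a := leq_trans (rk_lt a) Q_le.
  have ca : c (n + rk a) = lv a.
    rewrite /c insubF; last by rewrite ltnNge leq_addr.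
    by rewrite addKn; case: pickP => [a' /eqP/rk_inj -> //|/(_ a)]; rewrite eqxx.
  by rewrite cert_rowK ?ca //; [lia | apply: leq_trans (lv_lt a) Q_le].
exists (cert n c).
  rewrite size_mkseq x_pair !size_pair_str size_nseq.
  have : n <= n.*2.+1 + (2 * size A + size s) by lia.
  move: (_ + _) => N nN; rewrite (_ : size A = n * n) // !expnS expn0; nia.
rewrite /verify /= order_x; apply/and4P; split=> //.
- apply/all_iotaP => u un; rewrite (c_rk (Ordinal un)).
  exact: leq_trans (rk_lt _) Q_le.
- by rewrite /inst_adj matrix_x order_x; apply: check.
- rewrite (num_colors_card (adj := adj) hf rk_inj c_rk); last first.
    by move=> a; apply: leq_trans (rk_lt a) Q_le.
  by rewrite inst_budgetE order_x bits_x; lia.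
Qed.

Lemma polytime_pair_cut S : polytime_str S -> polytime_nat (fun c => pair_cut (S c)).
Proof. by move=> hS; rewrite /pair_cut; polytime_tac. Qed.
#[local] Hint Resolve polytime_pair_cut : polytime.

Lemma polytime_is_pair S : polytime_str S -> polytime_bool (fun c => is_pair (S c)).
Proof. by move=> hS; rewrite /is_pair; polytime_tac. Qed.

Lemma polytime_pair_fst S : polytime_str S -> polytime_str (fun c => pair_fst (S c)).
Proof. by move=> hS; rewrite /pair_fst; polytime_tac. Qed.

Lemma polytime_pair_snd S : polytime_str S -> polytime_str (fun c => pair_snd (S c)).
Proof. by move=> hS; rewrite /pair_snd; polytime_tac. Qed.
#[local] Hint Resolve polytime_is_pair polytime_pair_fst polytime_pair_snd : polytime.

Lemma polytime_inst_order S : polytime_str S -> polytime_nat (fun c => inst_order (S c)).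
Proof. by move=> hS; rewrite /inst_order; polytime_tac. Qed.

Lemma polytime_inst_matrix S :
  polytime_str S -> polytime_str (fun c => inst_matrix (S c)).
Proof. by move=> hS; rewrite /inst_matrix; polytime_tac. Qed.
#[local] Hint Resolve polytime_inst_order polytime_inst_matrix : polytime.

Lemma polytime_inst_adj S F F' : polytime_str S -> polytime_nat F -> polytime_nat F' ->
  polytime_bool (fun c => inst_adj (S c) (F c) (F' c)).
Proof. by move=> hS hF hF'; rewrite /inst_adj; polytime_tac. Qed.

Lemma polytime_inst_budget S :
  polytime_str S -> polytime_nat (fun c => inst_budget (S c)).
Proof.
move=> hS; pose bits c := inst_budget_bits (S c).
have hbits : polytime_str bits by rewrite /bits /inst_budget_bits; polytime_tac.
have horder : polytime_nat (fun c => inst_order (S c)) by polytime_tac.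
apply: (polytime_iteri (f := fun c i acc => minn (inst_order (S c))
  (nth false (bits c) (size (bits c) - i.+1) + acc.*2)))
  (polytime_ctx_bounded horder) _ _ => [|||c [|i] _ //].
1-3: by polytime_tac.
by rewrite iteriS geq_minl.
Qed.

Lemma polytime_cert_row N S F : polytime_nat N -> polytime_str S -> polytime_nat F ->
  polytime_nat (fun c => cert_row (N c) (S c) (F c)).
Proof. by move=> hN hS hF; rewrite /cert_row; polytime_tac. Qed.
#[local] Hint Resolve polytime_inst_adj polytime_inst_budget polytime_cert_row : polytime.

Lemma polytime_verify k S S' : polytime_str S -> polytime_str S' ->
  polytime_bool (fun c => verify k (S c) (S' c)).
Proof.
move=> hS hS'; rewrite /verify /inst_valid /num_colors /=; case: k.
- by rewrite /class_check /star_check; polytime_tac.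
- by rewrite /class_check /connected_check /forest_check; polytime_tac.
- by rewrite /class_check /forest_check; polytime_tac.
Qed.
#[local] Hint Resolve polytime_verify : polytime.

Theorem identification_in_NP H : sparse_class H -> in_NP (Identification H).
Proof.
move=> /sparse_class_kind[k ->].
exists (fun z => [:: is_pair z && verify k (pair_fst z) (pair_snd z)]), 4; split.
  apply: (polytime_str_polytime (S := fun c => [:: is_pair c.1 &&
    verify k (pair_fst c.1) (pair_snd c.1)])); polytime_tac.
move=> x; split=> [/verify_complete[y size_y ver]|[y [_]]].
  by exists y; split=> //; have [-> -> ->] := pair_strK x y; rewrite ver.
by have [-> -> ->] := pair_strK x y => -[/verify_sound].
Qed.

(** * From cliques of compatible vertices to identifications *)

Definition has_clique (N q : nat) (C : rel nat) : Prop :=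
  exists s : seq nat, [/\ uniq s, size s = q, all (fun u => u < N) s &
    {in s &, forall u v, u != v -> C u v}].

(* Complement of the compatibility graph [C] on [0, N), with [N] as an
   additional universal vertex. *)
Definition cone_adj (N : nat) (C : rel nat) : rel nat := fun u v =>
  (u != v) && [|| u == N, v == N, ~~ C u v | ~~ C v u].

Lemma cone_adj_sym N C : symmetric (cone_adj N C).
Proof.
move=> u v; rewrite /cone_adj eq_sym.
by case: (u == N); case: (v == N); rewrite ?orbT //= orbC.
Qed.

Lemma cone_adj_irr N C : irreflexive (cone_adj N C).
Proof. by move=> u; rewrite /cone_adj eqxx. Qed.

Definition cone_matrix (N : nat) (C : rel nat) : seq bool :=
  mkseq (fun t => cone_adj N C (t %/ N.+1) (t %% N.+1)) (N.+1 * N.+1).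

Lemma seq_adj_cone N C (i j : 'I_N.+1) :
  seq_adj (cone_matrix N C) N.+1 i j = cone_adj N C i j.
Proof.
have i_lt := ltn_ord i; have j_lt := ltn_ord j; rewrite /seq_adj nth_mkseq; last by nia.
by rewrite divnMDl // (divn_small j_lt) addn0 modnMDl modn_small.
Qed.

Lemma seq_adj_cone_sym N C : symmetric (seq_adj (cone_matrix N C) N.+1).
Proof. by move=> i j; rewrite !seq_adj_cone cone_adj_sym. Qed.

Lemma seq_adj_cone_irr N C : irreflexive (seq_adj (cone_matrix N C) N.+1).
Proof. by move=> i; rewrite seq_adj_cone cone_adj_irr. Qed.

Lemma quotient_section (G Q : sgraph) (f : vertex G -> vertex Q) :
  quotient_map f -> exists rep, cancel rep f.
Proof. by case=> f_surj _; apply: fin_all_exists f_surj. Qed.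

Section StarGraph.
Variable T : finType.

Definition star_rel : rel (option T) := fun a b => isSome a (+) isSome b.

Lemma star_rel_sym : symmetric star_rel.
Proof. by move=> a b; rewrite /star_rel addbC. Qed.

Lemma star_rel_irr : irreflexive star_rel.
Proof. by move=> a; rewrite /star_rel addbb. Qed.

Definition star_graph := SGraph star_rel_sym star_rel_irr.

Lemma star_graph_is_star : is_star star_graph.
Proof.
apply: (@star_center_is_star star_graph None).
by split=> [[]|[a|] [b|]] //; by [left | right].
Qed.

End StarGraph.

Section ConeGraph.
Variables (N q : nat) (C : rel nat).
Variables (es : symmetric (seq_adj (cone_matrix N C) N.+1))
          (ei : irreflexive (seq_adj (cone_matrix N C) N.+1)).
Let G := SGraph es ei.
Let apex : vertex G := (ord_max : 'I_N.+1).

Section ForestQuotient.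
Variables (Q : sgraph) (f : vertex G -> vertex Q).
Hypotheses (hf : quotient_map f) (forest_Q : is_forest Q).

Lemma apex_part_adj u : f u != f apex -> edge (f u) (f apex).
Proof.
move=> fu; apply/(quotient_edge hf); split=> //; exists u, apex; split=> //.
rewrite /edge /= seq_adj_cone /cone_adj eqxx orbT andbT.
by apply: contraNneq fu => e; apply/eqP; congr f; apply: val_inj.
Qed.

Lemma forest_parts_compatible (u v : 'I_N.+1) :
  f u != f apex -> f v != f apex -> f u != f v -> C u v.
Proof.
move=> fu fv fuv; apply/negPn/negP => not_C.
have edge_uv : edge (f u) (f v).
  apply/(quotient_edge hf); split=> //; exists u, v; split=> //.
  rewrite /edge /= seq_adj_cone /cone_adj not_C !orbT andbT.
  by apply: contraNneq fuv => /val_inj ->.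
apply: (forest_Q (s := [:: f u; f v; f apex])) => //.
rewrite /ucycle /= edge_uv apex_part_adj // edge_sym apex_part_adj //.
by rewrite !inE negb_or fuv fu fv.
Qed.

Lemma forest_quotient_clique : q < #|vertex Q| -> has_clique N q C.
Proof.
move=> q_lt; have [rep repK] := quotient_section hf.
pose s := [seq val (rep a : 'I_N.+1) | a <- enum (predC1 (f apex))].
have s_size : size s = #|vertex Q|.-1 by rewrite size_map -cardE cardC1.
have sP u : u \in take q s -> exists2 a, a != f apex & u = val (rep a : 'I_N.+1).
  by move=> /mem_take/mapP[a]; rewrite mem_enum !inE; exists a.
exists (take q s); split.
- rewrite take_uniq // map_inj_uniq ?enum_uniq // => a b /val_inj e.
  by rewrite -(repK a) -(repK b) e.
- by rewrite size_takel // s_size; lia.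
- apply/allP => _ /sP[a a_apex ->]; rewrite ltn_neqAle -ltnS ltn_ord andbT.
  apply: contraNneq a_apex => e; rewrite -(repK a); apply/eqP; congr f.
  exact: val_inj.
- move=> _ _ /sP[a a_apex ->] /sP[b b_apex ->] ab.
  by apply: forest_parts_compatible; rewrite !repK //; apply: contraNneq ab => ->.
Qed.

End ForestQuotient.

(* Keeps the clique and merges everything else with the apex. *)
Definition clique_map (s : seq nat) (u : vertex G) :
  vertex (star_graph {x : 'I_N.+1 | val x \in s}) := insub (u : 'I_N.+1).

Lemma clique_map_quotient s :
  all (fun u => u < N) s -> {in s &, forall u v, u != v -> C u v} ->
  quotient_map (clique_map s).
Proof.
move=> s_lt s_C; pose T := {x : 'I_N.+1 | val x \in s}; rewrite /clique_map.
have apex_None : insub (ord_max : 'I_N.+1) = None :> option T.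
  by rewrite insubF //; apply/negP => /(allP s_lt) /=; rewrite ltnn.
have s_neq (a : T) : val (val a) != N.
  by have /(allP s_lt) := valP a => a_lt; rewrite neq_ltn a_lt.
split=> [[x|]|a b]; first by exists (val x); rewrite valK.
  by exists ord_max.
split=> [|[ab [u [v [ua vb]]]]].
  case: a b => [a|] [b|] // _; split=> //.
    exists (val a), ord_max; rewrite valK apex_None; split=> //.
    by rewrite /edge /= seq_adj_cone /cone_adj eqxx orbT andbT s_neq.
  exists ord_max, (val b); rewrite valK apex_None; split=> //.
  by rewrite /edge /= seq_adj_cone /cone_adj eqxx andbT eq_sym s_neq.
rewrite /edge /= seq_adj_cone /cone_adj => /andP[uv].
case: a b ua vb ab => [a|] [b|] //; case: insubP => // a' us _ _.
case: insubP => // b' vs _ _ _.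
have vu : val v != val u by rewrite eq_sym.
rewrite (ltn_eqF (allP s_lt _ us)) (ltn_eqF (allP s_lt _ vs)) /=.
by rewrite (s_C _ _ us vs uv) (s_C _ _ vs us vu).
Qed.

Variable H : sgraph -> Prop.
Hypotheses (sparse_H : sparse_class H) (qN : q <= N).

Lemma cone_identifiableP : identifiable H G (N - q) <-> has_clique N q C.
Proof.
split=> [/(identifiableP _ _ sparse_H)[Q [f [hf HQ]]]|[s [uniq_s size_s s_lt s_C]]].
  rewrite card_ord => card_le.
  apply: forest_quotient_clique hf (sparse_class_forest sparse_H HQ) _; lia.
apply/(identifiableP _ _ sparse_H); exists _, (clique_map s).
split; [exact: clique_map_quotient | exact: sparse_class_star (star_graph_is_star _) |].
rewrite card_ord /= card_option card_sig.
have -> : #|[pred x : 'I_N.+1 | val x \in s]| = q; last by lia.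
rewrite (card_count_iota N.+1 (fun a => a \in s)) -size_filter -size_s.
apply/perm_size/uniq_perm => //; first exact/filter_uniq/iota_uniq.
move=> a; rewrite mem_filter mem_iota /= add0n.
by case: (boolP (a \in s)) => //= /(allP s_lt)/ltnW.
Qed.

End ConeGraph.

Definition binary_digits (k : nat) : seq bool := mkseq (fun i => odd (iter i half k)) k.

Lemma binval_binary_digits k : binval (binary_digits k) = k.
Proof.
rewrite /binary_digits.
suff digits n m : m < 2 ^ n -> binval (mkseq (fun i => odd (iter i half m)) n) = m.
  exact/digits/ltn_expl.
elim: n m => [|n IH] m; first by case: m.
rewrite expnS => m_lt.
have -> : mkseq (fun i => odd (iter i half m)) n.+1 =
    odd m :: mkseq (fun i => odd (iter i half m./2)) n.
  rewrite /mkseq /= -[1]addn0 iotaDl -map_comp; congr (_ :: _).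
  by apply: eq_map => i; rewrite /= -iterSr.
by rewrite /= IH; lia.
Qed.

Definition clique_instance (N q : nat) (C : rel nat) : seq bool :=
  pair_str (nseq N.+1 true) (pair_str (cone_matrix N C) (binary_digits (N - q))).

Lemma encodes_clique_instance N q C n (e : rel 'I_n) k :
  encodes (clique_instance N q C) e k -> n = N.+1 /\ k = N - q.
Proof.
case/encodesP=> A [s [<- /pair_str_inj[nE /pair_str_inj[_ <-]] _ _]].
by rewrite binval_binary_digits; move/(congr1 size): nE; rewrite !size_nseq.
Qed.

Section CliqueInstance.
Variables (H : sgraph -> Prop) (sparse_H : sparse_class H) (N q : nat) (C : rel nat).
Hypothesis qN : q <= N.

Lemma clique_instance_clique n (e : rel 'I_n) (es : symmetric e) (ei : irreflexive e) k :
  encodes (clique_instance N q C) e k -> identifiable H (SGraph es ei) k ->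
  has_clique N q C.
Proof.
move=> enc; have [nE kE] := encodes_clique_instance enc; subst n k.
have /encodesP[A [s [_ /pair_str_inj[_ /pair_str_inj[AE _]] _ eE]]] := enc.
by subst e A => /(cone_identifiableP _ _ sparse_H qN).
Qed.

Lemma clique_clique_instance : has_clique N q C ->
  exists (e : rel 'I_N.+1) (es : symmetric e) (ei : irreflexive e),
    encodes (clique_instance N q C) e (N - q) /\ identifiable H (SGraph es ei) (N - q).
Proof.
move=> clique_C; exists (seq_adj (cone_matrix N C) N.+1).
exists (@seq_adj_cone_sym N C), (@seq_adj_cone_irr N C); split; last first.
  exact/cone_identifiableP.
apply/encodesP; exists (cone_matrix N C), (binary_digits (N - q)); split=> //.
  exact: binval_binary_digits.
by rewrite size_mkseq.
Qed.

Lemma identification_clique_instance :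
  Identification H (clique_instance N q C) <-> has_clique N q C.
Proof.
split=> [[n [e [es [ei [k [enc idf]]]]]]|/clique_clique_instance[e [es [ei [enc idf]]]]].
  exact: clique_instance_clique enc idf.
by exists N.+1, e, es, ei, (N - q).
Qed.

Lemma identification_dual_clique_instance :
  Identification_dual H (clique_instance N q C) q.+1 <-> has_clique N q C.
Proof.
split=> [[n [e [es [ei [k [enc _ idf]]]]]]|].
  exact: clique_instance_clique enc idf.
case/clique_clique_instance=> e [es [ei [enc idf]]].
by exists N.+1, e, es, ei, (N - q); split=> //; lia.
Qed.

End CliqueInstance.

Lemma polytime_binary_digits F :
  polytime_nat F -> polytime_str (fun c => binary_digits (F c)).
Proof.
move=> hF; rewrite /binary_digits.
apply: (polytime_mkseq (P := fun c i => odd (iter i half (F c)))) => //.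
apply: polytime_odd; have hF' : polytime_nat (fun c => F (pop c)) by polytime_tac.
apply: (polytime_iter (N := top) (f := fun=> half) polytime_top hF'
  (polytime_ctx_bounded hF')) => [|c i _].
  exact/polytime_half/polytime_top.
by elim: i => //= i; lia.
Qed.
#[local] Hint Resolve polytime_binary_digits : polytime.

Lemma polytime_clique_instance N q (C : ctx -> rel nat) :
  polytime_nat N -> polytime_nat q ->
  (forall F F', polytime_nat F -> polytime_nat F' ->
    polytime_bool (fun c => C (pop c) (F c) (F' c))) ->
  polytime_str (fun c => clique_instance (N c) (q c) (C c)).
Proof.
by move=> hN hq hC; rewrite /clique_instance /cone_matrix /cone_adj; polytime_tac.
Qed.

(* In a binary constraint problem, the vertex [u] assigns a value to the
   variable [idx u]. *)
Definition solution N q (C : rel nat) (idx : nat -> nat) (w : nat -> nat) : Prop :=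
  forall t, t < q -> [/\ w t < N, idx (w t) = t
    & forall t', t' < q -> t <> t' -> C (w t) (w t')].

Lemma solution_clique N q (C : rel nat) idx w :
  solution N q C idx w -> has_clique N q C.
Proof.
move=> sol; exists (mkseq w q); split; rewrite ?size_mkseq //.
- rewrite map_inj_in_uniq ?iota_uniq // => t t'; rewrite !mem_iota => tq tq' e.
  by have [_ <- _] := sol t tq; have [_ <- _] := sol t' tq'; rewrite e.
- by apply/allP => u /mapP[t]; rewrite mem_iota => /sol[w_lt _ _] ->.
- move=> u v /mapP[t]; rewrite mem_iota => /sol[_ _ w_C] -> /mapP[t' t'q ->] ne.
  by apply: w_C; [rewrite mem_iota in t'q | move=> e; rewrite e eqxx in ne].
Qed.

Lemma uniq_other (T : eqType) (s : seq T) u :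
  uniq s -> 1 < size s -> exists2 v, v \in s & u != v.
Proof.
case: s => [|a [|b s]] //=; rewrite inE negb_or => /andP[/andP[ab _] _] _.
case: (eqVneq u a) => [->|ua]; last by exists a; rewrite // inE eqxx.
by exists b; rewrite ?inE ?eqxx ?orbT.
Qed.

Lemma clique_solution N q (C : rel nat) idx : 1 < q ->
  (forall u v, C u v -> idx u < q /\ idx u <> idx v) ->
  has_clique N q C -> exists w, solution N q C idx w.
Proof.
move=> q1 C_idx [s [uniq_s size_s s_lt s_C]].
have idx_lt u : u \in s -> idx u < q.
  move=> us; have [|v vs uv] := uniq_other u uniq_s; first by rewrite size_s.
  by have [] := C_idx _ _ (s_C _ _ us vs uv).
have idx_uniq : uniq (map idx s).
  rewrite map_inj_in_uniq // => u v us vs e; apply/eqP/negPn/negP => uv.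
  by have [] := C_idx _ _ (s_C _ _ us vs uv).
have idx_all : map idx s =i iota 0 q.
  apply: (uniq_min_size idx_uniq _ _).2 => [u /mapP[v vs ->]|]; last first.
    by rewrite size_map size_iota size_s.
  by rewrite mem_iota /= add0n idx_lt.
pose w t := nth 0 s (index t (map idx s)).
have wP t : t < q -> w t \in s /\ idx (w t) = t.
  move=> tq; have t_idx : t \in map idx s by rewrite idx_all mem_iota.
  have t_lt : index t (map idx s) < size s by rewrite -(size_map idx) index_mem.
  by rewrite /w mem_nth // -(nth_map 0 0) // nth_index.
exists w => t tq; have [ws w_t] := wP t tq; split=> //; first exact: (allP s_lt).
move=> t' t'q tt; have [w's w_t'] := wP t' t'q; apply: s_C => //.
by apply: contra_not_neq tt => e; rewrite -w_t -w_t' e.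
Qed.

Lemma has_cliqueP N q (C : rel nat) idx : 1 < q ->
  (forall u v, C u v -> idx u < q /\ idx u <> idx v) ->
  has_clique N q C <-> exists w, solution N q C idx w.
Proof.
move=> q1 C_idx; split=> [|[w]]; [exact: clique_solution | exact: solution_clique].
Qed.

Definition digit (B u i : nat) : nat := (u %/ B ^ i) %% B.

Fixpoint of_digits (B m : nat) (f : nat -> nat) : nat :=
  if m is m'.+1 then of_digits B m' (fun i => f i.+1) * B + f 0 else 0.

Lemma of_digits_lt B m f : (forall i, i < m -> f i < B) -> of_digits B m f < B ^ m.
Proof.
elim: m f => [|m IH] f f_lt //=; have f0 : f 0 < B by apply: f_lt.
have := IH (fun i => f i.+1) (fun i im => f_lt i.+1 im); rewrite expnS; nia.
Qed.

Lemma digit_of_digits B m f i :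
  (forall i, i < m -> f i < B) -> i < m -> digit B (of_digits B m f) i = f i.
Proof.
elim: m f i => [|m IH] f i f_lt //; have f0 : f 0 < B by apply: f_lt.
case: i => [|i] im; first by rewrite /digit expn0 divn1 /= modnMDl modn_small.
rewrite -(IH (fun i => f i.+1)) //; last by move=> j jm; apply: f_lt.
by rewrite /digit expnS divnMA /= divnMDl ?(divn_small f0) ?addn0 //; lia.
Qed.

Lemma polytime_digit B F i : polytime_nat B -> polytime_nat F ->
  polytime_nat (fun c => digit (B c) (F c) i).
Proof. by move=> hB hF; rewrite /digit; polytime_tac. Qed.
#[local] Hint Resolve polytime_digit : polytime.

(** * Tableaux of Turing machines *)

Section TapeDynamics.
Variables (M : tm) (T : nat).
Notation K := (tm_tapes M).
Notation sym := (option (bool + tm_aux M))%type.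

Definition view : finType := (tm_state M * {ffun 'I_K.+1 -> sym})%type.

(* After time [T] the head of tape 0 moves right once more, so that the symbol
   next to the output bit is scanned too. *)
Definition view_action (final : bool) (s : view) :
    tm_state M * {ffun 'I_K.+1 -> sym * direction} :=
  if final then (s.1, [ffun i => (s.2 i, if i == ord0 then MoveR else Stay)])
  else if tm_halt s.1 then (s.1, [ffun i => (s.2 i, Stay)])
  else tm_trans s.1 s.2.

Definition move_head (d : direction) (p : nat) : nat :=
  match d with MoveL => p.-1 | MoveR => p.+1 | Stay => p end.

Record abs_config := AbsConfig {
  abs_state : tm_state M;
  abs_head : 'I_K.+1 -> nat;
  abs_cell : 'I_K.+1 -> nat -> sym }.

Definition abs_view (c : abs_config) : view :=
  (abs_state c, [ffun i => abs_cell c i (abs_head c i)]).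

Definition abs_step (final : bool) (c : abs_config) : abs_config :=
  let a := view_action final (abs_view c) in
  AbsConfig a.1 (fun i => move_head (a.2 i).2 (abs_head c i))
    (fun i p => if p == abs_head c i then (a.2 i).1 else abs_cell c i p).

Definition init_cell (z : seq bool) (i : 'I_K.+1) (p : nat) : sym :=
  if (i == ord0) && (T.+2 <= p) then nth None [seq Some (inl b) | b <- z] (p - T.+2)
  else None.

Fixpoint abs_run (z : seq bool) (t : nat) : abs_config :=
  if t is t'.+1 then abs_step (t' == T) (abs_run z t')
  else AbsConfig (tm_start M) (fun=> T.+2) (init_cell z).

Section Run.
Variable z : seq bool.
Notation run := (abs_run z).

Lemma abs_head_bounds t i :
  T.+2 <= abs_head (run t) i + t /\ abs_head (run t) i <= T.+2 + t.
Proof.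
elim: t => [|t [lower upper]] /=; first by rewrite addn0.
by case: (_.2) => /=; lia.
Qed.

Lemma abs_head_gt0 t i : t <= T.+1 -> 0 < abs_head (run t) i.
Proof. by have [lower _] := abs_head_bounds t i; lia. Qed.

Lemma abs_cell_written t i :
  abs_cell (run t.+1) i (abs_head (run t) i) =
  ((view_action (t == T) (abs_view (run t))).2 i).1.
Proof. by rewrite /= eqxx. Qed.

Lemma abs_cell_kept a t i p : a <= t ->
  (forall j, a <= j < t -> abs_head (run j) i <> p) ->
  abs_cell (run t) i p = abs_cell (run a) i p.
Proof.
elim: t => [|t IH]; first by rewrite leqn0 => /eqP->.
rewrite leq_eqVlt => /predU1P[-> //|le_at not_p] /=.
case: eqP => [e|_]; first by case: (not_p t); rewrite ?e //; lia.
by apply: IH => // j aj; apply: not_p; lia.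
Qed.

Definition tape_cell (t : tape M) (pos p : nat) : sym :=
  if pos <= p then nth None t.2 (p - pos) else nth None t.1 (pos.-1 - p).

Lemma tape_cell_scanned t pos : tape_cell t pos pos = scanned t.
Proof. by rewrite /tape_cell leqnn subnn nth0. Qed.

Lemma tape_cell_write a d (t : tape M) pos p : 0 < pos ->
  tape_cell (write_move (a, d) t) (move_head d pos) p =
  if p == pos then a else tape_cell t pos p.
Proof.
case: t => l r; case: pos => // pos _; rewrite /tape_cell; case: d => /=.
- case: (ltngtP p pos.+1) => [p_lt|p_gt|->].
  + rewrite ltnS in p_lt; case: (ltngtP pos p) p_lt => [//|p_lt _|<- _].
      by rewrite nth_behead; congr nth; lia.
    by rewrite subnn /=; case: (l).
  + rewrite (ltnW (ltnW p_gt)); have -> : p - pos = (p - pos.+1).-1.+2 by lia.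
    by rewrite /= nth_behead prednK // subn_gt0.
  + by rewrite leqnSn subSnn.
- case: (ltngtP p pos.+1) => [p_lt|p_gt|->].
  + by have -> : pos.+1 - p = (pos - p).+1 by lia.
  + by rewrite nth_behead; congr nth; lia.
  + by rewrite subnn.
- case: (ltngtP p pos.+1) => [p_lt|p_gt|->] //; last by rewrite subnn.
  have -> : p - pos.+1 = (p - pos.+2).+1 by lia.
  by rewrite /= nth_behead.
Qed.

Lemma abs_run_tm t (c := iter t (@tm_step M) (tm_init M z)) : t <= T ->
  abs_state (run t) = c.1 /\
  forall i p, abs_cell (run t) i p = tape_cell (c.2 i) (abs_head (run t) i) p.
Proof.
rewrite {}/c; elim: t => [_|t IH tT].
  split=> // i p; rewrite /= /init_cell /tape_cell /=.
  by case: leqP => T_p; rewrite ?andbF ?nth_nil //= andbT; case: eqP; rewrite ?nth_nil.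
have [stateE cellE] := IH (ltnW tT); set c := iter t _ _ in stateE cellE.
have viewE : abs_view (run t) = (c.1, [ffun i => scanned (c.2 i)]).
  rewrite /abs_view stateE; congr pair; apply/ffunP => i.
  by rewrite !ffunE cellE tape_cell_scanned.
have head_gt0 i : 0 < abs_head (run t) i by apply: abs_head_gt0; lia.
rewrite /= (ltn_eqF tT) /abs_step viewE /view_action /= -/c /tm_step.
case: (tm_halt c.1) => /=.
  split=> // i p; rewrite !ffunE cellE /=; case: eqP => [->|] //.
  by rewrite tape_cell_scanned.
case: tm_trans => q act /=; split=> // i p.
by rewrite cellE; case: (act i) => a d; rewrite tape_cell_write.
Qed.

End Run.

Definition is_bit_cell (a : sym) : bool := if a is Some (inl _) then true else false.

Lemma leading_bits_true (r : seq (tm_sym M)) : leading_bits r = [:: true] <->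
  nth None r 0 = Some (inl true) /\ ~~ is_bit_cell (nth None r 1).
Proof.
case: r => [|[[[]|a]|] r] /=; try by split=> // -[].
by split; case: r => [|[[b|a]|] r] //= [].
Qed.

Definition accepting (s : nat -> view) : Prop :=
  [/\ tm_halt (s T).1, (s T).2 ord0 = Some (inl true)
    & ~~ is_bit_cell ((s T.+1).2 ord0)].

Definition run_views (z : seq bool) (t : nat) : view := abs_view (abs_run z t).

Lemma acceptingP z y t : outputs_within M z y t -> t <= T ->
  accepting (run_views z) <-> y = [:: true].
Proof.
move=> [halted out] tT; have := abs_run_tm z (leqnn T).
set c := iter T _ _ => -[stateE cellE].
have cE : c = iter t (@tm_step M) (tm_init M z).
  by rewrite /c -(subnK tT) iterD iter_tm_step_halted.
rewrite -cE in halted out.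
have read_T : (run_views z T).2 ord0 = nth None (c.2 ord0).2 0.
  by rewrite ffunE cellE tape_cell_scanned nth0.
have read_T1 : (run_views z T.+1).2 ord0 = nth None (c.2 ord0).2 1.
  rewrite ffunE /= eqxx /view_action /= !ffunE eqxx /= gtn_eqF //.
  by rewrite cellE /tape_cell leqnSn subSnn.
rewrite /accepting read_T read_T1 /= stateE -out.
by split=> [[_ bit end_]|/leading_bits_true[bit end_]];
  [apply/leading_bits_true | split].
Qed.

(* [prev t i] is one plus the time of the last visit, before time [t], of the
   head of tape [i] to its position at time [t]; 0 if there is none. *)
Record tableau (z : seq bool) (s : nat -> view) (head prev : nat -> 'I_K.+1 -> nat) :
    Prop := Tableau {
  tab_state0 : (s 0).1 = tm_start M;
  tab_head0 : forall i, head 0 i = T.+2;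
  tab_state : forall t, t <= T -> (s t.+1).1 = (view_action (t == T) (s t)).1;
  tab_head : forall t i, t <= T ->
    head t.+1 i = move_head ((view_action (t == T) (s t)).2 i).2 (head t i);
  tab_prev_le : forall t i, t <= T.+1 -> prev t i <= t;
  tab_first_visit : forall t i, t <= T.+1 -> prev t i = 0 ->
    (s t).2 i = init_cell z i (head t i);
  tab_revisit : forall t t' i, t < t' -> t' <= T.+1 -> prev t' i = t.+1 ->
    head t i = head t' i /\ (s t').2 i = ((view_action (t == T) (s t)).2 i).1;
  tab_between : forall t t' i, t < t' -> t' <= T.+1 -> prev t' i <= t ->
    head t i <> head t' i }.

Lemma tableau_run z s head prev t : tableau z s head prev -> t <= T.+1 ->
  run_views z t = s t /\ forall i, abs_head (abs_run z t) i = head t i.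
Proof.
move=> tab; elim/ltn_ind: t => t IH tT.
have [stateE headE] : abs_state (abs_run z t) = (s t).1 /\
    forall i, abs_head (abs_run z t) i = head t i.
  case: t IH tT => [_ _|t IH tT].
    by split=> [|i]; rewrite ?(tab_state0 tab) ?(tab_head0 tab).
  have [viewE headE] := IH t (leqnn _) (ltnW tT).
  split=> [|i]; rewrite /= -/(run_views z t) viewE ?(tab_state tab) //.
  by rewrite headE (tab_head tab).
split=> //; rewrite /run_views /abs_view stateE [RHS]surjective_pairing; congr pair.
apply/ffunP => i; rewrite ffunE headE; have prev_le := tab_prev_le tab i tT.
case prevE : (prev t i) => [|j].
  rewrite (tab_first_visit tab) // (@abs_cell_kept z 0 t) // => j /andP[_ jt].
  have [_ ->] := IH j jt (ltnW (leq_trans jt tT)).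
  by apply: (tab_between tab jt tT); rewrite prevE.
have jt : j < t by rewrite -prevE.
have [viewE headE'] := IH j jt (ltnW (leq_trans jt tT)).
have [same_head ->] := tab_revisit tab jt tT prevE.
rewrite (@abs_cell_kept z j.+1 t) // => [|j' /andP[jj jt']]; last first.
  have [_ ->] := IH j' jt' (ltnW (leq_trans jt' tT)).
  by apply: (tab_between tab jt' tT); rewrite prevE.
by rewrite -same_head -headE' abs_cell_written -/(run_views z j) viewE.
Qed.

Section RunTableau.
Variable z : seq bool.
Notation run := (abs_run z).

Definition last_visit t (i : 'I_K.+1) : nat :=
  \max_(j < t | abs_head (run j) i == abs_head (run t) i) j.+1.

Lemma last_visit_le t i : last_visit t i <= t.
Proof. by apply/bigmax_leqP => j _; apply: ltn_ord. Qed.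

Lemma last_visit_neq t i j :
  j < t -> last_visit t i <= j -> abs_head (run j) i <> abs_head (run t) i.
Proof.
move=> jt last_le e.
have := @leq_bigmax_cond _ (fun j : 'I_t => abs_head (run j) i == abs_head (run t) i)
  (fun j : 'I_t => j.+1) (Ordinal jt).
by rewrite -/(last_visit t i) /= e eqxx ltnNge last_le => /(_ isT).
Qed.

Lemma last_visit_eq t i j : last_visit t i = j.+1 ->
  j < t /\ abs_head (run j) i = abs_head (run t) i.
Proof.
suff [-> //|[k visit_k ->]] : last_visit t i = 0 \/
    exists2 k : 'I_t, abs_head (run k) i == abs_head (run t) i & last_visit t i = k.+1.
  by move=> [<-]; rewrite (eqP visit_k).
rewrite /last_visit; elim/big_ind: _ => [|m n max_m max_n|k visit_k]; first by left.
  by case: (leqP m n).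
by right; exists k.
Qed.

Lemma run_tableau :
  tableau z (run_views z) (fun t => abs_head (run t)) last_visit.
Proof.
split=> // [t i _|t i _ prev0|t t' i tt _ prevE|t t' i tt _].
- exact: last_visit_le.
- rewrite ffunE (@abs_cell_kept z 0 t) // => j /andP[_ jt].
  by apply: last_visit_neq; rewrite ?prev0.
- have [_ same_head] := last_visit_eq prevE; split=> //.
  rewrite ffunE (@abs_cell_kept z t.+1 t') // => [|j /andP[tj jt]].
    by rewrite -same_head abs_cell_written.
  by apply: last_visit_neq => //; rewrite prevE.
- exact: last_visit_neq.
Qed.

End RunTableau.

End TapeDynamics.

Section TableauClique.
Variables (M : tm) (T Y : nat) (x : seq bool).
Notation K := (tm_tapes M).
Notation sym := (option (bool + tm_aux M))%type.
Notation view := (view M).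
Notation tape_ids := (enum 'I_K.+1).

(* A vertex stands for one time step: time, certificate length, view, and for
   each tape the head position and the previous visit to it as in [tableau]. *)
Definition tab_base := T.*2 + Y + #|view| + 5.
Definition tab_fields := K.+1.*2.+3.

Definition vtime u := digit tab_base u 0.
Definition vlen u := digit tab_base u 1.
Definition vview u := digit tab_base u 2.
Definition vhead u i := digit tab_base u i.*2.+3.
Definition vprev u i := digit tab_base u i.*2.+4.

Definition view0 : view := (tm_start M, [ffun=> None]).
Definition view_of u : view := nth view0 (enum view) (vview u).

Definition on_view u (P : pred view) : bool :=
  has (fun s => (vview u == enum_rank s) && P s) (enum view).

Lemma on_viewP u (P : pred view) :
  reflect (vview u < #|view| /\ P (view_of u)) (on_view u P).
Proof.
apply: (iffP hasP) => [[s _ /andP[/eqP us Ps]]|[u_lt Pu]].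
  by rewrite /view_of us nth_enum_rank ltn_ord.
exists (view_of u); first by rewrite mem_enum.
by rewrite Pu andbT /view_of -(enum_val_nth view0 (Ordinal u_lt)) enum_valK.
Qed.

Definition prefix_size := (size x).*2.+1.

Definition init_symbol (i : 'I_K.+1) p l (a : sym) : bool :=
  if (i == ord0) && (T.+2 <= p) then
    if p - T.+2 < prefix_size then
      a == Some (inl (nth false (pair_str x [::]) (p - T.+2)))
    else if p - T.+2 < prefix_size + l then is_bit_cell a
    else a == None
  else a == None.

Definition valid_view u (s : view) : bool :=
  [&& vtime u <= T.+1, vlen u <= Y,
      all (fun i : 'I_K.+1 => (vprev u i <= vtime u) &&
        ((vprev u i == 0) ==> init_symbol i (vhead u i) (vlen u) (s.2 i))) tape_ids,
      (vtime u == 0) ==> ((s.1 == tm_start M) &&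
        all (fun i : 'I_K.+1 => vhead u i == T.+2) tape_ids),
      (vtime u == T) ==> (tm_halt s.1 && (s.2 ord0 == Some (inl true))) &
      (vtime u == T.+1) ==> ~~ is_bit_cell (s.2 ord0)].

Definition step_check (final : bool) u v (s s' : view) : bool :=
  let a := view_action final s in
  ((vtime v == (vtime u).+1) ==> ((s'.1 == a.1) &&
    all (fun i : 'I_K.+1 => vhead v i == move_head (a.2 i).2 (vhead u i)) tape_ids)) &&
  all (fun i : 'I_K.+1 =>
    ((vprev v i == (vtime u).+1) ==>
       ((vhead u i == vhead v i) && (s'.2 i == (a.2 i).1))) &&
    ((vprev v i <= vtime u) ==> (vhead u i != vhead v i))) tape_ids.

Definition tab_valid u : bool := on_view u (valid_view u).

Definition tab_pair u v : bool := (vlen u == vlen v) &&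
  on_view u (fun s => on_view v (step_check (vtime u == T) u v s)).

Definition tab_compat u v : bool :=
  [&& tab_valid u, tab_valid v, vtime u != vtime v
    & (vtime u < vtime v) ==> tab_pair u v].

Lemma init_cell_pair y p (k := p - T.+2) : T.+2 <= p ->
  @init_cell M T (pair_str x y) ord0 p =
    if k < prefix_size then Some (inl (nth false (pair_str x [::]) k))
    else if k < prefix_size + size y then Some (inl (nth false y (k - prefix_size)))
    else None.
Proof.
move=> T_p; rewrite /init_cell eqxx T_p /= -/k.
have size_z : size (pair_str x y) = prefix_size + size y by rewrite size_pair_str.
case: (ltnP k (prefix_size + size y)) => k_lt; last first.
  rewrite nth_default ?size_map ?size_z // ltnNge (leq_trans _ k_lt) //.
  exact: leq_addr.
rewrite (nth_map false) ?size_z // !nth_pair_str -/prefix_size.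
case: (ltnP k prefix_size) => k_prefix; last by rewrite ltnNge (ltnW k_prefix) gtn_eqF.
case: ltnP => // k_ge; have -> : k = (size x).*2 by rewrite /prefix_size in k_prefix; lia.
by rewrite eqxx.
Qed.

Lemma init_symbol_cell y i p :
  init_symbol i p (size y) (@init_cell M T (pair_str x y) i p).
Proof.
rewrite /init_symbol; case: (eqVneq i ord0) => [->|i0] /=; last first.
  by rewrite /init_cell (negbTE i0).
case: (leqP T.+2 p) => T_p; last by rewrite /init_cell (leqNgt T.+2) T_p andbF.
by rewrite init_cell_pair //; do !case: ifP.
Qed.

Lemma init_symbol_eq y i p a : init_symbol i p (size y) a ->
  (forall k, i = ord0 -> k < size y -> p = T.+2 + prefix_size + k -> is_bit_cell a ->
    a = Some (inl (nth false y k))) ->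
  a = @init_cell M T (pair_str x y) i p.
Proof.
rewrite /init_symbol; case: (eqVneq i ord0) => [->|i0] /= a_init cert_bit; last first.
  by rewrite /init_cell (negbTE i0) (eqP a_init).
case: (leqP T.+2 p) a_init => T_p /=; last first.
  by rewrite /init_cell (leqNgt T.+2) T_p andbF => /eqP.
rewrite init_cell_pair //; case: ltnP => [_ /eqP //|k_ge].
case: ltnP => [k_lt a_bit|_ /eqP //]; apply: cert_bit => //; lia.
Qed.

Section Sound.
Variable w : nat -> nat.
Hypothesis sol : solution (tab_base ^ tab_fields) T.+2 tab_compat vtime w.

Lemma sol_valid t : t <= T.+1 -> valid_view (w t) (view_of (w t)).
Proof.
move=> tT; have [_ _ compat] := sol (tT : t < T.+2).
suff /on_viewP[] : tab_valid (w t) by [].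
case: (eqVneq t 0) => [t0|t0]; last by have /and4P[] := compat 0 isT (elimN eqP t0).
have t1 : t <> 1 by rewrite t0.
by have /and4P[] := compat 1 isT t1.
Qed.

Lemma sol_time t : t <= T.+1 -> vtime (w t) = t.
Proof. by move=> tT; have [] := sol (tT : t < T.+2). Qed.

Lemma sol_pair t t' : t < t' -> t' <= T.+1 -> vlen (w t) = vlen (w t') /\
  step_check (t == T) (w t) (w t') (view_of (w t)) (view_of (w t')).
Proof.
move=> tt tT; have tT' : t < T.+2 by lia.
have [_ _ compat] := sol tT'; have ne : t <> t' by lia.
have /and4P[_ _ _] := compat t' tT ne; rewrite /tab_pair !sol_time ?tt //=.
by case/andP=> /eqP-> /on_viewP[_ /on_viewP[_]].
Qed.

Notation l := (vlen (w 0)).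
Notation s := (fun t => view_of (w t)).
Notation head := (fun t (i : 'I_K.+1) => vhead (w t) i).
Notation prev := (fun t (i : 'I_K.+1) => vprev (w t) i).

Lemma sol_len t : t <= T.+1 -> vlen (w t) = l.
Proof. by case: t => // t tT; have [-> _] := sol_pair (ltn0Sn t) tT. Qed.

Lemma sol_between t t' i : t < t' -> t' <= T.+1 -> prev t' i <= t ->
  head t i <> head t' i.
Proof.
move=> tt tT le_t; have [_ /andP[_ /all_enum_ordP/(_ i)/andP[_]]] := sol_pair tt tT.
by rewrite sol_time ?le_t => [/eqP//|]; apply: ltnW (leq_trans tt tT).
Qed.

Lemma sol_first_visit t i : t <= T.+1 -> prev t i = 0 ->
  init_symbol i (head t i) l ((s t).2 i).
Proof.
move=> tT prev0; have /and5P[_ _ /all_enum_ordP/(_ i)/andP[_]] := sol_valid tT.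
by rewrite prev0 eqxx sol_len.
Qed.

(* Bit [k] of the certificate is read off at the first visit to its cell. *)
Definition sol_cert : seq bool :=
  mkseq (fun k => has (fun t => [&& prev t ord0 == 0,
      head t ord0 == T.+2 + prefix_size + k & (s t).2 ord0 == Some (inl true)])
    (iota 0 T.+2)) l.

Lemma nth_sol_cert t k b : t <= T.+1 -> k < l -> prev t ord0 = 0 ->
  head t ord0 = T.+2 + prefix_size + k -> (s t).2 ord0 = Some (inl b) ->
  nth false sol_cert k = b.
Proof.
move=> tT kl prev0 head_t read_t; rewrite nth_mkseq //.
apply/has_iotaP; case: b read_t => read_t.
  by exists t; rewrite // prev0 head_t read_t !eqxx.
move=> [t' tT' /and3P[/eqP prev0' /eqP head_t' /eqP read_t']].
case: (ltngtP t t') => tt; last by rewrite tt read_t' in read_t.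
- by have := sol_between tt tT' (i := ord0); rewrite prev0' head_t head_t'; apply.
- by have := sol_between tt tT (i := ord0); rewrite prev0 head_t head_t'; apply.
Qed.

Lemma sol_tableau : tableau T (pair_str x sol_cert) s head prev.
Proof.
have valid0 := sol_valid (leq0n _); have /and5P[_ _ _ /implyP] := valid0.
rewrite sol_time // eqxx => /(_ isT)/andP[/eqP state0 /all_enum_ordP head0] _.
have step t (i : 'I_K.+1) : t <= T -> (s t.+1).1 = (view_action (t == T) (s t)).1 /\
    head t.+1 i = move_head ((view_action (t == T) (s t)).2 i).2 (head t i).
  move=> tT; have [_ /andP[+ _]] := sol_pair (leqnn t.+1) (tT : t < T.+1).
  rewrite !sol_time ?(leqW tT) // eqxx /= => /andP[/eqP-> /all_enum_ordP head_step].
  by split=> //; apply/eqP.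
split=> [||t tT|t i tT|t i tT|t i tT prev0|t t' i tt tT prevE|].
- exact: state0.
- by move=> i; apply/eqP.
- by have [] := step t ord0 tT.
- by have [] := step t i tT.
- have /and5P[_ _ /all_enum_ordP/(_ i)/andP[]] := sol_valid tT.
  by rewrite sol_time.
- have init := sol_first_visit tT prev0; apply: init_symbol_eq.
    by rewrite size_mkseq.
  rewrite size_mkseq => k i0 kl head_t; subst i; case read_t : (_ ord0) => [[b|]|] // _.
  by rewrite (nth_sol_cert tT kl prev0 head_t read_t).
- have [_ /andP[_ /all_enum_ordP/(_ i)/andP[+ _]]] := sol_pair tt tT.
  rewrite sol_time; last exact: ltnW (leq_trans tt tT).
  by rewrite prevE eqxx /= => /andP[/eqP-> /eqP->].
- exact: sol_between.
Qed.

Lemma sol_accepting : accepting T s.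
Proof.
have /and5P[_ _ _ _ /andP[+ _]] := sol_valid (leqnSn T); rewrite sol_time // eqxx /=.
have /and5P[_ _ _ _ /andP[_ +]] := sol_valid (leqnn T.+1); rewrite sol_time // eqxx /=.
by move=> bit /andP[halted /eqP read]; split.
Qed.

Lemma solution_accepting :
  exists2 y, size y <= Y & accepting T (run_views M T (pair_str x y)).
Proof.
exists sol_cert.
  by rewrite size_mkseq; have /and5P[] := sol_valid (leq0n _).
have viewE t : t <= T.+1 -> run_views M T (pair_str x sol_cert) t = s t.
  by move=> tT; have [] := tableau_run sol_tableau tT.
by rewrite /accepting !viewE //; exact: sol_accepting.
Qed.

End Sound.

Section Complete.
Variable y : seq bool.
Hypothesis size_y : size y <= Y.
Let z := pair_str x y.
Hypothesis acc : accepting T (run_views M T z).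
Notation s := (run_views M T z).
Notation head t := (abs_head (abs_run M T z t)).
Notation prev := (@last_visit M T z).

Definition time_field t i : nat :=
  match i with
  | 0 => t
  | 1 => size y
  | 2 => enum_rank (s t)
  | i'.+3 => if odd i' then prev t (inord i'./2) else head t (inord i'./2)
  end.

Lemma time_field_lt t i : t <= T.+1 -> time_field t i < tab_base.
Proof.
move=> tT; rewrite /tab_base; case: i => [|[|[|i]]] /=; try lia.
  by apply: leq_trans (ltn_ord (enum_rank _)) _; rewrite -addnA addnC -addnA leq_addr.
case: odd; first by have := @last_visit_le M T z t (inord i./2); lia.
by have [_] := @abs_head_bounds M T z t (inord i./2); lia.
Qed.

Definition time_vertex t := of_digits tab_base tab_fields (time_field t).

Lemma time_vertex_lt t : t <= T.+1 -> time_vertex t < tab_base ^ tab_fields.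
Proof. by move=> tT; apply: of_digits_lt => i _; apply: time_field_lt. Qed.

Lemma time_vertexE t i : t <= T.+1 -> i < tab_fields ->
  digit tab_base (time_vertex t) i = time_field t i.
Proof. by move=> tT i_lt; apply: digit_of_digits => // j _; apply: time_field_lt. Qed.

Lemma vtime_time_vertex t : t <= T.+1 -> vtime (time_vertex t) = t.
Proof. by move=> tT; rewrite /vtime time_vertexE. Qed.

Lemma vlen_time_vertex t : t <= T.+1 -> vlen (time_vertex t) = size y.
Proof. by move=> tT; rewrite /vlen time_vertexE. Qed.

Lemma vhead_time_vertex t (i : 'I_K.+1) :
  t <= T.+1 -> vhead (time_vertex t) i = head t i.
Proof.
move=> tT; rewrite /vhead time_vertexE //.
  by rewrite /= odd_double doubleK inord_val.
by rewrite /tab_fields; have := ltn_ord i; lia.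
Qed.

Lemma vprev_time_vertex t (i : 'I_K.+1) :
  t <= T.+1 -> vprev (time_vertex t) i = prev t i.
Proof.
move=> tT; rewrite /vprev time_vertexE //.
  by rewrite /= odd_double /= uphalf_double inord_val.
by rewrite /tab_fields; have := ltn_ord i; lia.
Qed.

Lemma on_view_time_vertex t (P : pred view) :
  t <= T.+1 -> on_view (time_vertex t) P = P (s t).
Proof.
move=> tT; have viewE : vview (time_vertex t) = enum_rank (s t).
  by rewrite /vview time_vertexE.
have view_ofE : view_of (time_vertex t) = s t by rewrite /view_of viewE nth_enum_rank.
apply/on_viewP/idP => [[_]|Ps]; rewrite view_ofE // viewE.
by split=> //; apply: ltn_ord.
Qed.

Lemma time_vertex_valid t : t <= T.+1 -> tab_valid (time_vertex t).
Proof.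
move=> tT; rewrite /tab_valid on_view_time_vertex //; have tab := run_tableau M T z.
have [halted read_T end_] := acc.
apply/and5P; split; rewrite ?vtime_time_vertex ?vlen_time_vertex //.
- apply/all_enum_ordP => i; rewrite vprev_time_vertex // vhead_time_vertex //.
  rewrite (tab_prev_le tab) //=; apply/implyP => /eqP prev0.
  by rewrite (tab_first_visit tab tT prev0) init_symbol_cell.
- apply/implyP => /eqP t0; rewrite t0 eqxx; apply/all_enum_ordP => i.
  by rewrite vhead_time_vertex // (tab_head0 tab).
- apply/andP; split; apply/implyP => /eqP e; rewrite e ?halted ?read_T //.
Qed.

Lemma time_vertex_pair t t' : t < t' -> t' <= T.+1 ->
  tab_pair (time_vertex t) (time_vertex t').
Proof.
move=> tt tT'; have tT : t <= T := leq_trans tt tT'; have tab := run_tableau M T z.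
rewrite /tab_pair !on_view_time_vertex ?(leqW tT) //.
rewrite !vlen_time_vertex ?(leqW tT) // eqxx /= /step_check.
rewrite !vtime_time_vertex ?(leqW tT) //; apply/andP; split.
  apply/implyP => /eqP tt1; rewrite tt1 (tab_state tab) // eqxx /=.
  by apply/all_enum_ordP => i; rewrite !vhead_time_vertex ?(leqW tT).
apply/all_enum_ordP => i; rewrite vprev_time_vertex // !vhead_time_vertex ?(leqW tT) //.
apply/andP; split; apply/implyP.
  by move/eqP => prevE; have [-> ->] := tab_revisit tab tt tT' prevE; rewrite !eqxx.
by move=> prev_le; apply/eqP/(tab_between tab tt tT').
Qed.

Lemma time_vertex_solution :
  solution (tab_base ^ tab_fields) T.+2 tab_compat vtime time_vertex.
Proof.
move=> t tT; split; [exact: time_vertex_lt | exact: vtime_time_vertex |].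
move=> t' tT' ne; apply/and4P; split; rewrite ?time_vertex_valid ?vtime_time_vertex //.
  exact/eqP.
by apply/implyP => tt; apply: time_vertex_pair.
Qed.

End Complete.

Lemma tableau_cliqueP : has_clique (tab_base ^ tab_fields) T.+2 tab_compat <->
  exists2 y, size y <= Y & accepting T (run_views M T (pair_str x y)).
Proof.
have time_lt u v : tab_compat u v -> vtime u < T.+2 /\ vtime u <> vtime v.
  by case/and4P=> /on_viewP[_ /and5P[time_u _ _ _ _]] _ /eqP.
rewrite (has_cliqueP _ _ time_lt) //; split=> [[w]|[y size_y acc]].
  exact: solution_accepting.
by exists (time_vertex y); apply: time_vertex_solution.
Qed.

End TableauClique.

Lemma polytime_bool_case P (f : bool -> ctx -> bool) : polytime_bool P ->
  (forall b, polytime_bool (f b)) -> polytime_bool (fun c => f (P c) c).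
Proof.
move=> hP hf; apply: polytime_ext (polytime_bool_if hP (hf true) (hf false)) => c.
by case: (P c).
Qed.

Section TableauPolytime.
Variables (M : tm) (T Y : ctx -> nat) (S : ctx -> seq bool).
Hypotheses (hT : polytime_nat T) (hY : polytime_nat Y) (hS : polytime_str S).

Lemma polytime_tab_base : polytime_nat (fun c => tab_base M (T c) (Y c)).
Proof. by rewrite /tab_base; polytime_tac. Qed.

#[local] Hint Resolve polytime_tab_base : polytime.

Lemma polytime_on_view F (P : ctx -> pred (view M)) : polytime_nat F ->
  (forall s, polytime_bool (fun c => P c s)) ->
  polytime_bool (fun c => on_view (T c) (Y c) (F c) (P c)).
Proof. by move=> hF hP; rewrite /on_view /vview; polytime_tac. Qed.

Lemma polytime_move_head d F :
  polytime_nat F -> polytime_nat (fun c => move_head d (F c)).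
Proof. by move=> hF; rewrite /move_head; case: d; polytime_tac. Qed.

Lemma polytime_init_symbol (i : 'I_(tm_tapes M).+1) p l a :
  polytime_nat p -> polytime_nat l ->
  polytime_bool (fun c => init_symbol (T c) (S c) i (p c) (l c) a).
Proof.
move=> hp hl; rewrite /init_symbol /prefix_size.
have hbit : polytime_bool (fun c =>
    a == Some (inl (nth false (pair_str (S c) [::]) (p c - (T c).+2)))).
  apply: (polytime_bool_case (f := fun b _ => a == Some (inl b))); polytime_tac.
polytime_tac.
Qed.

Lemma polytime_step_check b s s' F F' : polytime_nat F -> polytime_nat F' ->
  polytime_bool (fun c => @step_check M (T c) (Y c) b (F c) (F' c) s s').
Proof.
move=> hF hF'; have hmove := polytime_move_head.
by rewrite /step_check /vtime /vhead /vprev; polytime_tac.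
Qed.

Lemma polytime_valid_view s F : polytime_nat F ->
  polytime_bool (fun c => @valid_view M (T c) (Y c) (S c) (F c) s).
Proof.
move=> hF; have hinit := polytime_init_symbol.
by rewrite /valid_view /vtime /vlen /vhead /vprev; polytime_tac.
Qed.

End TableauPolytime.

Lemma polytime_tab_compat M T Y S F F' :
  polytime_nat T -> polytime_nat Y -> polytime_str S ->
  polytime_nat F -> polytime_nat F' ->
  polytime_bool (fun c => tab_compat M (T c) (Y c) (S c) (F c) (F' c)).
Proof.
move=> hT hY hS hF hF'; have hbase := polytime_tab_base M hT hY.
have htime G : polytime_nat G -> polytime_nat (fun c => vtime M (T c) (Y c) (G c)).
  by move=> hG; rewrite /vtime; polytime_tac.
have hvalid G : polytime_nat G ->
    polytime_bool (fun c => tab_valid M (T c) (Y c) (S c) (G c)).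
  move=> hG; apply: polytime_on_view => // s; exact: polytime_valid_view.
have hpair : polytime_bool (fun c => tab_pair M (T c) (Y c) (F c) (F' c)).
  apply: polytime_andb; first by rewrite /vlen; polytime_tac.
  apply: polytime_on_view => // s; apply: polytime_on_view => // s'.
  pose f b c := @step_check M (T c) (Y c) b (F c) (F' c) s s'.
  apply: (polytime_bool_case (f := f)) => [|b]; first by polytime_tac.
  exact: polytime_step_check.
by rewrite /tab_compat; polytime_tac.
Qed.

Theorem identification_NP_hard H : sparse_class H -> NP_hard (Identification H).
Proof.
move=> sparse_H L [V [c [[M [d hM]] L_V]]].
pose Y (x : seq bool) := c * (size x).+1 ^ c.
pose T (x : seq bool) := d * ((size x).*2.+1 + Y x).+1 ^ d.
pose N x := tab_base M (T x) (Y x) ^ tab_fields M.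
pose inst x := clique_instance (N x) (T x).+2 (tab_compat M (T x) (Y x) x).
have hY S : polytime_str S -> polytime_nat (fun c => Y (S c)).
  by move=> hS; rewrite /Y; polytime_tac.
have hT S : polytime_str S -> polytime_nat (fun c => T (S c)).
  by move=> hS; have := hY _ hS => hYS; rewrite /T; polytime_tac.
have hbase := polytime_tab_base; have hcompat := polytime_tab_compat.
exists inst; split.
  apply: (polytime_str_polytime (S := fun c => inst c.1)).
  by apply: polytime_clique_instance => [||F F' hF hF']; rewrite /N; polytime_tac.
move=> x; have base_gt : (T x).+2 <= tab_base M (T x) (Y x) by rewrite /tab_base; lia.
have qN : (T x).+2 <= N x.
  rewrite /N expnS; apply: leq_trans base_gt (leq_pmulr _ _).
  by rewrite expn_gt0 /tab_base addnS.
rewrite (identification_clique_instance sparse_H _ qN) tableau_cliqueP L_V.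
have acc y : size y <= Y x ->
    accepting (T x) (run_views M (T x) (pair_str x y)) <-> V (pair_str x y) = [:: true].
  move=> size_y; apply: acceptingP (hM _) _; rewrite leq_mul2l; apply/orP; right.
  by apply: leq_expl; rewrite size_pair_str ltnS leq_add2l.
by split=> [[y [size_y y_acc]]|[y size_y y_acc]]; exists y; rewrite ?acc // -?acc.
Qed.

(** * Circuits *)

Section CircuitParser.
Variable x : seq bool.

Definition run_length (p : nat) : nat :=
  find (fun i => ~~ nth false x (p + i)) (iota 0 (size x)).

(* Positions are cut off at [(size x).+1], which signals a parse error. *)
Definition after_unary (p : nat) : nat := minn (p + run_length p).+1 (size x).+1.

Definition gate_end (p : nat) : nat :=
  if nth false x p then
    iter (run_length p.+2).+1 after_unary (minn p.+2 (size x).+1)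
  else if nth false x p.+1 then after_unary (minn p.+2 (size x).+1)
  else minn p.+2 (size x).+1.

Definition gate_start (j : nat) : nat := iter j gate_end (after_unary 0).

Definition gate_at (p : nat) : gate :=
  if nth false x p then
    let s := mkseq (fun i => run_length (iter i.+1 after_unary p.+2)) (run_length p.+2) in
    if nth false x p.+1 then Or s else And s
  else if nth false x p.+1 then Not (run_length p.+2) else Input.

Definition parsed_gate (j : nat) : gate := gate_at (gate_start j).
Definition parsed_size : nat := run_length 0.
Definition parsed_circuit : circuit := mkseq parsed_gate parsed_size.
Definition parse_ok : bool := gate_start parsed_size == size x.

Lemma run_length_true p i : i < run_length p -> nth false x (p + i).
Proof.
move=> i_lt; have := before_find 0 i_lt; rewrite nth_iota.
  by move/negbT; rewrite negbK.
by apply: leq_trans i_lt _; rewrite /run_length (leq_trans (find_size _ _)) ?size_iota.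
Qed.

Lemma run_length_end p :
  p + run_length p < size x -> nth false x (p + run_length p) = false.
Proof.
move=> end_lt; have has_end : has (fun i => ~~ nth false x (p + i)) (iota 0 (size x)).
  by rewrite has_find size_iota -/(run_length p); lia.
have := nth_find 0 has_end; rewrite -/(run_length p) nth_iota; first by move/negbTE.
by lia.
Qed.

Lemma take_after_unary p : after_unary p <= size x ->
  p < after_unary p /\ take (after_unary p) x = take p x ++ unary_str (run_length p).
Proof.
move=> after_le; have e : after_unary p = (p + run_length p).+1.
  by rewrite /after_unary in after_le *; lia.
rewrite e in after_le *; split; first lia.
rewrite (take_nth false) // run_length_end // /unary_str -rcons_cat; congr rcons.
rewrite takeD; congr cat; apply: (@eq_from_nth _ false).
  by rewrite size_takel ?size_nseq // size_drop; lia.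
move=> i; rewrite size_takel ?size_drop; last lia.
by move=> i_lt; rewrite nth_take // nth_drop run_length_true // nth_nseq i_lt.
Qed.

Lemma take_iter_after_unary q i : iter i after_unary q <= size x ->
  q <= iter i after_unary q /\ take (iter i after_unary q) x =
    take q x ++
      flatten [seq unary_str (run_length (iter k after_unary q)) | k <- iota 0 i].
Proof.
elim: i => [|i IH]; first by rewrite cats0.
rewrite iterS => /[dup] iter_le /take_after_unary[lt ->].
have [le ->] := IH (leq_trans (ltnW lt) iter_le).
split; first exact: leq_trans le (ltnW lt).
by rewrite -addn1 iotaD map_cat flatten_cat /= add0n cats0 catA.
Qed.

Lemma take_two p : p.+2 <= size x ->
  take p.+2 x = take p x ++ [:: nth false x p; nth false x p.+1].
Proof. by move=> p_le; rewrite !(take_nth false) ?(ltnW p_le) // -!cats1 -catA. Qed.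

Lemma take_gate_end p : gate_end p <= size x ->
  p < gate_end p /\ take (gate_end p) x = take p x ++ gate_str (gate_at p).
Proof.
have minE q : q <= size x -> minn p.+2 (size x).+1 <= q -> minn p.+2 (size x).+1 = p.+2.
  by lia.
rewrite /gate_end /gate_at; case bit0: (nth false x p).
  move=> end_le; have [ge_q] := take_iter_after_unary end_le.
  have e := minE _ end_le ge_q; rewrite e in end_le ge_q *; move=> ->; split.
    exact: leq_trans ge_q.
  rewrite (take_two (leq_trans ge_q end_le)) -catA; congr cat; rewrite bit0.
  rewrite /= -[1]addn0 iotaDl -map_comp.
  by case: (nth _ _ _); rewrite /= /list_str size_mkseq /mkseq -map_comp.
case bit1: (nth false x p.+1).
  move=> end_le; have [gt_q] := take_after_unary end_le.
  have e := minE _ end_le (ltnW gt_q); rewrite e in end_le gt_q *; move=> ->; split.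
    exact: ltn_trans gt_q.
  by rewrite (take_two (leq_trans (ltnW gt_q) end_le)) -catA bit0 bit1.
move=> end_le; have e := minE _ end_le (leqnn _); rewrite e in end_le *.
by rewrite take_two // bit0 bit1.
Qed.

Lemma parse_sound : parse_ok -> x = circuit_str parsed_circuit.
Proof.
move=> /eqP end_x.
have take_start j : gate_start j <= size x -> take (gate_start j) x =
    unary_str parsed_size ++ flatten [seq gate_str (parsed_gate i) | i <- iota 0 j].
  elim: j => [|j IH]; first by rewrite cats0 => /take_after_unary[_ ->]; rewrite take0.
  rewrite /gate_start iterS => /[dup] start_le /take_gate_end[lt ->].
  rewrite IH; last exact: leq_trans (ltnW lt) start_le.
  by rewrite -addn1 iotaD map_cat flatten_cat /= add0n cats0 catA.
rewrite -{1}[x]take_size -end_x take_start ?end_x //.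
by rewrite /circuit_str size_mkseq /parsed_circuit /mkseq -map_comp.
Qed.

Lemma drop_after_unary p m r : p <= size x -> drop p x = unary_str m ++ r ->
  [/\ run_length p = m, after_unary p <= size x & drop (after_unary p) x = r].
Proof.
move=> p_le e; have nth_p i : nth false x (p + i) = nth false (unary_str m ++ r) i.
  by rewrite -e nth_drop.
have size_p : size x - p = m.+1 + size r.
  by rewrite -size_drop e size_cat size_rcons size_nseq.
have run_p : run_length p = m.
  apply: find_iota; first lia.
    by rewrite nth_p nth_cat size_rcons size_nseq leqnn nth_rcons size_nseq ltnn eqxx.
  move=> i im; rewrite negbK nth_p nth_cat size_rcons size_nseq ltnS (ltnW im).
  by rewrite nth_rcons size_nseq im nth_nseq im.
have after_p : after_unary p = m.+1 + p by rewrite /after_unary run_p; lia.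
split=> //; first by rewrite after_p; lia.
by rewrite after_p -drop_drop e drop_size_cat // size_rcons size_nseq.
Qed.

Lemma drop_iter_after_unary s q r : q <= size x ->
  drop q x = flatten (map unary_str s) ++ r ->
  [/\ mkseq (fun i => run_length (iter i after_unary q)) (size s) = s,
      iter (size s) after_unary q <= size x & drop (iter (size s) after_unary q) x = r].
Proof.
elim: s q => [|m s IH] q q_le //=; rewrite -catA.
move=> /(drop_after_unary q_le)[run_q after_le drop_after].
have [runs_s iter_le drop_iter] := IH _ after_le drop_after; rewrite -iterS iterSr.
split=> //; rewrite /mkseq /= run_q -[1]addn0 iotaDl -map_comp; congr (_ :: _).
rewrite -[RHS]runs_s /mkseq; apply: eq_map => i /=.
by rewrite -iterS iterSr.
Qed.

Lemma drop_list_str p s r : p <= size x -> drop p x = list_str s ++ r ->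
  [/\ mkseq (fun i => run_length (iter i.+1 after_unary p)) (run_length p) = s,
      iter (run_length p).+1 after_unary p <= size x
    & drop (iter (run_length p).+1 after_unary p) x = r].
Proof.
move=> p_le; rewrite /list_str -catA => /(drop_after_unary p_le)[-> after_le drop_after].
have [runs_s iter_le drop_iter] := drop_iter_after_unary after_le drop_after.
rewrite iterSr; split=> //; rewrite -[RHS]runs_s.
by apply: eq_map => i; rewrite iterSr.
Qed.

Lemma drop_gate_end p g r : p <= size x -> drop p x = gate_str g ++ r ->
  [/\ gate_at p = g, gate_end p <= size x & drop (gate_end p) x = r].
Proof.
move=> p_le e; have nth_p i : nth false x (p + i) = nth false (gate_str g ++ r) i.
  by rewrite -e nth_drop.
have := nth_p 0; have := nth_p 1; rewrite addn0 addn1 => bit1 bit0.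
have p2_le : p.+2 <= size x.
  have : size (drop p x) = size (gate_str g) + size r by rewrite e size_cat.
  by rewrite size_drop; case: (g) => /=; lia.
have drop_p2 : drop p.+2 x = drop 2 (gate_str g) ++ r.
  by rewrite -add2n -drop_drop e; case: (g) => [|i|s|s] /=; rewrite ?drop0.
have min_p2 : minn p.+2 (size x).+1 = p.+2 by lia.
rewrite /gate_at /gate_end min_p2 bit0 bit1.
case: g drop_p2 {e nth_p bit0 bit1} => [//|i|s|s] /=; rewrite ?drop0.
- by move/(drop_after_unary p2_le)=> [-> after_le drop_after].
- by move/(drop_list_str p2_le)=> [-> iter_le drop_iter].
- by move/(drop_list_str p2_le)=> [-> iter_le drop_iter].
Qed.

Lemma parse_complete C : x = circuit_str C -> parse_ok /\ parsed_circuit = C.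
Proof.
move=> e; have [|size_C after_le drop_after] :=
    @drop_after_unary 0 (size C) (flatten (map gate_str C)) (leq0n _).
  by rewrite drop0.
have start j : j <= size C -> gate_start j <= size x /\
    drop (gate_start j) x = flatten (map gate_str (drop j C)).
  elim: j => [|j IH] jC; first by rewrite drop0.
  have [start_le] := IH (ltnW jC); rewrite (drop_nth Input jC) /= => drop_start.
  by have [_ end_le drop_end] := drop_gate_end start_le drop_start.
have gateE j : j < size C -> parsed_gate j = nth Input C j.
  move=> jC; have [start_le] := start j (ltnW jC); rewrite (drop_nth Input jC) /=.
  by case/(drop_gate_end start_le).
split.
  have [start_le] := start _ (leqnn _); rewrite drop_size /= => drop_start.
  rewrite /parse_ok /parsed_size size_C eqn_leq start_le /=.
  by have := size_drop (gate_start (size C)) x; rewrite drop_start /=; lia.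
apply: (@eq_from_nth _ Input); rewrite size_mkseq /parsed_size size_C // => j jC.
by rewrite nth_mkseq ?gateE // /parsed_size size_C.
Qed.

Definition num_args (j : nat) : nat :=
  if nth false x (gate_start j) then run_length (gate_start j).+2
  else nth false x (gate_start j).+1.

Definition gate_arg (j i : nat) : nat :=
  if nth false x (gate_start j) then run_length (iter i.+1 after_unary (gate_start j).+2)
  else run_length (gate_start j).+2.

Lemma parsed_gate_args j : gate_args (parsed_gate j) = mkseq (gate_arg j) (num_args j).
Proof.
rewrite /parsed_gate /gate_at /num_args /gate_arg.
by case: (nth false x _); case: (nth false x _).
Qed.

End CircuitParser.

Definition is_not (g : gate) := if g is Not _ then true else false.
Definition is_and (g : gate) := if g is And _ then true else false.

Lemma polytime_run_length S F : polytime_str S -> polytime_nat F ->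
  polytime_nat (fun c => run_length (S c) (F c)).
Proof. by move=> hS hF; rewrite /run_length; polytime_tac. Qed.
#[local] Hint Resolve polytime_run_length : polytime.

Lemma polytime_after_unary S F : polytime_str S -> polytime_nat F ->
  polytime_nat (fun c => after_unary (S c) (F c)).
Proof. by move=> hS hF; rewrite /after_unary; polytime_tac. Qed.
#[local] Hint Resolve polytime_after_unary : polytime.

Lemma polytime_iter_after_unary S F N :
  polytime_str S -> polytime_nat F -> polytime_nat N ->
  polytime_nat (fun c => iter (N c) (after_unary (S c)) (F c)).
Proof.
move=> hS hF hN; apply: (polytime_iter (f := fun c => after_unary (S c))
  (B := fun c => F c + (size (S c)).+1)) => //.
- by apply: polytime_ctx_bounded; polytime_tac.
- by polytime_tac.
- by move=> c [|i] _; rewrite ?iterS /= ?leq_addr // /after_unary geq_min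
    (leq_addl (F c)) orbT.
Qed.
#[local] Hint Resolve polytime_iter_after_unary : polytime.

Lemma polytime_gate_start S F : polytime_str S -> polytime_nat F ->
  polytime_nat (fun c => gate_start (S c) (F c)).
Proof.
move=> hS hF; apply: (polytime_iter (f := fun c => gate_end (S c))
  (a := fun c => after_unary (S c) 0) (B := fun c => (size (S c)).+1)) => //.
- by polytime_tac.
- by apply: polytime_ctx_bounded; polytime_tac.
- by rewrite /gate_end; polytime_tac.
- move=> c [|i] _; first by rewrite /= /after_unary geq_minr.
  rewrite iterS /gate_end; case: ifP => _; first by rewrite iterS /after_unary geq_minr.
  by case: ifP => _; rewrite ?/after_unary geq_minr.
Qed.
#[local] Hint Resolve polytime_gate_start : polytime.

Section ParsedGatePolytime.
Variables (S : ctx -> seq bool) (F : ctx -> nat).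
Hypotheses (hS : polytime_str S) (hF : polytime_nat F).
Notation gate c := (parsed_gate (S c) (F c)).

Lemma polytime_parsed_size : polytime_nat (fun c => parsed_size (S c)).
Proof. by rewrite /parsed_size; polytime_tac. Qed.

Lemma polytime_num_args : polytime_nat (fun c => num_args (S c) (F c)).
Proof. by rewrite /num_args; polytime_tac. Qed.

Lemma polytime_size_args : polytime_nat (fun c => size (gate_args (gate c))).
Proof.
by apply: polytime_ext polytime_num_args => c; rewrite parsed_gate_args size_mkseq.
Qed.

Lemma polytime_gate_arg F' : polytime_nat F' ->
  polytime_nat (fun c => gate_arg (S c) (F c) (F' c)).
Proof. by move=> hF'; rewrite /gate_arg; polytime_tac. Qed.

Lemma polytime_is_input : polytime_bool (fun c => is_input (gate c)).
Proof.
have test : polytime_bool (fun c => ~~ nth false (S c) (gate_start (S c) (F c)) &&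
    ~~ nth false (S c) (gate_start (S c) (F c)).+1) by polytime_tac.
apply: polytime_ext test => c; rewrite /parsed_gate /gate_at.
by case: (nth false _ _); case: (nth false _ _).
Qed.

Lemma polytime_is_not : polytime_bool (fun c => is_not (gate c)).
Proof.
have test : polytime_bool (fun c => ~~ nth false (S c) (gate_start (S c) (F c)) &&
    nth false (S c) (gate_start (S c) (F c)).+1) by polytime_tac.
apply: polytime_ext test => c; rewrite /parsed_gate /gate_at.
by case: (nth false _ _); case: (nth false _ _).
Qed.

Lemma polytime_is_and : polytime_bool (fun c => is_and (gate c)).
Proof.
have test : polytime_bool (fun c => nth false (S c) (gate_start (S c) (F c)) &&
    ~~ nth false (S c) (gate_start (S c) (F c)).+1) by polytime_tac.
apply: polytime_ext test => c; rewrite /parsed_gate /gate_at.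
by case: (nth false _ _); case: (nth false _ _).
Qed.

End ParsedGatePolytime.

#[local] Hint Resolve polytime_parsed_size polytime_num_args polytime_gate_arg
  polytime_size_args polytime_is_input polytime_is_not polytime_is_and : polytime.

Section ArgsPolytime.
Variables (S : ctx -> seq bool) (F : ctx -> nat) (P : ctx -> nat -> bool).
Hypotheses (hS : polytime_str S) (hF : polytime_nat F).
Hypothesis hP : forall G, polytime_nat G -> polytime_bool (fun c => P (pop c) (G c)).

Lemma polytime_all_args :
  polytime_bool (fun c => all (P c) (gate_args (parsed_gate (S c) (F c)))).
Proof.
have hall : polytime_bool (fun c =>
    all (fun i => P c (gate_arg (S c) (F c) i)) (iota 0 (num_args (S c) (F c)))).
  by polytime_tac.
by apply: polytime_ext hall => c; rewrite parsed_gate_args all_map.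
Qed.

Lemma polytime_has_args :
  polytime_bool (fun c => has (P c) (gate_args (parsed_gate (S c) (F c)))).
Proof.
have hhas : polytime_bool (fun c =>
    has (fun i => P c (gate_arg (S c) (F c) i)) (iota 0 (num_args (S c) (F c)))).
  by polytime_tac.
by apply: polytime_ext hhas => c; rewrite parsed_gate_args has_map.
Qed.

End ArgsPolytime.

#[local] Hint Resolve polytime_all_args polytime_has_args : polytime.

Section NodeValues.
Variables (T : Type) (h : seq T -> gate -> T) (x0 : T).

Lemma node_values_rcons C g :
  node_values h (rcons C g) = rcons (node_values h C) (h (node_values h C) g).
Proof. by rewrite /node_values -cats1 foldl_cat. Qed.

Lemma size_node_values C : size (node_values h C) = size C.
Proof. by elim/last_ind: C => // C g IH; rewrite node_values_rcons !size_rcons IH. Qed.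

Lemma nth_node_values C j : j < size C ->
  nth x0 (node_values h C) j = h (take j (node_values h C)) (nth Input C j).
Proof.
elim/last_ind: C => // C g IH; rewrite size_rcons node_values_rcons ltnS leq_eqVlt.
rewrite !nth_rcons size_node_values.
case: (ltngtP j (size C)) => // [jC _|-> _].
  by rewrite IH // -cats1 take_cat size_node_values jC.
by rewrite -cats1 take_cat size_node_values ltnn subnn take0 cats0.
Qed.

Lemma last_node_values C :
  last x0 (node_values h C) = nth x0 (node_values h C) (size C).-1.
Proof. by rewrite -nth_last size_node_values. Qed.

End NodeValues.

Lemma bigmax_leq_all (s : seq nat) (F : nat -> nat) m :
  (\max_(i <- s) F i <= m) = all (fun i => F i <= m) s.
Proof. by elim: s => [|i s IH]; rewrite ?big_nil // big_cons geq_max IH. Qed.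

Section CircuitTheory.
Variables (g : nat -> gate) (n : nat).
Notation C := (mkseq g n).
Notation args j := (gate_args (g j)).
Hypothesis wf : circuit_wf C.

Lemma args_lt j i : j < n -> i \in args j -> i < j.
Proof.
move=> jn ij; have jC : j < size C by rewrite size_mkseq.
by have := wf jC; rewrite nth_mkseq // => /allP/(_ i ij).
Qed.

Lemma args_ltn j i : j < n -> i \in args j -> i < n.
Proof. by move=> jn ij; apply: ltn_trans (args_lt jn ij) jn. Qed.

Lemma is_input_args j : is_input (g j) -> args j = [::].
Proof. by case: (g j). Qed.

Definition node_depth (j : nat) : nat :=
  nth 0 (node_values (fun ds g =>
    if is_input g then 0 else (\max_(i <- gate_args g) nth 0 ds i).+1) C) j.

Definition node_weft (j : nat) : nat :=
  nth 0 (node_values (fun ws g =>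
    \max_(i <- gate_args g) nth 0 ws i + (2 < size (gate_args g))) C) j.

Lemma node_depthE j : j < n ->
  node_depth j = if is_input (g j) then 0 else (\max_(i <- args j) node_depth i).+1.
Proof.
move=> jn; rewrite /node_depth nth_node_values ?size_mkseq // nth_mkseq //.
case: is_input => //; congr S; apply: eq_big_seq => i /(args_lt jn) ij.
by rewrite nth_take.
Qed.

Lemma node_weftE j : j < n ->
  node_weft j = \max_(i <- args j) node_weft i + (2 < size (args j)).
Proof.
move=> jn; rewrite /node_weft nth_node_values ?size_mkseq // nth_mkseq //.
by congr addn; apply: eq_big_seq => i /(args_lt jn) ij; rewrite nth_take.
Qed.

Lemma node_depth_arg D j i :
  j < n -> i \in args j -> node_depth j <= D.+1 -> node_depth i <= D.
Proof.
move=> jn ij; rewrite node_depthE //; case: ifP => [/is_input_args e|_].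
  by rewrite e in ij.
by rewrite ltnS bigmax_leq_all => /allP; apply.
Qed.

Lemma node_weft_arg j i : j < n -> i \in args j ->
  node_weft i + (2 < size (args j)) <= node_weft j.
Proof.
move=> jn ij; rewrite (node_weftE jn) leq_add2r.
have := leqnn (\max_(k <- args j) node_weft k).
by rewrite {1}bigmax_leq_all => /allP; apply.
Qed.

Lemma node_depth0_input j : j < n -> node_depth j <= 0 -> is_input (g j).
Proof. by move=> jn; rewrite node_depthE //; case: ifP. Qed.

Lemma node_weft_input j : j < n -> is_input (g j) -> node_weft j = 0.
Proof. by move=> jn /is_input_args e; rewrite node_weftE // e big_nil. Qed.

Fixpoint depth_le (D j : nat) : bool :=
  is_input (g j) || (if D is D'.+1 then all (depth_le D') (args j) else false).

Fixpoint weft_le (t D j : nat) {struct D} : bool :=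
  if D is D'.+1 then
    if size (args j) <= 2 then all (weft_le t D') (args j)
    else if t is t'.+1 then all (weft_le t' D') (args j) else false
  else true.

Lemma depth_leP D j : j < n -> depth_le D j = (node_depth j <= D).
Proof.
elim: D j => [|D IH] j jn; rewrite /= node_depthE //; case: is_input => //=.
rewrite ltnS bigmax_leq_all; apply: eq_in_all => i ij.
by rewrite IH // (args_ltn jn).
Qed.

Lemma weft_leP t D j : j < n -> node_depth j <= D -> weft_le t D j = (node_weft j <= t).
Proof.
elim: D t j => [|D IH] t j jn depth_j.
  by rewrite /= (node_weft_input jn) // node_depth0_input.
rewrite /= node_weftE //; have IH' t' : all (weft_le t' D) (args j) =
    (\max_(i <- args j) node_weft i <= t').
  rewrite bigmax_leq_all; apply: eq_in_all => i ij.
  by rewrite IH // ?(args_ltn jn) //; apply: node_depth_arg depth_j.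
case: leqP => _; first by rewrite addn0.
by case: t => [|t]; rewrite addn1.
Qed.

(* A gate other than an input has value [b] iff all, if [conjunctive] holds, or
   some of its arguments have the value [arg_value]. *)
Definition conjunctive (h : gate) (b : bool) : bool := is_not h || (is_and h == b).
Definition arg_value (h : gate) (b : bool) : bool := is_not h (+) b.
Definition some_or_all (h : gate) (b : bool) (P : pred nat) (s : seq nat) : bool :=
  if conjunctive h b then all P s else has P s.

(* Three-valued evaluation: [forces known v D b j] says that node [j] has value
   [b] whatever the inputs outside [known] are, where [v] gives the values on
   [known]. *)
Fixpoint forces (known v : pred nat) (D : nat) (b : bool) (j : nat) : bool :=
  if is_input (g j) then known j && (v j == b)
  else if D is D'.+1 then
    some_or_all (g j) b (forces known v D' (arg_value (g j) b)) (args j)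
  else false.

Fixpoint inputs_of (D j : nat) : seq nat :=
  if is_input (g j) then [:: j]
  else if D is D'.+1 then flatten (map (inputs_of D') (args j)) else [::].

Lemma inputs_of_lt D j : j < n -> all (fun i => i < n) (inputs_of D j).
Proof.
elim: D j => [|D IH] j jn /=; case: is_input => //=; rewrite ?jn //.
by apply/allP => i /flatten_mapP[k kj]; apply: (allP (IH k (args_ltn jn kj))).
Qed.

Lemma size_inputs_of D j :
  j < n -> node_depth j <= D -> node_weft j = 0 -> size (inputs_of D j) <= 2 ^ D.
Proof.
elim: D j => [|D IH] j jn depth_j weft_j /=; case: ifP => // _; first by rewrite expn_gt0.
have args_le : size (args j) <= 2.
  by move: weft_j; rewrite node_weftE //; case: (leqP _ 2) => //= _; rewrite addn1.
have IHj i : i \in args j -> size (inputs_of D i) <= 2 ^ D.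
  move=> ij; apply: IH; [exact: args_ltn ij | exact: node_depth_arg depth_j |].
  by have := node_weft_arg jn ij; rewrite weft_j leqn0 addn_eq0 => /andP[/eqP].
apply: leq_trans (_ : size (args j) * 2 ^ D <= _); last first.
  by rewrite expnS leq_mul2r args_le orbT.
elim: (args j) IHj => //= i s IHs IHj; rewrite size_cat mulSn leq_add ?IHs //.
  by apply: IHj; rewrite mem_head.
by move=> k ks; apply: IHj; rewrite inE ks orbT.
Qed.

Section Values.
Variable a : nat -> bool.

Definition node_value (j : nat) : bool :=
  nth false (node_values (fun vs g => match g with
    | Input => a (size vs)
    | Not i => ~~ nth false vs i
    | And s => all (nth false vs) s
    | Or s => has (nth false vs) s
    end) C) j.

Lemma node_valueE j : j < n -> node_value j = match g j with
  | Input => a j | Not i => ~~ node_value i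
  | And s => all node_value s | Or s => has node_value s end.
Proof.
move=> jn; have lt_j i : i \in args j -> i < j := args_lt jn.
rewrite /node_value nth_node_values ?size_mkseq // nth_mkseq //.
case: (g j) lt_j => [|i|s|s] /= lt_j.
- by rewrite size_takel // size_node_values size_mkseq ltnW.
- by rewrite nth_take // lt_j ?inE.
- by apply: eq_in_all => i /lt_j ij; rewrite nth_take.
- by apply: eq_in_has => i /lt_j ij; rewrite nth_take.
Qed.

Lemma node_value_input j : j < n -> is_input (g j) -> node_value j = a j.
Proof. by move=> jn; rewrite node_valueE //; case: (g j). Qed.

Lemma node_value_args j b : j < n -> ~~ is_input (g j) -> (node_value j == b) =
  some_or_all (g j) b (fun i => node_value i == arg_value (g j) b) (args j).
Proof.
move=> jn; rewrite node_valueE // /some_or_all /conjunctive /arg_value.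
have all_eqb (s : seq nat) v : all (fun i => node_value i == v) s =
    (if v then all node_value s else ~~ has node_value s).
  by case: v; rewrite -?all_predC; apply: eq_all => i /=; case: (node_value i).
have has_eqb (s : seq nat) v : has (fun i => node_value i == v) s =
    (if v then has node_value s else ~~ all node_value s).
  by case: v; rewrite -?has_predC; apply: eq_has => i /=; case: (node_value i).
case: (g j) => [|i|s|s] //= _; first by case: (node_value i) b => [] [].
all: by case: b; rewrite /= ?all_eqb ?has_eqb ?eqb_id ?eqbF_neg.
Qed.

Section Views.
Variables known v : pred nat.
Hypothesis view : forall i, i < n -> is_input (g i) -> known i -> v i = a i.

Lemma some_or_all_sub h b (P Q : pred nat) s :
  (forall i, i \in s -> P i -> Q i) -> some_or_all h b P s -> some_or_all h b Q s.
Proof.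
move=> PQ; rewrite /some_or_all; case: ifP => _.
  by move=> /allP all_P; apply/allP => i si; apply: PQ (all_P i si).
by case/hasP=> i si Pi; apply/hasP; exists i; [|apply: PQ].
Qed.

Lemma forces_sound D b j : j < n -> forces known v D b j -> node_value j = b.
Proof.
elim: D b j => [|D IH] b j jn /=; case: ifP => // input_j.
1,2: by case/andP=> known_j /eqP <-; rewrite node_value_input // view.
move=> args_force; apply/eqP; rewrite node_value_args ?input_j //.
apply: some_or_all_sub args_force => i ij /IH -> //; exact: args_ltn ij.
Qed.

Lemma forces_complete D j : j < n -> node_depth j <= D ->
  {in inputs_of D j, forall i, known i} -> forces known v D (node_value j) j.
Proof.
elim: D j => [|D IH] j jn depth_j /=; case: ifP => input_j known_j.
- by rewrite known_j ?inE //= view ?known_j ?inE //= node_value_input.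
- by have := node_depth0_input jn depth_j; rewrite input_j.
- by rewrite known_j ?inE //= view ?known_j ?inE //= node_value_input.
have := node_value_args (node_value j) jn; rewrite input_j eqxx => /(_ isT)/esym.
apply: some_or_all_sub => i ij /eqP <-; apply: IH.
- exact: args_ltn ij.
- exact: node_depth_arg depth_j.
by move=> k ki; apply: known_j; apply/flatten_mapP; exists i.
Qed.

End Views.

(* The claims in [cl] support the claim that node [j] has value [b]; claims about
   nodes of weft 0, and conjunctive claims about large gates, need no support. *)
Definition justified (d : nat) (cl : nat -> bool -> bool) (j : nat) (b : bool) : bool :=
  [|| weft_le 0 d j, conjunctive (g j) b && (2 < size (args j))
    | some_or_all (g j) b (fun i => cl i (arg_value (g j) b)) (args j)].

Lemma justified_sub d (cl cl' : nat -> bool -> bool) j b :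
  (forall i v, cl i v -> cl' i v) ->
  justified d cl j b -> justified d cl' j b.
Proof.
rewrite /justified => sub /or3P[->|->|supp]; rewrite ?orbT //.
by rewrite (some_or_all_sub _ supp) ?orbT // => i _; apply: sub.
Qed.

Section ClaimsSound.
Variables (d : nat) (cl : nat -> bool -> bool).
Hypothesis cl_justified : forall j b, j < n -> cl j b -> justified d cl j b.
Hypothesis views : forall cs, size cs <= 2 ^ d -> all (fun i => i < n) cs ->
  exists known v : pred nat,
    [/\ forall i, i < n -> is_input (g i) -> known i -> v i = a i,
        {in cs, forall i, known i} &
        forall j b, j < n -> cl j b -> ~~ forces known v d (~~ b) j].

(* Some view knows all inputs of [j] and would refute a wrong claim. *)
Lemma claim_weft0 j b :
  j < n -> node_depth j <= d -> node_weft j = 0 -> cl j b -> node_value j = b.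
Proof.
move=> jn depth_j weft_j cl_j.
have [known [v [view known_cs unrefuted]]] :=
  views (size_inputs_of jn depth_j weft_j) (inputs_of_lt d jn).
have := unrefuted _ _ jn cl_j; have := forces_complete view jn depth_j known_cs.
by case: (node_value j) b {cl_j} => [] [] // ->.
Qed.

Lemma claim_large j b : j < n -> node_depth j <= d -> node_weft j <= 1 ->
  conjunctive (g j) b -> 2 < size (args j) -> cl j b -> node_value j = b.
Proof.
move=> jn depth_j weft_j conj_j large cl_j.
have not_input : ~~ is_input (g j) by apply: contraL large => /is_input_args ->.
have not_not : is_not (g j) = false by case: (g j) large.
apply/eqP; rewrite node_value_args // /some_or_all conj_j; apply/allP => i ij.
have iN := args_ltn jn ij; have d0 : 0 < d.
  by case: (posnP d) depth_j => // -> /(node_depth0_input jn); rewrite (negbTE not_input).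
have depth_i : node_depth i <= d.-1 by apply: node_depth_arg jn ij _; rewrite prednK.
have weft_i : node_weft i = 0 by have := node_weft_arg jn ij; rewrite large; lia.
have inputs_le : size (inputs_of d.-1 i) <= 2 ^ d.
  by apply: leq_trans (size_inputs_of iN depth_i weft_i) _; rewrite leq_exp2l // leq_pred.
have [known [v [view known_cs unrefuted]]] := views inputs_le (inputs_of_lt _ iN).
have := unrefuted _ _ jn cl_j; apply: contraR => value_i.
rewrite -(prednK d0) /= (negbTE not_input) /some_or_all /conjunctive not_not.
have -> : (is_and (g j) == ~~ b) = false.
  by move: conj_j; rewrite /conjunctive not_not /= => /eqP->; case: (b).
apply/hasP; exists i => //; have := forces_complete view iN depth_i known_cs.
rewrite /arg_value not_not in value_i *.
by case: (node_value i) (b) value_i => [] [].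
Qed.

Lemma claim_true j b :
  j < n -> node_depth j <= d -> node_weft j <= 1 -> cl j b -> node_value j = b.
Proof.
elim/ltn_ind: j b => j IH b jn depth_j weft_j cl_j.
case: (eqVneq (node_weft j) 0) => [weft0|weft1]; first exact: claim_weft0.
have not_input : ~~ is_input (g j) by apply: contra_neqN weft1 => /(node_weft_input jn).
have := cl_justified jn cl_j; rewrite /justified weft_leP // leqn0 (negbTE weft1) /=.
case/orP=> [/andP[conj_j large]|supp]; first exact: claim_large.
apply/eqP; rewrite node_value_args //; apply: some_or_all_sub supp => i ij cl_i.
apply/eqP/IH => //; [exact: args_lt ij | exact: args_ltn ij | |].
  exact: node_depth_arg jn ij (leqW depth_j).
by apply: leq_trans weft_j; apply: leq_trans (node_weft_arg jn ij); apply: leq_addr.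
Qed.

End ClaimsSound.

Definition true_claims (L : seq nat) (j : nat) (b : bool) : bool :=
  (j \in L) && (node_value j == b).

Lemma true_claims_sub L L' : {subset L <= L'} ->
  forall j b, true_claims L j b -> true_claims L' j b.
Proof. by move=> sub j b; rewrite /true_claims => /andP[/sub-> ->]. Qed.

Lemma support_exists d j : j < n -> ~~ is_input (g j) ->
  exists r, [/\ {subset r <= args j}, size r <= 2 &
    justified d (true_claims r) j (node_value j)].
Proof.
move=> jn not_input; have := node_value_args (node_value j) jn not_input.
rewrite eqxx /justified /some_or_all => /esym; case: ifP => conj_j.
  move/allP=> args_true; case: (ltnP 2 (size (args j))) => [large|small].
    by exists [::]; split=> //; rewrite orbT.
  exists (args j); split=> //; apply/orP; right; apply/allP => i ij.
  by rewrite /true_claims ij args_true.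
case/hasP=> i ij value_i; exists [:: i]; split=> //.
  by move=> k; rewrite inE => /eqP->.
by apply/orP; right; apply/hasP; exists i; rewrite // /true_claims inE eqxx.
Qed.

(* The set of nodes of a proof tree for the values of the nodes in [r]. *)
Definition proof_nodes d (r L : seq nat) : Prop :=
  [/\ {subset r <= L}, all (fun i => i < n) L
    & {in L, forall i, justified d (true_claims L) i (node_value i)}].

Lemma proof_nodes_cat d r r' L L' :
  proof_nodes d r L -> proof_nodes d r' L' -> proof_nodes d (r ++ r') (L ++ L').
Proof.
move=> [rL L_lt L_just] [rL' L'_lt L'_just]; split.
- by move=> i; rewrite !mem_cat => /orP[/rL->|/rL'->]; rewrite ?orbT.
- by rewrite all_cat L_lt.
move=> i; rewrite mem_cat => /orP[/L_just|/L'_just]; apply: justified_sub;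
  apply: true_claims_sub => k kL; by rewrite mem_cat kL ?orbT.
Qed.

Lemma proof_nodes_cons d r L j : j < n ->
  justified d (true_claims r) j (node_value j) -> proof_nodes d r L ->
  proof_nodes d [:: j] (j :: L).
Proof.
move=> jn just_j [rL L_lt L_just]; have subL : {subset L <= j :: L}.
  by move=> i iL; rewrite inE iL orbT.
split; [by move=> i; rewrite !inE => /eqP->; rewrite eqxx | by rewrite /= jn |].
move=> i; rewrite inE => /predU1P[->|/L_just].
  apply: justified_sub just_j; apply: true_claims_sub => k /rL; exact: subL.
by apply: justified_sub; apply: true_claims_sub.
Qed.

Lemma proof_nodes_exists d D j :
  j < n -> node_depth j <= D -> D <= d -> node_weft j <= 1 ->
  exists2 L, proof_nodes d [:: j] L & size L < 2 ^ D.+1.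
Proof.
elim: D j => [|D IH] j jn depth_j Dd weft_j; case: (boolP (is_input (g j))) => input_j.
1,3: exists [:: j]; last exact: (@leq_pexp2l 2 1).
1,2: split=> [i|/=|i]; rewrite ?inE ?jn // => /eqP->;
  by rewrite /justified weft_leP ?(node_weft_input jn) // (leq_trans depth_j).
  by have := node_depth0_input jn depth_j; rewrite (negbTE input_j).
have [r [r_args size_r just_j]] := support_exists d jn input_j.
suff [L r_L size_L] : exists2 L, proof_nodes d r L & size L <= size r * (2 ^ D.+1).-1.
  exists (j :: L); first exact: proof_nodes_cons just_j r_L.
  have : 0 < 2 ^ D.+1 by rewrite expn_gt0.
  by rewrite /= (expnS 2 D.+1); nia.
elim: r r_args {size_r just_j} => [|i r IHr] r_args; first by exists [::].
have [|L r_L size_L] := IHr; first by move=> k kr; apply: r_args; rewrite inE kr orbT.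
have ij : i \in args j by apply: r_args; rewrite mem_head.
have [||||L' i_L' size_L'] := IH i.
- exact: args_ltn ij.
- exact: node_depth_arg depth_j.
- exact: ltnW.
- by apply: leq_trans weft_j; apply: leq_trans (node_weft_arg jn ij); apply: leq_addr.
exists (L' ++ L); first exact: proof_nodes_cat i_L' r_L.
by rewrite size_cat /= mulSn leq_add //; lia.
Qed.

End Values.
End CircuitTheory.

(** * Circuits of weft one *)

Definition circuit_check (d : nat) (x : seq bool) : bool :=
  let n := parsed_size x in
  [&& parse_ok x, 0 < n,
      all (fun j => all (fun i => i < j) (gate_args (parsed_gate x j))) (iota 0 n),
      depth_le (parsed_gate x) d n.-1 & weft_le (parsed_gate x) 1 d n.-1].

Lemma circuit_checkP d x (C := parsed_circuit x) :
  reflect [/\ parse_ok x, 0 < parsed_size x, circuit_wf C, circuit_weft C <= 1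
            & circuit_depth C <= d]
    (circuit_check d x).
Proof.
have wfP : reflect (circuit_wf C) (all (fun j => all (fun i => i < j)
    (gate_args (parsed_gate x j))) (iota 0 (parsed_size x))).
  apply: (iffP (all_iotaP _ _)) => wf j.
    by rewrite size_mkseq => jn; rewrite nth_mkseq // wf.
  by move=> jn; have := wf j; rewrite size_mkseq nth_mkseq // => /(_ jn).
rewrite /circuit_weft /circuit_depth !last_node_values size_mkseq.
rewrite -/(node_weft _ _ _) -/(node_depth _ _ _).
have last_lt : 0 < parsed_size x -> (parsed_size x).-1 < parsed_size x.
  by move=> n0; rewrite prednK.
apply: (iffP and5P) => [[ok n0 /wfP wf]|[ok n0 wf weft depth]].
  by rewrite (depth_leP wf) ?last_lt // => depth; rewrite (weft_leP wf) ?last_lt.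
by split=> //; [exact/wfP | rewrite (depth_leP wf) ?last_lt |
  rewrite (weft_leP wf) ?last_lt].
Qed.

Lemma WCS_parsedP d x k : WCS 1 d x k <-> circuit_check d x /\ exists a,
  circuit_weight a (parsed_circuit x) = k /\
  node_value (parsed_gate x) (parsed_size x) a (parsed_size x).-1.
Proof.
have valueE a : circuit_value a (parsed_circuit x) =
    node_value (parsed_gate x) (parsed_size x) a (parsed_size x).-1.
  by rewrite /circuit_value last_node_values size_mkseq.
split=> [[C [x_C wf weft depth [a [weight value]]]]|].
  have [ok C_E] := parse_complete x_C; subst C; split; last by exists a; rewrite -valueE.
  apply/circuit_checkP; split=> //; rewrite lt0n; apply: contraTneq value => n0.
  by rewrite /parsed_circuit n0.
case=> /circuit_checkP[ok n0 wf weft depth] [a [weight value]].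
exists (parsed_circuit x); split=> //; first exact: parse_sound.
by exists a; rewrite valueE.
Qed.

Section WeftOne.
Variables (d : nat) (x : seq bool) (k : nat).
Notation g := (parsed_gate x).
Notation n := (parsed_size x).
Notation C := (parsed_circuit x).

Definition num_intervals := 2 ^ d.
Definition num_claims := 2 ^ d.+1.
Definition num_vars := k.+2 ^ num_intervals.
Definition weft_base := num_vars + n.*2 + 5.
Definition weft_fields := (num_claims + num_intervals.*2).+1.

(* [(l, true)] is the upper end point of the interval [l]. *)
Definition endpoint : finType := ('I_num_intervals * bool)%type.

(* A vertex consists of an index in base [k + 2] with digits [i_l], a list of
   claims, and the intervals [X_{i_l}, X_{i_l + 1}], where
   [0 = X_0 < X_1 < ... < X_k < X_{k+1} = n + 1] lists the true inputs [j] as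
   [j + 1]. *)
Definition vindex u := digit weft_base u 0.
Definition vclaim u e := digit weft_base u e.+1.
Definition vpoint u (e : endpoint) := digit weft_base u (num_claims + (e.1.*2 + e.2)).+1.
Definition vrank u (e : endpoint) := digit k.+2 (vindex u) e.1 + e.2.

Definition vknown u c : bool :=
  has (fun l => (vpoint u (l, false) <= c.+1) && (c.+1 <= vpoint u (l, true)))
    (enum 'I_num_intervals).
Definition vtrue u c : bool := has (fun e => vpoint u e == c.+1) (enum endpoint).

(* The claim [2 j + b] asserts that node [j] has value [b]. *)
Definition vclaimed u j (b : bool) : bool :=
  has (fun e : 'I_num_claims => vclaim u e == j.*2 + b) (enum 'I_num_claims).

Definition points_agree u v : bool :=
  all (fun e => all (fun e' =>
    ((vrank u e < vrank v e') ==> (vpoint u e < vpoint v e')) &&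
    ((vrank u e == vrank v e') ==> (vpoint u e == vpoint v e')))
  (enum endpoint)) (enum endpoint).

Definition point_valid i p : bool :=
  [&& (i == 0) ==> (p == 0), (i == k.+1) ==> (p == n.+1)
    & ((0 < i) && (i <= k)) ==> is_input (g p.-1)].

Definition claim_valid u m : bool :=
  [&& m./2 < n, justified g d (vclaimed u) m./2 (odd m)
    & ~~ forces g (vknown u) (vtrue u) d (~~ odd m) m./2].

Definition weft_valid u : bool :=
  [&& circuit_check d x, vindex u < num_vars, points_agree u u,
      all (fun e => point_valid (vrank u e) (vpoint u e)) (enum endpoint),
      vclaim u 0 == n.-1.*2.+1 &
      all (fun e : 'I_num_claims => claim_valid u (vclaim u e)) (enum 'I_num_claims)].

Definition weft_pair u v : bool :=
  all (fun e : 'I_num_claims => vclaim u e == vclaim v e) (enum 'I_num_claims) &&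
  points_agree u v.

Definition weft_compat u v : bool :=
  [&& weft_valid u, weft_valid v, vindex u != vindex v & weft_pair u v].

Lemma num_intervals_gt0 : 0 < num_intervals. Proof. by rewrite expn_gt0. Qed.

Lemma num_claims_gt0 : 0 < num_claims. Proof. by rewrite expn_gt0. Qed.

Lemma num_vars_gt1 : 1 < num_vars.
Proof. by rewrite -(expn0 k.+2) ltn_exp2l ?num_intervals_gt0. Qed.

Lemma points_agreeP u v : reflect
  (forall e e', (vrank u e < vrank v e' -> vpoint u e < vpoint v e') /\
                (vrank u e = vrank v e' -> vpoint u e = vpoint v e'))
  (points_agree u v).
Proof.
apply: (iffP allP) => [agree e e'|agree e _].
  have /allP/(_ e') := agree e (mem_enum _ e); rewrite mem_enum => /(_ isT).
  by case/andP=> /implyP lt /implyP eq; split=> // /eqP/eq/eqP.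
apply/allP => e' _; have [lt eq] := agree e e'.
by apply/andP; split; apply/implyP => // /eqP/eq ->.
Qed.

Lemma half_claim j (b : bool) : (j.*2 + b)./2 = j.
Proof. by rewrite addnC half_bit_double. Qed.

Lemma odd_claim j (b : bool) : odd (j.*2 + b) = b.
Proof. by rewrite oddD odd_double oddb. Qed.

Record true_inputs (a : nat -> bool) (X : nat -> nat) : Prop := TrueInputs {
  true_inputs0 : X 0 = 0;
  true_inputs_last : X k.+1 = n.+1;
  true_inputs_lt : forall i i', i < i' -> i' <= k.+2 -> X i < X i';
  true_inputs_input : forall i, i < k -> is_input (g (X i.+1).-1);
  true_inputsP : forall c, c < n -> is_input (g c) ->
    a c = has (fun i => X i.+1 == c.+1) (iota 0 k) }.

Lemma weight_iotaE a :
  circuit_weight a C = count (fun j => is_input (g j) && a j) (iota 0 n).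
Proof.
rewrite /circuit_weight size_mkseq; apply: eq_in_count => j.
by rewrite mem_iota => jn; rewrite nth_mkseq.
Qed.

Section TrueInputs.
Variables (a : nat -> bool) (X : nat -> nat).
Hypothesis aX : true_inputs a X.

Lemma true_inputs_bounds i : i < k -> 0 < X i.+1 <= n.
Proof.
move=> ik; have := true_inputs_lt aX (ltn0Sn i) (leqW (leqW ik)).
have := true_inputs_lt aX (ik : i.+1 < k.+1) (leqnSn _).
by rewrite (true_inputs0 aX) (true_inputs_last aX) ltnS => -> ->.
Qed.

Lemma true_inputs_point i : i <= k.+2 -> point_valid i (X i).
Proof.
move=> ik; apply/and3P; split; apply/implyP.
- by move/eqP->; rewrite (true_inputs0 aX).
- by move/eqP->; rewrite (true_inputs_last aX).
by case: i {ik} => // i ik; apply: (true_inputs_input aX).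
Qed.

Lemma true_inputs_weight : circuit_weight a C = k.
Proof.
rewrite weight_iotaE -size_filter -[RHS](size_mkseq (fun i => (X i.+1).-1)).
have pred_XK i : i < k -> (X i.+1).-1.+1 = X i.+1.
  by move=> ik; rewrite prednK //; have /andP[] := true_inputs_bounds ik.
apply/perm_size/uniq_perm; first exact/filter_uniq/iota_uniq.
  rewrite map_inj_in_uniq ?iota_uniq // => i i'; rewrite !mem_iota /= => ik i'k e.
  have {}e : X i.+1 = X i'.+1 by rewrite -pred_XK // e pred_XK.
  have lt_neq m m' : m < m' -> m' < k -> X m.+1 <> X m'.+1.
    move=> mm m'k eX; have := true_inputs_lt aX (mm : m.+1 < m'.+1) (leqW (leqW m'k)).
    by rewrite eX ltnn.
  by case: (ltngtP i i') => // [/lt_neq/(_ i'k)|/lt_neq/(_ ik)]; rewrite e.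
move=> j; rewrite mem_filter mem_iota /= add0n; apply/andP/mapP.
  case=> /andP[input_j a_j] jn; move: a_j; rewrite (true_inputsP aX) //.
  by case/has_iotaP=> i ik /eqP e; exists i; rewrite ?mem_iota ?e.
case=> i; rewrite mem_iota => ik ->; have input_i := true_inputs_input aX ik.
have jn : (X i.+1).-1 < n.
  by rewrite -ltnS pred_XK //; have /andP[] := true_inputs_bounds ik.
split=> //; rewrite input_i (true_inputsP aX) //.
by apply/has_iotaP; exists i; rewrite ?pred_XK.
Qed.

Section Views.
Variable u : nat.
Hypothesis u_rank : forall e, vrank u e <= k.+2.
Hypothesis u_point : forall e, vpoint u e = X (vrank u e).

(* An interval contains no true input besides its end points. *)
Lemma view_sound c : c < n -> is_input (g c) -> vknown u c -> vtrue u c = a c.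
Proof.
move=> cn input_c /hasP[l _ /andP[lo_le hi_ge]].
rewrite (true_inputsP aX) //; apply/hasP/has_iotaP => [[e _ /eqP]|[i ik /eqP X_i]].
  rewrite u_point => X_e; have rank_e := u_rank e.
  have X_lt i i' : i < i' -> i' <= k.+2 -> X i < X i' := true_inputs_lt aX (i' := i').
  have rank_le : vrank u e <= k.
    rewrite leqNgt; apply/negP; rewrite leq_eqVlt => /predU1P[eq|gt].
      by move: X_e; rewrite -eq (true_inputs_last aX); lia.
    by have := X_lt _ _ gt rank_e; rewrite X_e (true_inputs_last aX); lia.
  case E : (vrank u e) X_e rank_le => [|i] X_e ik.
    by rewrite (true_inputs0 aX) in X_e.
  by exists i; rewrite ?X_e.
rewrite !u_point in lo_le hi_ge.
have lo_i : vrank u (l, false) <= i.+1.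
  rewrite leqNgt; apply/negP => gt; have := true_inputs_lt aX gt (u_rank _).
  by rewrite X_i ltnNge lo_le.
have hi_i : i.+1 <= vrank u (l, true).
  rewrite leqNgt; apply/negP => gt; have := true_inputs_lt aX gt (leqW (leqW ik)).
  by rewrite X_i ltnNge hi_ge.
have [e rank_e] : exists e, vrank u e = i.+1.
  have rank_true : vrank u (l, true) = (vrank u (l, false)).+1.
    by rewrite /vrank addn0 addn1.
  rewrite rank_true ltnS in hi_i; case: (eqVneq (vrank u (l, false)) i.+1) => [e|ne].
    by exists (l, false).
  by exists (l, true); rewrite rank_true; lia.
by exists e; rewrite ?mem_enum // u_point rank_e X_i.
Qed.

End Views.

Definition locate c := find (fun i => c.+1 <= X i.+1) (iota 0 k.+1).

Lemma locateP c : c < n -> locate c <= k /\ X (locate c) <= c.+1 <= X (locate c).+1.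
Proof.
move=> cn; have located : has (fun i => c.+1 <= X i.+1) (iota 0 k.+1).
  by apply/has_iotaP; exists k; rewrite // (true_inputs_last aX); lia.
have locate_lt : locate c < k.+1 by move: located; rewrite has_find size_iota.
split=> //; apply/andP; split; last by have := nth_find 0 located; rewrite nth_iota.
case E: (locate c) => [|j]; first by rewrite (true_inputs0 aX).
have j_lt : j < locate c by rewrite E.
have := before_find 0 j_lt; rewrite nth_iota ?add0n; last by lia.
by move/negbT; rewrite -ltnNge => /ltnW.
Qed.

End TrueInputs.

Section Sound.
Variable w : nat -> nat.
Hypothesis sol : solution (weft_base ^ weft_fields) num_vars weft_compat vindex w.

Lemma sol_index t : t < num_vars -> vindex (w t) = t.
Proof. by case/sol. Qed.

Lemma sol_weft_valid t : t < num_vars -> weft_valid (w t).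
Proof.
move=> tq; have [_ _ compat] := sol tq.
case: (eqVneq t 0) => [t0|t0].
  have t1 : t <> 1 by rewrite t0.
  by have /and4P[] := compat 1 num_vars_gt1 t1.
by have /and4P[] := compat 0 (ltnW num_vars_gt1) (elimN eqP t0).
Qed.

Lemma sol_weft_pair t t' : t < num_vars -> t' < num_vars -> weft_pair (w t) (w t').
Proof.
move=> tq tq'; case: (eqVneq t t') => [<-|ne].
  have /and5P[_ _ agree _ _] := sol_weft_valid tq; apply/andP; split=> //.
  exact/all_enum_ordP.
by have [_ _ /(_ t' tq' (elimN eqP ne))/and4P[]] := sol tq.
Qed.

Lemma sol_agree t t' e e' : t < num_vars -> t' < num_vars ->
  (vrank (w t) e < vrank (w t') e' -> vpoint (w t) e < vpoint (w t') e') /\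
  (vrank (w t) e = vrank (w t') e' -> vpoint (w t) e = vpoint (w t') e').
Proof. by move=> tq tq'; have /andP[_ /points_agreeP] := sol_weft_pair tq tq'. Qed.

Lemma sol_claim t t' (e : 'I_num_claims) : t < num_vars -> t' < num_vars ->
  vclaim (w t) e = vclaim (w t') e.
Proof.
by move=> tq tq'; have /andP[/all_enum_ordP/(_ e)/eqP] := sol_weft_pair tq tq'.
Qed.

Lemma sol_rank t e : t < num_vars -> vrank (w t) e = digit k.+2 t e.1 + e.2.
Proof. by move=> tq; rewrite /vrank sol_index. Qed.

Lemma sol_rank_le t e : t < num_vars -> vrank (w t) e <= k.+2.
Proof.
move=> tq; rewrite sol_rank //; have : digit k.+2 t e.1 < k.+2 by apply: ltn_mod.
by case: e.2; lia.
Qed.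

(* The end point of rank [i] in the vertex whose index has the constant digit
   [minn i k.+1]. *)
Definition rank_index i := of_digits k.+2 num_intervals (fun=> minn i k.+1).
Definition rank_endpoint i : endpoint := (Ordinal num_intervals_gt0, i == k.+2).
Definition sol_X i := vpoint (w (rank_index i)) (rank_endpoint i).

Lemma rank_index_lt i : rank_index i < num_vars.
Proof. by apply: of_digits_lt => _ _; lia. Qed.

Lemma rank_rank_index i : i <= k.+2 -> vrank (w (rank_index i)) (rank_endpoint i) = i.
Proof.
move=> ik; rewrite sol_rank ?rank_index_lt // digit_of_digits ?num_intervals_gt0 //=.
  by case: eqP; lia.
by move=> _ _; lia.
Qed.

Lemma sol_point t e : t < num_vars -> vpoint (w t) e = sol_X (vrank (w t) e).
Proof.
move=> tq; have rank_le := sol_rank_le e tq.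
set i := vrank (w t) e; have [_] := sol_agree e (rank_endpoint i) tq (rank_index_lt i).
by rewrite rank_rank_index //; apply.
Qed.

Lemma sol_X_lt i i' : i < i' -> i' <= k.+2 -> sol_X i < sol_X i'.
Proof.
move=> ii ik; have [lt _] := sol_agree (rank_endpoint i) (rank_endpoint i')
  (rank_index_lt i) (rank_index_lt i').
by apply: lt; rewrite !rank_rank_index //; lia.
Qed.

Lemma sol_X_valid i : i <= k.+2 -> point_valid i (sol_X i).
Proof.
move=> ik; have /and5P[_ _ _ /allP/(_ (rank_endpoint i)) valid _] :=
  sol_weft_valid (rank_index_lt i).
by rewrite mem_enum rank_rank_index // in valid; apply: valid.
Qed.

Definition sol_input c := has (fun i => sol_X i.+1 == c.+1) (iota 0 k).

Lemma sol_true_inputs : true_inputs sol_input sol_X.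
Proof.
split=> // [||i i' ii ik|i ik].
- by have /and3P[/eqP] := sol_X_valid (leq0n k.+2).
- by have /and3P[_ /implyP/(_ (eqxx _))/eqP] := sol_X_valid (leqnSn k.+1).
- exact: sol_X_lt.
- by have /and3P[_ _ /implyP] := sol_X_valid (leqW (leqW ik)); apply.
Qed.

Lemma sol_views cs : size cs <= 2 ^ d -> all (fun i => i < n) cs ->
  exists known v : pred nat,
    [/\ forall i, i < n -> is_input (g i) -> known i -> v i = sol_input i,
        {in cs, forall i, known i} &
        forall j b, j < n -> vclaimed (w 0) j b -> ~~ forces g known v d (~~ b) j].
Proof.
move=> size_cs cs_lt; have q0 := ltnW num_vars_gt1.
pose rank l := minn (locate sol_X (nth 0 cs l)) k.
pose t := of_digits k.+2 num_intervals rank.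
have tq : t < num_vars by apply: of_digits_lt => i _; rewrite /rank; lia.
exists (vknown (w t)), (vtrue (w t)); split.
- move=> i iN input_i; apply: (view_sound sol_true_inputs) => // e.
    exact: sol_rank_le.
  exact: sol_point.
- move=> i i_cs; have [locate_le X_locate] := locateP sol_true_inputs (allP cs_lt i i_cs).
  have l_lt : index i cs < num_intervals by apply: leq_trans size_cs; rewrite index_mem.
  have digitE : digit k.+2 t (index i cs) = locate sol_X i.
    rewrite digit_of_digits // => [|l _]; last by rewrite /rank; lia.
    by rewrite /rank nth_index // (minn_idPl locate_le).
  apply/hasP; exists (Ordinal l_lt); first by rewrite mem_enum.
  by rewrite !sol_point ?sol_rank //= digitE addn0 addn1.
move=> j b jn /has_enum_ordP[e /eqP claim_e].
have /and5P[_ _ _ _ /andP[_ /all_enum_ordP/(_ e)/and3P[_ _]]] := sol_weft_valid tq.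
by rewrite (sol_claim e tq q0) claim_e odd_claim half_claim.
Qed.

Lemma solution_WCS : WCS 1 d x k.
Proof.
have q0 := ltnW num_vars_gt1.
have /and5P[check _ _ _ /andP[/eqP output /all_enum_ordP claims]] := sol_weft_valid q0.
have /circuit_checkP[_ n0 wf weft depth] := check.
rewrite /circuit_weft /circuit_depth !last_node_values size_mkseq in weft depth.
apply/WCS_parsedP; split=> //; exists sol_input; split.
  exact: true_inputs_weight sol_true_inputs.
have n1 : n.-1 < n by rewrite prednK.
apply: (claim_true wf _ sol_views n1 depth weft).
  move=> j b jn /has_enum_ordP[e /eqP claim_e]; have /and3P[_ + _] := claims e.
  by rewrite claim_e odd_claim half_claim.
by apply/has_enum_ordP; exists (Ordinal num_claims_gt0); rewrite /= output addn1.
Qed.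

End Sound.

Lemma true_inputs_exist a :
  circuit_weight a C = k -> exists2 X, true_inputs a X & X k.+2 = n.+2.
Proof.
rewrite weight_iotaE => weight.
pose s := [seq j <- iota 0 n | is_input (g j) && a j].
have size_s : size s = k by rewrite size_filter.
have sP j : j \in s = [&& is_input (g j), a j & j < n].
  by rewrite mem_filter mem_iota /= add0n andbA.
have nth_s i : i < k -> nth 0 s i \in s by move=> ik; rewrite mem_nth ?size_s.
have s_lt : sorted ltn s.
  by apply: sorted_filter; [exact: ltn_trans | exact: iota_ltn_sorted].
pose X i := if i is i'.+1 then if i' < k then (nth 0 s i').+1 else n.+1 + (i' - k) else 0.
have XS i : i < k -> X i.+1 = (nth 0 s i).+1 by rewrite /X => ->.
exists X; last by rewrite /X ltnNge leqnSn subSnn addn1.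
split=> // [|i i' ii i'k|i ik|c cn input_c].
- by rewrite /X ltnn subnn addn0.
- case: i' i i'k ii => // i' [|i] i'k ii; rewrite /X; first by case: ifP.
  case: (ltnP i' k) => i'_k.
    have ik : i < k by lia.
    by rewrite ik ltnS; apply: (sorted_ltn_nth ltn_trans 0 s_lt); rewrite ?inE ?size_s.
  case: (ltnP i k) => ik; last by lia.
  by have := nth_s i ik; rewrite sP => /and3P[_ _]; lia.
- by have := nth_s i ik; rewrite XS // sP => /and3P[].
apply/idP/has_iotaP => [a_c|[i ik]]; last first.
  by rewrite XS // eqSS => /eqP <-; have := nth_s i ik; rewrite sP => /and3P[].
have c_s : c \in s by rewrite sP input_c a_c cn.
by exists (index c s); rewrite ?XS ?nth_index // -size_s index_mem.
Qed.

Section Complete.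
Variables (a : nat -> bool) (X : nat -> nat) (L : seq nat).
Hypotheses (check : circuit_check d x) (aX : true_inputs a X) (X_last : X k.+2 = n.+2).
Notation value := (node_value g n a).
Hypothesis output_true : value n.-1.
Hypothesis L_proof : proof_nodes g n a d [:: n.-1] L.
Hypothesis size_L : size L < num_claims.

Lemma true_inputs_le i : i <= k.+2 -> X i <= n.+2.
Proof.
rewrite leq_eqVlt => /predU1P[->|i_lt]; first by rewrite X_last.
by rewrite -X_last ltnW // (true_inputs_lt aX).
Qed.

Definition proof_node e := nth n.-1 (n.-1 :: L) e.
Definition proof_claim e := (proof_node e).*2 + value (proof_node e).

Lemma proof_node_in e : proof_node e \in L.
Proof.
have [sub _ _] := L_proof; have last_L : n.-1 \in L by apply: sub; rewrite inE.
rewrite /proof_node; case: (ltnP e (size L).+1) => e_lt; last by rewrite nth_default.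
by have := mem_nth n.-1 (e_lt : e < size (n.-1 :: L)); rewrite inE => /predU1P[->|].
Qed.

Lemma proof_node_lt e : proof_node e < n.
Proof. by have [_ /allP L_lt _] := L_proof; apply/L_lt/proof_node_in. Qed.

Definition weft_field t i : nat :=
  if i == 0 then t else if i <= num_claims then proof_claim i.-1
  else let m := i - num_claims.+1 in X (digit k.+2 t m./2 + odd m).

Lemma weft_field_lt t i : t < num_vars -> weft_field t i < weft_base.
Proof.
move=> tq; rewrite /weft_field /weft_base; case: ifP => _; first lia.
case: ifP => _.
  by rewrite /proof_claim; have := proof_node_lt i.-1; case: (value _); lia.
set m := i - _; have digit_lt : digit k.+2 t m./2 < k.+2 by apply: ltn_mod.
have rank_le : digit k.+2 t m./2 + odd m <= k.+2 by case: odd; lia.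
by have := true_inputs_le rank_le; rewrite /=; lia.
Qed.

Definition index_vertex t := of_digits weft_base weft_fields (weft_field t).

Lemma index_vertexE t i : t < num_vars -> i < weft_fields ->
  digit weft_base (index_vertex t) i = weft_field t i.
Proof. by move=> tq i_lt; apply: digit_of_digits => // j _; apply: weft_field_lt. Qed.

Lemma vindex_index_vertex t : t < num_vars -> vindex (index_vertex t) = t.
Proof. by move=> tq; rewrite /vindex index_vertexE. Qed.

Lemma vclaim_index_vertex t e :
  t < num_vars -> e < num_claims -> vclaim (index_vertex t) e = proof_claim e.
Proof.
move=> tq e_lt; rewrite /vclaim index_vertexE ?/weft_field /= ?e_lt //.
by rewrite /weft_fields; lia.
Qed.

Lemma vrank_index_vertex_le t e : t < num_vars -> vrank (index_vertex t) e <= k.+2.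
Proof.
move=> tq; rewrite /vrank vindex_index_vertex //.
have : digit k.+2 t e.1 < k.+2 by apply: ltn_mod.
by case: e.2; lia.
Qed.

Lemma vpoint_index_vertex t e : t < num_vars ->
  vpoint (index_vertex t) e = X (vrank (index_vertex t) e).
Proof.
move=> tq; rewrite /vpoint /vrank vindex_index_vertex //.
have e_lt : e.1.*2 + e.2 < num_intervals.*2.
  by have := ltn_ord e.1; case: e.2; lia.
rewrite index_vertexE //; last by rewrite /weft_fields ltnS ltn_add2l.
by rewrite /weft_field /= ltnNge leq_addr /= subSS addKn half_claim odd_claim.
Qed.

Lemma index_vertex_agree t t' : t < num_vars -> t' < num_vars ->
  points_agree (index_vertex t) (index_vertex t').
Proof.
move=> tq tq'; apply/points_agreeP => e e'; rewrite !vpoint_index_vertex //.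
split=> [lt|->//]; apply: (true_inputs_lt aX lt); exact: vrank_index_vertex_le.
Qed.

Lemma index_vertex_claims t j b : t < num_vars ->
  true_claims g n a L j b -> vclaimed (index_vertex t) j b.
Proof.
move=> tq /andP[jL /eqP<-]; have j_in : j \in n.-1 :: L by rewrite inE jL orbT.
have e_lt : index j (n.-1 :: L) < num_claims.
  by apply: leq_trans size_L; rewrite -[(size L).+1]/(size (n.-1 :: L)) index_mem.
apply/has_enum_ordP; exists (Ordinal e_lt).
by rewrite vclaim_index_vertex // /proof_claim /proof_node nth_index.
Qed.

Lemma index_vertex_claim_valid t e : t < num_vars -> e < num_claims ->
  claim_valid (index_vertex t) (vclaim (index_vertex t) e).
Proof.
move=> tq e_lt; rewrite vclaim_index_vertex // /claim_valid /proof_claim.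
rewrite odd_claim half_claim proof_node_lt /=; have [_ _ L_just] := L_proof.
rewrite (justified_sub _ (L_just _ (proof_node_in e))) /=; last first.
  by move=> j b; apply: index_vertex_claims.
have /circuit_checkP[_ _ wf _ _] := check.
have view : forall i, i < n -> is_input (g i) -> vknown (index_vertex t) i ->
    vtrue (index_vertex t) i = a i.
  apply: (view_sound aX) => e'; first exact: vrank_index_vertex_le.
  exact: vpoint_index_vertex.
by apply/negP => /(forces_sound wf view (proof_node_lt e)); case: (value _).
Qed.

Lemma index_vertex_valid t : t < num_vars -> weft_valid (index_vertex t).
Proof.
move=> tq; apply/and5P; split; rewrite ?vindex_index_vertex ?index_vertex_agree //.
  apply/allP => e _; rewrite vpoint_index_vertex // (true_inputs_point aX) //.
  exact: vrank_index_vertex_le.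
rewrite vclaim_index_vertex ?num_claims_gt0 // /proof_claim /= output_true addn1 eqxx.
by apply/all_enum_ordP => e; apply: index_vertex_claim_valid.
Qed.

Lemma index_vertex_solution :
  solution (weft_base ^ weft_fields) num_vars weft_compat vindex index_vertex.
Proof.
move=> t tq; split; [| exact: vindex_index_vertex |].
  by apply: of_digits_lt => i _; apply: weft_field_lt.
move=> t' tq' ne; apply/and4P; split; rewrite ?index_vertex_valid ?vindex_index_vertex //.
  exact/eqP.
rewrite /weft_pair index_vertex_agree // andbT; apply/all_enum_ordP => e.
by rewrite !vclaim_index_vertex.
Qed.

End Complete.

Lemma WCS_solution :
  WCS 1 d x k ->
  exists w, solution (weft_base ^ weft_fields) num_vars weft_compat vindex w.
Proof.
case/WCS_parsedP=> check [a [weight output]].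
have /circuit_checkP[_ n0 wf weft depth] := check.
rewrite /circuit_weft /circuit_depth !last_node_values size_mkseq in weft depth.
have [X aX X_last] := true_inputs_exist weight.
have n1 : n.-1 < n by rewrite prednK.
have [L L_proof size_L] := proof_nodes_exists wf a n1 depth (leqnn d) weft.
by exists (index_vertex a X L); apply: index_vertex_solution.
Qed.

Lemma weft_cliqueP :
  has_clique (weft_base ^ weft_fields) num_vars weft_compat <-> WCS 1 d x k.
Proof.
have index_lt u v : weft_compat u v -> vindex u < num_vars /\ vindex u <> vindex v.
  by case/and4P=> /and5P[_ index_u _ _ _] _ /eqP.
rewrite (has_cliqueP _ num_vars_gt1 index_lt); split=> [[w]|]; first exact: solution_WCS.
exact: WCS_solution.
Qed.

End WeftOne.

Lemma polytime_depth_le D S F : polytime_str S -> polytime_nat F ->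
  polytime_bool (fun c => depth_le (parsed_gate (S c)) D (F c)).
Proof. by elim: D S F => [|D IH] S F hS hF /=; polytime_tac. Qed.

Lemma polytime_weft_le t D S F : polytime_str S -> polytime_nat F ->
  polytime_bool (fun c => weft_le (parsed_gate (S c)) t D (F c)).
Proof. by elim: D t S F => [|D IH] [|t] S F hS hF /=; polytime_tac. Qed.

#[local] Hint Resolve polytime_depth_le polytime_weft_le : polytime.

Lemma polytime_circuit_check d S :
  polytime_str S -> polytime_bool (fun c => circuit_check d (S c)).
Proof. by move=> hS; rewrite /circuit_check /parse_ok /=; polytime_tac. Qed.

Lemma polytime_addb P Q :
  polytime_bool P -> polytime_bool Q -> polytime_bool (fun c => P c (+) Q c).
Proof.
move=> hP hQ; apply: polytime_ext (polytime_bool_if hP (polytime_negb hQ) hQ) => c.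
by case: (P c).
Qed.

#[local] Hint Resolve polytime_circuit_check polytime_addb : polytime.

Lemma polytime_some_or_all S F P (Q : ctx -> nat -> bool) :
  polytime_str S -> polytime_nat F -> polytime_bool P ->
  (forall G, polytime_nat G -> polytime_bool (fun c => Q (pop c) (G c))) ->
  polytime_bool (fun c => some_or_all (parsed_gate (S c) (F c)) (P c) (Q c)
    (gate_args (parsed_gate (S c) (F c)))).
Proof. by move=> hS hF hP hQ; rewrite /some_or_all /conjunctive; polytime_tac. Qed.

#[local] Hint Resolve polytime_some_or_all : polytime.

Section WeftPolytime.
Variable d : nat.

Lemma polytime_weft_base S K :
  polytime_str S -> polytime_nat K -> polytime_nat (fun c => weft_base d (S c) (K c)).
Proof. by move=> hS hK; rewrite /weft_base /num_vars; polytime_tac. Qed.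

#[local] Hint Resolve polytime_weft_base : polytime.

Lemma polytime_vpoint S K U e : polytime_str S -> polytime_nat K -> polytime_nat U ->
  polytime_nat (fun c => vpoint (S c) (K c) (U c) (e : endpoint d)).
Proof. by move=> hS hK hU; rewrite /vpoint; polytime_tac. Qed.

Lemma polytime_vrank S K U e : polytime_str S -> polytime_nat K -> polytime_nat U ->
  polytime_nat (fun c => vrank (S c) (K c) (U c) (e : endpoint d)).
Proof. by move=> hS hK hU; rewrite /vrank /vindex; polytime_tac. Qed.

Lemma polytime_vclaim S K U e : polytime_str S -> polytime_nat K -> polytime_nat U ->
  polytime_nat (fun c => vclaim d (S c) (K c) (U c) e).
Proof. by move=> hS hK hU; rewrite /vclaim; polytime_tac. Qed.

End WeftPolytime.

#[local] Hint Resolve polytime_weft_base polytime_vpoint polytime_vrank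
  polytime_vclaim : polytime.

Lemma polytime_vknown d S K U F :
  polytime_str S -> polytime_nat K -> polytime_nat U -> polytime_nat F ->
  polytime_bool (fun c => vknown d (S c) (K c) (U c) (F c)).
Proof. by move=> hS hK hU hF; rewrite /vknown; polytime_tac. Qed.

Lemma polytime_vtrue d S K U F :
  polytime_str S -> polytime_nat K -> polytime_nat U -> polytime_nat F ->
  polytime_bool (fun c => vtrue d (S c) (K c) (U c) (F c)).
Proof. by move=> hS hK hU hF; rewrite /vtrue; polytime_tac. Qed.

Lemma polytime_vclaimed d S K U F P : polytime_str S -> polytime_nat K ->
  polytime_nat U -> polytime_nat F -> polytime_bool P ->
  polytime_bool (fun c => vclaimed d (S c) (K c) (U c) (F c) (P c)).
Proof. by move=> hS hK hU hF hP; rewrite /vclaimed; polytime_tac. Qed.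

#[local] Hint Resolve polytime_vknown polytime_vtrue polytime_vclaimed : polytime.

Lemma polytime_arg_value S F P :
  polytime_str S -> polytime_nat F -> polytime_bool P ->
  polytime_bool (fun c => arg_value (parsed_gate (S c) (F c)) (P c)).
Proof. by move=> hS hF hP; rewrite /arg_value; polytime_tac. Qed.

#[local] Hint Resolve polytime_arg_value : polytime.

Lemma polytime_forces d D S K U P F : polytime_str S -> polytime_nat K ->
  polytime_nat U -> polytime_bool P -> polytime_nat F ->
  polytime_bool (fun c => forces (parsed_gate (S c)) (vknown d (S c) (K c) (U c))
    (vtrue d (S c) (K c) (U c)) D (P c) (F c)).
Proof. by elim: D S K U P F => [|D IH] S K U P F hS hK hU hP hF /=; polytime_tac. Qed.

Lemma polytime_justified d S K U F P : polytime_str S -> polytime_nat K ->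
  polytime_nat U -> polytime_nat F -> polytime_bool P ->
  polytime_bool (fun c =>
    justified (parsed_gate (S c)) d (vclaimed d (S c) (K c) (U c)) (F c) (P c)).
Proof.
by move=> hS hK hU hF hP; rewrite /justified /conjunctive; polytime_tac.
Qed.

Lemma polytime_points_agree d S K U V : polytime_str S -> polytime_nat K ->
  polytime_nat U -> polytime_nat V ->
  polytime_bool (fun c => points_agree d (S c) (K c) (U c) (V c)).
Proof. by move=> hS hK hU hV; rewrite /points_agree; polytime_tac. Qed.

#[local] Hint Resolve polytime_forces polytime_justified polytime_points_agree : polytime.

Lemma polytime_weft_valid d S K U : polytime_str S -> polytime_nat K ->
  polytime_nat U -> polytime_bool (fun c => weft_valid d (S c) (K c) (U c)).
Proof.
move=> hS hK hU; rewrite /weft_valid /num_vars /point_valid /claim_valid /vindex.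
polytime_tac.
Qed.

#[local] Hint Resolve polytime_weft_valid : polytime.

Lemma polytime_weft_compat d S K U V : polytime_str S -> polytime_nat K ->
  polytime_nat U -> polytime_nat V ->
  polytime_bool (fun c => weft_compat d (S c) (K c) (U c) (V c)).
Proof.
by move=> hS hK hU hV; rewrite /weft_compat /weft_pair /vindex; polytime_tac.
Qed.

Theorem identification_W1_hard H : sparse_class H -> W1_hard (Identification_dual H).
Proof.
move=> sparse_H P [d P_WCS].
pose K z := size (pair_fst z); pose q z := num_vars d (K z).
pose N z := weft_base d (pair_snd z) (K z) ^ weft_fields d.
pose inst z := clique_instance (N z) (q z) (weft_compat d (pair_snd z) (K z)).
have paramK x k : pair_snd (param_str x k) = x /\ K (param_str x k) = k.
  by have [_ fst_x snd_x] := pair_strK (nseq k true) x; rewrite /K fst_x size_nseq.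
apply: (@fpt_reduces_polytime P (WCS 1 d) _ inst (fun z => (q z).+1)
  (fun k => (num_vars d k).+1)) => //.
- have hcompat := polytime_weft_compat d; rewrite /q /K /inst /N /q /num_vars.
  apply: polytime_pair_str; first by polytime_tac.
  by apply: polytime_clique_instance; rewrite /K; polytime_tac.
- move=> x k; rewrite /q /inst /N /q; have [-> ->] := paramK x k.
  rewrite (identification_dual_clique_instance sparse_H) ?weft_cliqueP //.
  rewrite /weft_fields expnS; apply: leq_trans (leq_pmulr _ _).
    by rewrite /weft_base; lia.
  by rewrite expn_gt0 /weft_base addnS.
- by move=> x k; rewrite /q; have [_ ->] := paramK x k.
- by move=> m n mn; rewrite ltnS; apply: leq_expl.
- by rewrite /num_vars; polytime_tac.
Qed.

Theorem theorem3p1 (H : sgraph -> Prop)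
  (H_class : H = is_star \/ H = is_tree \/ H = is_forest) :
  NP_complete (Identification H) /\ W1_hard (Identification_dual H).
Proof.
split; last exact: identification_W1_hard.
by split; [apply: identification_in_NP | apply: identification_NP_hard].
Qed.
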